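(* The system $\mathsf{RCA}_0^\omega+\mathsf{FF}+\mathsf{QF\text{-}AC}^{2,1}$ proves $(\exists^2)\leftrightarrow[\mathsf{UATR}\vee\neg\mathsf{HBU}]$.
   Context: Work in the language $\mathsf{L}_\omega$ of higher-order arithmetic with variables of all finite types: $0$ is the type of natural numbers and $\sigma\to\tau$ the type of mappings; $1=0\to0$, $2=1\to0$, $3=2\to0$. Equality at higher types is pointwise; $\le_\tau$ pointwise via $\le_0$. $\mathsf{RCA}_0^\omega$ is Kohlenbach's base theory: basic axioms making $0,1,<,+,\times$ an ordered semiring, the combinators $K,S$, the recursor $\mathbf{R}_0$ ($\mathbf{R}_0(f,m,0)=m$, $\mathbf{R}_0(f,m,n+1)=f(\mathbf{R}_0(f,m,n))$), extensionality at all types, quantifier-free induction, and $\mathsf{QF\text{-}AC}^{1,0}$. $\mathsf{QF\text{-}AC}^{\sigma,\tau}$ is the schema $(\forall x^\sigma)(\exists y^\tau)A(x,y)\to(\exists Y^{\sigma\to\tau})(\forall x^\sigma)A(x,Y(x))$ for quantifier-free $A$. $\overline{f}n=\langle f(0),\dots,f(n-1)\rangle$; $C$ is the set of $f^1\le_1 1$. Reals are represented by type-1 objects coding fast-converging Cauchy sequences of rationals with equality $=_{\mathbb R}$; a function $\Psi:\mathbb R\to\mathbb R^+$ is a type $1\to1$ object mapping reals to positive reals and respecting $=_{\mathbb R}$. $I=[0,1]$, $I^\Psi_x=(x-\Psi(x),x+\Psi(x))$. $(\exists^2)$: $(\exists\varphi^2\le_2 1)(\forall f^1)\big[(\exists n^0)(f(n)=0)\leftrightarrow\varphi(f)=0\big]$.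 $\mathsf{FF}$: $(\exists\Phi^3)(\forall Y^2\in\mathsf{cont})(\forall f,g\in C)(\overline f\Phi(Y)=\overline g\Phi(Y)\to Y(f)=Y(g))$, where $Y\in\mathsf{cont}$ means $(\forall f^1)(\exists N^0)(\forall g^1)(\overline fN=\overline gN\to Y(f)=Y(g))$. $\mathsf{HBU}$: $(\forall\Psi:\mathbb R\to\mathbb R^+)(\exists\langle y_1,\dots,y_k\rangle)(\forall x\in I)(\exists i\le k)(x\in I^\Psi_{y_i})$. $\mathsf{UATR}$: $(\exists\Phi)(\forall X^1,f^1)\big[\mathsf{WO}(X)\to H_f(X,\Phi(X,f))\big]$, where $\Phi$ maps pairs of type-1 objects to type-1 objects; $\mathsf{WO}(X)$ expresses that $X$ codes a countable well-ordering; and, for a formula $\theta(n,Z)$, $H_\theta(X,Y)$ expresses that $Y$ is the result of iterating $\theta$ along $X$ (for each $j$ in the field of $X$, $Y_j=\{n:\theta(n,Y^j)\}$ where $Y^j=\{(m,i): i<_X j,\ m\in Y_i\}$, as in Simpson's Subsystems of Second Order Arithmetic, Ch. V); $H_f$ is $H_\theta$ with $\theta(n,Z)\equiv(\exists m^0)(f(n,m,\overline Zm)=0)$. *)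

(* Defs.v *)
From Stdlib Require Import List.
Import ListNotations.

Set Implicit Arguments.
Unset Strict Implicit.
Unset Printing Implicit Defensive.

(* Well-typed de Bruijn syntax: [var Γ σ], [tm Γ σ] and [form Γ] only contain
   the free variables declared in the context [Γ], the most recently bound
   variable coming first.  Every finite type has a closed inhabitant, so free
   variables that have been declared but do not occur are harmless. *)

Inductive ty : Set := N | Arr (σ τ : ty).

Declare Scope ty_scope.
Delimit Scope ty_scope with ty.
Bind Scope ty_scope with ty.
Notation "σ ⇒ τ" := (Arr σ τ) (at level 55, right associativity) : ty_scope.
Local Open Scope ty_scope.

Definition ty1 : ty := N ⇒ N.
Definition ty2 : ty := ty1 ⇒ N.
Definition ty3 : ty := ty2 ⇒ N.

Definition ctx : Set := list ty.

Inductive var : ctx -> ty -> Set :=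
| vz : forall Γ σ, var (σ :: Γ) σ
| vs : forall Γ σ τ, var Γ σ -> var (τ :: Γ) σ.
Arguments vz {Γ σ}.
Arguments vs {Γ σ τ} v.

Inductive tm (Γ : ctx) : ty -> Set :=
| Var : forall σ, var Γ σ -> tm Γ σ
| App : forall σ τ, tm Γ (σ ⇒ τ) -> tm Γ σ -> tm Γ τ
| Zero : tm Γ N
| One : tm Γ N
| Plus : tm Γ (N ⇒ N ⇒ N)
| Times : tm Γ (N ⇒ N ⇒ N)
| CombK : forall σ τ, tm Γ (σ ⇒ τ ⇒ σ)
| CombS : forall ρ σ τ, tm Γ ((ρ ⇒ σ ⇒ τ) ⇒ (ρ ⇒ σ) ⇒ ρ ⇒ τ)
| Rec0 : tm Γ (ty1 ⇒ N ⇒ N ⇒ N).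
Arguments Zero {Γ}.
Arguments One {Γ}.
Arguments Plus {Γ}.
Arguments Times {Γ}.
Arguments CombK {Γ} σ τ.
Arguments CombS {Γ} ρ σ τ.
Arguments Rec0 {Γ}.

Inductive form : ctx -> Set :=
| Eq : forall Γ, tm Γ N -> tm Γ N -> form Γ
| Lt : forall Γ, tm Γ N -> tm Γ N -> form Γ
| Bot : forall Γ, form Γ
| And : forall Γ, form Γ -> form Γ -> form Γ
| Or : forall Γ, form Γ -> form Γ -> form Γ
| Imp : forall Γ, form Γ -> form Γ -> form Γ
| All : forall Γ σ, form (σ :: Γ) -> form Γ
| Ex : forall Γ σ, form (σ :: Γ) -> form Γ.
Arguments Bot {Γ}.

Definition sentence : Set := form [].

Fixpoint quantifier_free Γ (A : form Γ) : Prop :=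
  match A with
  | Eq _ _ | Lt _ _ | Bot => True
  | And B C | Or B C | Imp B C => quantifier_free B /\ quantifier_free C
  | All _ | Ex _ => False
  end.

Definition ren (Γ Δ : ctx) : Type := forall σ, var Γ σ -> var Δ σ.
Definition sub (Γ Δ : ctx) : Type := forall σ, var Γ σ -> tm Δ σ.

Definition var_case Γ τ (P : ty -> Type) (z : P τ) (s : forall σ, var Γ σ -> P σ)
    σ (v : var (τ :: Γ) σ) : P σ :=
  match v in var Γ' σ'
    return match Γ' with
           | [] => unit
           | τ' :: Γ'' => P τ' -> (forall ρ, var Γ'' ρ -> P ρ) -> P σ'
           end
  with
  | vz => fun z _ => z
  | vs w => fun _ s => s _ w
  end z s.

Definition up_ren Γ Δ τ (r : ren Γ Δ) : ren (τ :: Γ) (τ :: Δ) :=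
  var_case (P := var (τ :: Δ)) vz (fun σ v => vs (r σ v)).

Fixpoint ren_tm Γ Δ (r : ren Γ Δ) σ (t : tm Γ σ) : tm Δ σ :=
  match t with
  | Var v => Var (r _ v)
  | App t u => App (ren_tm r t) (ren_tm r u)
  | Zero => Zero
  | One => One
  | Plus => Plus
  | Times => Times
  | CombK σ τ => CombK σ τ
  | CombS ρ σ τ => CombS ρ σ τ
  | Rec0 => Rec0
  end.

Fixpoint ren_form Γ (A : form Γ) : forall Δ, ren Γ Δ -> form Δ :=
  match A with
  | Eq s t => fun _ r => Eq (ren_tm r s) (ren_tm r t)
  | Lt s t => fun _ r => Lt (ren_tm r s) (ren_tm r t)
  | Bot => fun _ _ => Bot
  | And B C => fun _ r => And (ren_form B r) (ren_form C r)
  | Or B C => fun _ r => Or (ren_form B r) (ren_form C r)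
  | Imp B C => fun _ r => Imp (ren_form B r) (ren_form C r)
  | All B => fun _ r => All (ren_form B (up_ren r))
  | Ex B => fun _ r => Ex (ren_form B (up_ren r))
  end.

Definition shift Γ τ : ren Γ (τ :: Γ) := fun σ v => vs v.
Arguments shift {Γ τ} σ v.

Definition up_sub Γ Δ τ (s : sub Γ Δ) : sub (τ :: Γ) (τ :: Δ) :=
  var_case (P := tm (τ :: Δ)) (Var vz) (fun σ v => ren_tm shift (s σ v)).

Fixpoint sub_tm Γ Δ (s : sub Γ Δ) σ (t : tm Γ σ) : tm Δ σ :=
  match t with
  | Var v => s _ v
  | App t u => App (sub_tm s t) (sub_tm s u)
  | Zero => Zero
  | One => One
  | Plus => Plus
  | Times => Times
  | CombK σ τ => CombK σ τ
  | CombS ρ σ τ => CombS ρ σ τ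
  | Rec0 => Rec0
  end.

Fixpoint sub_form Γ (A : form Γ) : forall Δ, sub Γ Δ -> form Δ :=
  match A with
  | Eq t u => fun _ s => Eq (sub_tm s t) (sub_tm s u)
  | Lt t u => fun _ s => Lt (sub_tm s t) (sub_tm s u)
  | Bot => fun _ _ => Bot
  | And B C => fun _ s => And (sub_form B s) (sub_form C s)
  | Or B C => fun _ s => Or (sub_form B s) (sub_form C s)
  | Imp B C => fun _ s => Imp (sub_form B s) (sub_form C s)
  | All B => fun _ s => All (sub_form B (up_sub s))
  | Ex B => fun _ s => Ex (sub_form B (up_sub s))
  end.

Definition inst Γ τ (A : form (τ :: Γ)) (t : tm Γ τ) : form Γ :=
  sub_form A (var_case (P := tm Γ) t (fun σ v => Var v)).

Definition Neg Γ (A : form Γ) : form Γ := Imp A Bot.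
Definition Iff Γ (A B : form Γ) : form Γ := And (Imp A B) (Imp B A).

(* The axioms of a theory may contain free variables (parameters). *)
Definition theory : Type := forall Γ, form Γ -> Prop.

(* Classical natural deduction with equality at type 0; equality at higher
   types is the pointwise [eq_at] below. *)
Inductive prv (T : theory) : forall Γ, list (form Γ) -> form Γ -> Prop :=
| prv_hyp : forall Γ (H : list (form Γ)) A, In A H -> prv T H A
| prv_ax : forall Γ (H : list (form Γ)) A, T Γ A -> prv T H A
| prv_and_intro : forall Γ (H : list (form Γ)) A B,
    prv T H A -> prv T H B -> prv T H (And A B)
| prv_and_elim1 : forall Γ (H : list (form Γ)) A B, prv T H (And A B) -> prv T H A
| prv_and_elim2 : forall Γ (H : list (form Γ)) A B, prv T H (And A B) -> prv T H B
| prv_or_intro1 : forall Γ (H : list (form Γ)) A B, prv T H A -> prv T H (Or A B)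
| prv_or_intro2 : forall Γ (H : list (form Γ)) A B, prv T H B -> prv T H (Or A B)
| prv_or_elim : forall Γ (H : list (form Γ)) A B C,
    prv T H (Or A B) -> prv T (A :: H) C -> prv T (B :: H) C -> prv T H C
| prv_imp_intro : forall Γ (H : list (form Γ)) A B,
    prv T (A :: H) B -> prv T H (Imp A B)
| prv_imp_elim : forall Γ (H : list (form Γ)) A B,
    prv T H (Imp A B) -> prv T H A -> prv T H B
| prv_raa : forall Γ (H : list (form Γ)) A, prv T (Neg A :: H) Bot -> prv T H A
| prv_all_intro : forall Γ (H : list (form Γ)) σ (A : form (σ :: Γ)),
    prv T (map (fun B => ren_form B shift) H) A -> prv T H (All A)
| prv_all_elim : forall Γ (H : list (form Γ)) σ (A : form (σ :: Γ)) (t : tm Γ σ),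
    prv T H (All A) -> prv T H (inst A t)
| prv_ex_intro : forall Γ (H : list (form Γ)) σ (A : form (σ :: Γ)) (t : tm Γ σ),
    prv T H (inst A t) -> prv T H (Ex A)
| prv_ex_elim : forall Γ (H : list (form Γ)) σ (A : form (σ :: Γ)) (C : form Γ),
    prv T H (Ex A) ->
    prv T (A :: map (fun B => ren_form B shift) H) (ren_form C shift) ->
    prv T H C
| prv_eq_refl : forall Γ (H : list (form Γ)) (t : tm Γ N), prv T H (Eq t t)
| prv_eq_subst : forall Γ (H : list (form Γ)) (A : form (N :: Γ)) (s t : tm Γ N),
    prv T H (Eq s t) -> prv T H (inst A s) -> prv T H (inst A t).

Definition proves (T : theory) (A : sentence) : Prop := prv T [] A.

(* In [∀ x : σ, A] and [∃ x : σ, A] the identifier [x] stands for de Bruijn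
   variable 0 of the extended context.  [↑t] weakens a term to the ambient
   context; the weakening is found by instance resolution and is unambiguous,
   since the source context has to be a suffix of the target one. *)

Class Ext (Γ Δ : ctx) : Type := ext_ren : ren Γ Δ.
#[export] Instance Ext_refl Γ : Ext Γ Γ | 0 := fun σ v => v.
#[export] Instance Ext_cons Γ Δ τ {e : Ext Γ Δ} : Ext Γ (τ :: Δ) | 1 :=
  fun σ v => vs (e σ v).

Definition weaken Γ Δ (e : Ext Γ Δ) σ (t : tm Γ σ) : tm Δ σ := ren_tm e t.

Definition all Γ σ (F : tm (σ :: Γ) σ -> form (σ :: Γ)) : form Γ := All (F (Var vz)).
Definition ex Γ σ (F : tm (σ :: Γ) σ -> form (σ :: Γ)) : form Γ := Ex (F (Var vz)).
Arguments all {Γ} σ F.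
Arguments ex {Γ} σ F.

Definition plus Γ (s t : tm Γ N) : tm Γ N := App (App Plus s) t.
Definition times Γ (s t : tm Γ N) : tm Γ N := App (App Times s) t.

Declare Scope L_scope.
Delimit Scope L_scope with L.
Bind Scope L_scope with tm.
Bind Scope L_scope with form.
Notation "↑ t" := (weaken _ t) (at level 9, t at level 9, format "↑ t") : L_scope.
Notation "s · t" := (App s t) (at level 34, left associativity) : L_scope.
Notation "s + t" := (plus s t) : L_scope.
Notation "s * t" := (times s t) : L_scope.
Notation "0" := Zero : L_scope.
Notation "1" := One : L_scope.
Notation "2" := (plus One One) : L_scope.
Notation "s ≐ t" := (Eq s t) (at level 70, no associativity) : L_scope.
Notation "s ≺ t" := (Lt s t) (at level 70, no associativity) : L_scope.
Notation "s ≼ t" := (Or (Lt s t) (Eq s t)) (at level 70, no associativity) : L_scope.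
Notation "¬ A" := (Neg A) (at level 75, right associativity) : L_scope.
Notation "A ∧ B" := (And A B) (at level 80, right associativity) : L_scope.
Notation "A ∨ B" := (Or A B) (at level 85, right associativity) : L_scope.
Notation "A → B" := (Imp A B) (at level 99, B at level 200, right associativity) : L_scope.
Notation "A ↔ B" := (Iff A B) (at level 95, no associativity) : L_scope.
Notation "∀ x : σ , A" := (all σ (fun x => A))
  (at level 200, x name, σ at level 60, A at level 200, right associativity) : L_scope.
Notation "∃ x : σ , A" := (ex σ (fun x => A))
  (at level 200, x name, σ at level 60, A at level 200, right associativity) : L_scope.
Notation "T ⊢ A" := (proves T A%L) (at level 100, no associativity).
Local Open Scope L_scope.

Fixpoint eq_at (τ : ty) : forall Γ, tm Γ τ -> tm Γ τ -> form Γ :=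
  match τ with
  | N => fun _ s t => s ≐ t
  | ρ ⇒ τ' => fun _ s t => ∀ x : ρ, eq_at (↑s · x) (↑t · x)
  end.

Fixpoint le_at (τ : ty) : forall Γ, tm Γ τ -> tm Γ τ -> form Γ :=
  match τ with
  | N => fun _ s t => s ≼ t
  | ρ ⇒ τ' => fun _ s t => ∀ x : ρ, le_at (↑s · x) (↑t · x)
  end.

(* The number 1 lifted to a constant functional of each type. *)
Fixpoint one_at (τ : ty) : forall Γ, tm Γ τ :=
  match τ with
  | N => fun _ => 1
  | ρ ⇒ τ' => fun Γ => CombK τ' ρ · one_at τ' Γ
  end.
Arguments one_at τ {Γ}.

(* Discretely ordered commutative semiring, naturally ordered with least
   element 0. *)
Definition basic_axioms Γ : list (form Γ) :=
  [ ∀ x : N, ∀ y : N, ∀ z : N, (↑x + ↑y) + z ≐ ↑x + (↑y + z);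
    ∀ x : N, ∀ y : N, ↑x + y ≐ y + ↑x;
    ∀ x : N, x + 0 ≐ x;
    ∀ x : N, ∀ y : N, ∀ z : N, (↑x * ↑y) * z ≐ ↑x * (↑y * z);
    ∀ x : N, ∀ y : N, ↑x * y ≐ y * ↑x;
    ∀ x : N, x * 1 ≐ x;
    ∀ x : N, x * 0 ≐ 0;
    ∀ x : N, ∀ y : N, ∀ z : N, ↑x * (↑y + z) ≐ ↑x * ↑y + ↑x * z;
    ∀ x : N, ¬ (x ≺ x);
    ∀ x : N, ∀ y : N, ∀ z : N, ↑x ≺ ↑y ∧ ↑y ≺ z → ↑x ≺ z;
    ∀ x : N, ∀ y : N, ↑x ≺ y ∨ ↑x ≐ y ∨ y ≺ ↑x;
    ∀ x : N, ∀ y : N, ∀ z : N, ↑x ≺ ↑y → ↑x + z ≺ ↑y + z;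
    ∀ x : N, ∀ y : N, ∀ z : N, 0 ≺ z ∧ ↑x ≺ ↑y → ↑x * z ≺ ↑y * z;
    ∀ x : N, ∀ y : N, ↑x ≺ y → ∃ z : N, ↑x + z ≐ ↑y;
    ∀ x : N, 0 ≼ x;
    0 ≺ 1;
    ∀ x : N, 0 ≺ x → 1 ≼ x ].

(* In A(x,y) the variable y is de Bruijn variable 0, x is variable 1, and the
   remaining variables are parameters. *)
Definition choice_instance Γ σ τ (A : form (τ :: σ :: Γ)) : form Γ :=
  (∀ x : σ, ∃ y : τ, A)
  → ∃ Y : σ ⇒ τ, ∀ x : σ, inst (ren_form A (up_ren (up_ren shift))) (↑Y · x).

Definition induction_instance Γ (A : form (N :: Γ)) : form Γ :=
  inst A 0
  ∧ (∀ n : N, A → inst (ren_form A (up_ren shift)) (n + 1))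
  → ∀ n : N, A.

Inductive QF_AC (σ τ : ty) : theory :=
| qf_ac : forall Γ (A : form (τ :: σ :: Γ)),
    quantifier_free A -> QF_AC σ τ (choice_instance A).

Inductive RCA0ω : theory :=
| rca_basic : forall Γ A, In A (basic_axioms Γ) -> RCA0ω A
| rca_K : forall Γ σ τ,
    RCA0ω (Γ := Γ) (∀ x : σ, ∀ y : τ, eq_at (CombK σ τ · ↑x · y) ↑x)
| rca_S : forall Γ ρ σ τ,
    RCA0ω (Γ := Γ) (∀ x : ρ ⇒ σ ⇒ τ, ∀ y : ρ ⇒ σ, ∀ z : ρ,
      eq_at (CombS ρ σ τ · ↑x · ↑y · z) (↑x · z · (↑y · z)))
| rca_R0_zero : forall Γ,
    RCA0ω (Γ := Γ) (∀ f : ty1, ∀ m : N, Rec0 · ↑f · m · 0 ≐ m)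
| rca_R0_succ : forall Γ,
    RCA0ω (Γ := Γ) (∀ f : ty1, ∀ m : N, ∀ n : N,
      Rec0 · ↑f · ↑m · (n + 1) ≐ ↑f · (Rec0 · ↑f · ↑m · n))
| rca_ext : forall Γ ρ τ,
    RCA0ω (Γ := Γ) (∀ x : ρ, ∀ y : ρ, ∀ φ : ρ ⇒ τ,
      eq_at ↑x ↑y → eq_at (φ · ↑x) (φ · ↑y))
| rca_ind : forall Γ (A : form (N :: Γ)),
    quantifier_free A -> RCA0ω (induction_instance A)
| rca_qf_ac : forall Γ (A : form Γ), QF_AC ty1 N A -> RCA0ω A.

(* The injective pairing (i,j) = (i+j)^2 + i of Simpson. *)
Definition pair Γ (i j : tm Γ N) : tm Γ N := (i + j) * (i + j) + i.

(* s = <f(0),...,f(n-1)>, with <> coded by 0 and s⌢<a> by (s,a) + 1. *)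
Definition is_initseg Γ (f : tm Γ ty1) (n s : tm Γ N) : form Γ :=
  ∃ c : ty1,
    c · 0 ≐ 0
    ∧ (∀ i : N, i ≺ ↑n → ↑c · (i + 1) ≐ pair (↑c · i) (↑f · i) + 1)
    ∧ c · ↑n ≐ ↑s.

Definition same_initseg Γ (f g : tm Γ ty1) (n : tm Γ N) : form Γ :=
  ∃ s : N, is_initseg ↑f ↑n s ∧ is_initseg ↑g ↑n s.

Definition in_C Γ (f : tm Γ ty1) : form Γ := le_at f (one_at ty1).

(* Sets of numbers are given by characteristic functions. *)
Definition mem Γ (n : tm Γ N) (X : tm Γ ty1) : form Γ := X · n ≐ 1.

Definition E2 Γ : form Γ :=
  ∃ φ : ty2, le_at φ (one_at ty2)
    ∧ ∀ f : ty1, (∃ n : N, ↑f · n ≐ 0) ↔ ↑φ · f ≐ 0.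

Definition cont Γ (Y : tm Γ ty2) : form Γ :=
  ∀ f : ty1, ∃ n : N, ∀ g : ty1, same_initseg ↑f g ↑n → ↑Y · ↑f ≐ ↑Y · g.

Definition FF Γ : form Γ :=
  ∃ Φ : ty3, ∀ Y : ty2, cont Y →
    ∀ f : ty1, ∀ g : ty1, in_C ↑f ∧ in_C g →
      same_initseg ↑f g (↑Φ · ↑Y) → ↑Y · ↑f ≐ ↑Y · g.

(* Terms denoting the rational number (qpos - qneg) / qden. *)
Record qexp (Γ : ctx) : Set := Qexp { qpos : tm Γ N; qneg : tm Γ N; qden : tm Γ N }.

Definition qweaken Γ Δ (e : Ext Γ Δ) (p : qexp Γ) : qexp Δ :=
  Qexp ↑(qpos p) ↑(qneg p) ↑(qden p).
Notation "⇑ p" := (qweaken _ p) (at level 9, p at level 9, format "⇑ p") : L_scope.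

Definition qadd Γ (p q : qexp Γ) : qexp Γ :=
  Qexp (qpos p * qden q + qpos q * qden p) (qneg p * qden q + qneg q * qden p)
       (qden p * qden q).
Definition qopp Γ (p : qexp Γ) : qexp Γ := Qexp (qneg p) (qpos p) (qden p).
Definition qsub Γ (p q : qexp Γ) : qexp Γ := qadd p (qopp q).

Definition qlt Γ (p q : qexp Γ) : form Γ :=
  qpos p * qden q + qneg q * qden p ≺ qpos q * qden p + qneg p * qden q.
Definition qeq Γ (p q : qexp Γ) : form Γ :=
  qpos p * qden q + qneg q * qden p ≐ qpos q * qden p + qneg p * qden q.

Definition qabs_lt Γ (p q : qexp Γ) : form Γ := qlt p q ∧ qlt (qopp p) q.
Definition qabs_le Γ (p q : qexp Γ) : form Γ := ¬ qlt q p ∧ ¬ qlt q (qopp p).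

Definition double Γ : tm Γ ty1 :=
  CombS N N N · Plus · (CombS N ty1 N · CombK N ty1 · CombK N N).
Arguments double {Γ}.
Definition pow2 Γ (n : tm Γ N) : tm Γ N := Rec0 · double · 1 · n.

Definition over_pow2 Γ (c n : tm Γ N) : qexp Γ := Qexp c 0 (pow2 n).

(* The code of the rational (a - b) / (c + 1). *)
Definition qcode Γ (a b c : tm Γ N) : tm Γ N := pair (pair a b) c.

(* "t codes a rational q such that F(q)"; q is unique if it exists, because
   pairing is injective. *)
Definition codes Γ (t : tm Γ N) (F : qexp (N :: N :: N :: Γ) -> form (N :: N :: N :: Γ))
    : form Γ :=
  ∃ a : N, ∃ b : N, ∃ c : N, ↑t ≐ qcode ↑a ↑b c ∧ F (Qexp ↑a ↑b (c + 1)).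

(* |q_n - q_{n+i}| < 2^{-n} for all n, i. *)
Definition is_real Γ (x : tm Γ ty1) : form Γ :=
  ∀ n : N, ∀ i : N,
    codes (↑x · ↑n) (fun p =>
      codes (↑x · (↑n + ↑i)) (fun q =>
        qabs_lt (qsub ⇑p q) (over_pow2 1 ↑n))).

Definition real_eq Γ (x y : tm Γ ty1) : form Γ :=
  ∀ n : N,
    codes (↑x · n) (fun p =>
      codes (↑y · ↑n) (fun q =>
        qabs_le (qsub ⇑p q) (over_pow2 2 ↑n))).

Definition real_lt Γ (x y : tm Γ ty1) : form Γ :=
  ∃ n : N,
    codes (↑x · n) (fun p =>
      codes (↑y · ↑n) (fun q =>
        qlt (qadd ⇑p (over_pow2 2 ↑n)) q)).

Definition real_le Γ (x y : tm Γ ty1) : form Γ := ¬ real_lt y x.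

Definition real_zero Γ : tm Γ ty1 := CombK N N · qcode 0 0 0.
Definition real_one Γ : tm Γ ty1 := CombK N N · qcode 1 0 0.
Arguments real_zero {Γ}.
Arguments real_one {Γ}.

(* Sums and differences of reals are taken termwise, after shifting the index
   by one so that the result is again fast-converging. *)
Definition real_op (op : forall Γ, qexp Γ -> qexp Γ -> qexp Γ) Γ (x y z : tm Γ ty1)
    : form Γ :=
  ∀ n : N,
    codes (↑x · (n + 1)) (fun p =>
      codes (↑y · (↑n + 1)) (fun q =>
        codes (↑z · ↑n) (fun r =>
          qeq r (op _ ⇑p ⇑q)))).

Definition is_real_sum Γ (x y z : tm Γ ty1) : form Γ := real_op qadd x y z.
Definition is_real_diff Γ (x y z : tm Γ ty1) : form Γ := real_op qsub x y z.

Definition in_unit_interval Γ (x : tm Γ ty1) : form Γ :=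
  is_real x ∧ real_le real_zero x ∧ real_le x real_one.

(* x ∈ (y - Ψ(y), y + Ψ(y)) *)
Definition in_interval Γ (Ψ : tm Γ (ty1 ⇒ ty1)) (y x : tm Γ ty1) : form Γ :=
  ∃ u : ty1, ∃ v : ty1,
    is_real_diff ↑y (↑Ψ · ↑y) ↑u ∧ is_real_sum ↑y (↑Ψ · ↑y) v
    ∧ real_lt ↑u ↑x ∧ real_lt ↑x v.

Definition pos_real_function Γ (Ψ : tm Γ (ty1 ⇒ ty1)) : form Γ :=
  (∀ x : ty1, is_real x → is_real (↑Ψ · x) ∧ real_lt real_zero (↑Ψ · x))
  ∧ (∀ x : ty1, ∀ y : ty1, is_real ↑x ∧ is_real y → real_eq ↑x y →
       real_eq (↑Ψ · ↑x) (↑Ψ · y)).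

(* A finite sequence of reals is given by its length k and its entries y(i), i < k. *)
Definition HBU Γ : form Γ :=
  ∀ Ψ : ty1 ⇒ ty1, pos_real_function Ψ →
    ∃ k : N, ∃ y : N ⇒ ty1,
      (∀ i : N, i ≺ ↑k → is_real (↑y · i))
      ∧ ∀ x : ty1, in_unit_interval x →
          ∃ i : N, i ≺ ↑k ∧ in_interval ↑Ψ (↑y · i) ↑x.

Definition ord_le Γ (X : tm Γ ty1) (i j : tm Γ N) : form Γ := mem (pair i j) X.
Definition ord_lt Γ (X : tm Γ ty1) (i j : tm Γ N) : form Γ :=
  ord_le X i j ∧ ¬ ord_le X j i.
Definition in_field Γ (X : tm Γ ty1) (i : tm Γ N) : form Γ := ord_le X i i.

Definition LO Γ (X : tm Γ ty1) : form Γ :=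
  (∀ i : N, ∀ j : N, ord_le ↑X ↑i j → in_field ↑X ↑i ∧ in_field ↑X j)
  ∧ (∀ i : N, ∀ j : N, ∀ k : N, ord_le ↑X ↑i ↑j ∧ ord_le ↑X ↑j k → ord_le ↑X ↑i k)
  ∧ (∀ i : N, ∀ j : N, ord_le ↑X ↑i j ∧ ord_le ↑X j ↑i → ↑i ≐ j)
  ∧ (∀ i : N, ∀ j : N, in_field ↑X ↑i ∧ in_field ↑X j →
       ord_le ↑X ↑i j ∨ ord_le ↑X j ↑i).

Definition WF Γ (X : tm Γ ty1) : form Γ :=
  ¬ ∃ h : ty1, ∀ n : N, ord_lt ↑X (↑h · (n + 1)) (↑h · n).

Definition WO Γ (X : tm Γ ty1) : form Γ := LO X ∧ WF X.

(* Z = Y^j = {(m,i) : i <_X j, m ∈ Y_i}, where Y_i = {m : (m,i) ∈ Y}. *)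
Definition is_below Γ (X Y : tm Γ ty1) (j : tm Γ N) (Z : tm Γ ty1) : form Γ :=
  in_C Z
  ∧ ∀ k : N, mem k ↑Z ↔
      ∃ m : N, ∃ i : N,
        ↑k ≐ pair ↑m i ∧ ord_lt ↑X i ↑j ∧ mem (pair ↑m i) ↑Y.

(* In θ(n,Z) the variable Z is de Bruijn variable 0 and n is variable 1. *)
Definition H Γ (θ : form (ty1 :: N :: Γ)) (X Y : tm Γ ty1) : form Γ :=
  ∀ j : N, in_field ↑X j →
    All (* n *) (mem (pair (Var vz) ↑j) ↑Y ↔
      Ex (* Z *) (is_below ↑X ↑Y ↑j (Var vz)
                  ∧ ren_form θ (up_ren (up_ren shift)))).

Definition theta Γ (f : tm Γ ty1) : form (ty1 :: N :: Γ) :=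
  let n : tm (ty1 :: N :: Γ) N := Var (vs vz) in
  let Z : tm (ty1 :: N :: Γ) ty1 := Var vz in
  ∃ m : N, ∃ s : N,
    is_initseg ↑Z ↑m s ∧ ↑f · pair (pair ↑n ↑m) s ≐ 0.

Definition Hf Γ (f X Y : tm Γ ty1) : form Γ := H (theta f) X Y.

Definition UATR Γ : form Γ :=
  ∃ Φ : ty1 ⇒ ty1 ⇒ ty1, ∀ X : ty1, ∀ f : ty1,
    WO ↑X → Hf f ↑X (↑Φ · ↑X · f).

Arguments E2 {Γ}.
Arguments FF {Γ}.
Arguments HBU {Γ}.
Arguments UATR {Γ}.

Inductive extend (T U : theory) : theory :=
| extend_l : forall Γ (A : form Γ), T Γ A -> extend T U A
| extend_r : forall Γ (A : form Γ), U Γ A -> extend T U A.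

Inductive just_FF : theory :=
| just_FF_intro : forall Γ, just_FF (FF (Γ := Γ)).

Definition RCA0ω_FF_QFAC21 : theory := extend (extend RCA0ω just_FF) (QF_AC ty2 ty1).

(* Main.v *)
Require Import Defs.
From HB Require Import structures.
From mathcomp Require Import ssreflect ssrfun ssrbool eqtype ssrnat choice order.
From mathcomp Require Import ssralg ssrnum ring lra.
From Stdlib Require Import List Cantor Classical ClassicalEpsilon Program.Equality.
From Stdlib Require Import Ring FunctionalExtensionality PropExtensionality.
(* Imported again because MathComp shadows some of its names. *)
Require Import Defs.

(** By the completeness theorem it suffices to argue in Henkin models of the theory, whose
    functionals may be taken extensional.  In such a model:

    - UATR applied to a one-point well-ordering decides [(∃n) f(n) = 0], so it gives (∃²).
    - If (∃²) fails, Grilliot's trick shows that all type 2 functionals are continuous.  Let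
      [Y(f)] be some [n] such that [2^-n] is smaller than [Ψ] at the real with binary digits
      [f].  By FF, [Y] is bounded on [C], so [Ψ] is bounded below on the dyadic rationals, and
      equidistant points witness HBU.  Hence ¬HBU gives (∃²).
    - Given (∃²) and HBU, let [X] be a well-ordering and suppose that no set is the hierarchy
      along [X].  Each [Z] then has an error at an [X]-minimal level, coded by [G(Z)].  HBU,
      transferred to a Cantor set of reals, yields finitely many [Z_i] such that every [Y] in
      [C] agrees with some [Z_i] up to [G(Z_i)].  This fails for the [Y] that extends the
      [Z_i] of largest error level correctly by that level.  So the hierarchy exists, and
      QF-AC^{2,1} makes it a functional of [X], because "[Z] is the hierarchy along [X], or
      [Z] descends in [X], or [X] is not a linear order" is arithmetical. *)

Set Implicit Arguments.
Unset Strict Implicit.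
Unset Printing Implicit Defensive.
Import ListNotations.
Local Open Scope ty_scope.
Local Open Scope nat_scope.

(** * Substitution and derivations *)

(** The numbers of a Henkin model may be nonstandard, and this shapes every argument inside one.
    Induction, least elements and choice are available only for predicates represented by an element
    of the model that vanishes exactly when the predicate holds. The constructions are arranged so
    that their matrices are of this kind. The covering function in HBU must respect equality of
    reals, whereas a functional on Cantor space knows nothing of reals. The two are linked by
    reading base-4 digits off an arbitrary real through comparison with thresholds: (∃²) decides the
    comparisons, and the outcome depends on the real alone. Only the digits 0 and 3 are used, which
    leaves a gap around each threshold. *)

Definition scons {P : ty -> Type} {Γ τ} (z : P τ) (s : forall σ, var Γ σ -> P σ) :
    forall σ, var (τ :: Γ) σ -> P σ :=
  var_case z s.

(** The match generalises over the context index so that the case analysis goes through at [τ :: Γ].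
    Its main use is to compare two substitutions on an extended context. *)
Lemma var_inv Γ τ (P : forall σ, var (τ :: Γ) σ -> Prop) :
  P τ vz -> (forall σ v, P σ (vs v)) -> forall σ v, P σ v.
Proof.
move=> pz ps σ v.
refine (match v as v' in var Γ' σ' return
  (match Γ' return var Γ' σ' -> Prop with
   | [] => fun _ => True
   | τ' :: Γ'' => fun w => forall P : forall σ, var (τ' :: Γ'') σ -> Prop,
        P τ' vz -> (forall σ v, P σ (vs v)) -> P σ' w
   end) v' with vz _ _ => _ | vs _ _ _ w => _ end P pz ps); auto.
Qed.

Lemma sub_ext Γ (P : ty -> Type) (s s' : forall σ, var Γ σ -> P σ) :
  (forall σ v, s σ v = s' σ v) -> s = s'.
Proof.
by move=> e; apply: functional_extensionality_dep => σ;
  apply: functional_extensionality_dep => v.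
Qed.

Lemma sub_tm_ext Γ Δ (s s' : sub Γ Δ) σ (t : tm Γ σ) :
  (forall σ v, s σ v = s' σ v) -> sub_tm s t = sub_tm s' t.
Proof. by move=> e; rewrite (sub_ext (P := tm Δ) e). Qed.

Lemma sub_form_ext Γ Δ (s s' : sub Γ Δ) (A : form Γ) :
  (forall σ v, s σ v = s' σ v) -> sub_form A s = sub_form A s'.
Proof. by move=> e; rewrite (sub_ext (P := tm Δ) e). Qed.

Lemma ren_tm_sub Γ Δ (r : ren Γ Δ) σ (t : tm Γ σ) :
  ren_tm r t = sub_tm (fun σ v => Var (r σ v)) t.
Proof. by elim: t => //= σ' τ t -> u ->. Qed.

Lemma sub_sub_tm Γ Δ Θ (s : sub Γ Δ) (s' : sub Δ Θ) σ (t : tm Γ σ) :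
  sub_tm s' (sub_tm s t) = sub_tm (fun σ v => sub_tm s' (s σ v)) t.
Proof. by elim: t => //= σ' τ t -> u ->. Qed.

Lemma sub_tm_Var Γ σ (t : tm Γ σ) : sub_tm (fun σ v => Var v) t = t.
Proof. by elim: t => //= σ' τ t -> u ->. Qed.

Lemma sub_ren_tm Γ Δ Θ (r : ren Γ Δ) (s : sub Δ Θ) σ (t : tm Γ σ) :
  sub_tm s (ren_tm r t) = sub_tm (fun σ v => s σ (r σ v)) t.
Proof. by rewrite ren_tm_sub sub_sub_tm. Qed.

Lemma ren_sub_tm Γ Δ Θ (s : sub Γ Δ) (r : ren Δ Θ) σ (t : tm Γ σ) :
  ren_tm r (sub_tm s t) = sub_tm (fun σ v => ren_tm r (s σ v)) t.
Proof.
rewrite ren_tm_sub sub_sub_tm; apply: sub_tm_ext => ? ?.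
by rewrite ren_tm_sub.
Qed.

Lemma up_sub_shift Γ Δ τ (s : sub Γ Δ) σ (t : tm Γ σ) :
  sub_tm (up_sub (τ := τ) s) (ren_tm shift t) = ren_tm shift (sub_tm s t).
Proof. by rewrite sub_ren_tm ren_sub_tm. Qed.

Lemma up_sub_ren Γ Δ τ (r : ren Γ Δ) :
  up_sub (τ := τ) (fun σ v => Var (r σ v)) = fun σ v => Var (up_ren r v).
Proof. by apply: sub_ext; apply: var_inv. Qed.

Lemma ren_form_sub Γ (A : form Γ) : forall Δ (r : ren Γ Δ),
  ren_form A r = sub_form A (fun σ v => Var (r σ v)).
Proof.
elim: A => //= {Γ}.
- by move=> Γ t u Δ r; rewrite !ren_tm_sub.
- by move=> Γ t u Δ r; rewrite !ren_tm_sub.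
- by move=> Γ A IHA B IHB Δ r; rewrite IHA IHB.
- by move=> Γ A IHA B IHB Δ r; rewrite IHA IHB.
- by move=> Γ A IHA B IHB Δ r; rewrite IHA IHB.
- by move=> Γ σ A IHA Δ r; rewrite IHA up_sub_ren.
- by move=> Γ σ A IHA Δ r; rewrite IHA up_sub_ren.
Qed.

Lemma up_sub_comp Γ Δ Θ τ (s : sub Γ Δ) (s' : sub Δ Θ) :
  (fun σ v => sub_tm (up_sub s') (up_sub (τ := τ) s v)) =
  up_sub (fun σ v => sub_tm s' (s σ v)).
Proof. by apply: sub_ext; apply: var_inv => //= σ v; rewrite up_sub_shift. Qed.

Lemma sub_sub_form Γ (A : form Γ) : forall Δ Θ (s : sub Γ Δ) (s' : sub Δ Θ),
  sub_form (sub_form A s) s' = sub_form A (fun σ v => sub_tm s' (s σ v)).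
Proof.
elim: A => //= {Γ}.
- by move=> Γ t u Δ Θ s s'; rewrite !sub_sub_tm.
- by move=> Γ t u Δ Θ s s'; rewrite !sub_sub_tm.
- by move=> Γ A IHA B IHB Δ Θ s s'; rewrite IHA IHB.
- by move=> Γ A IHA B IHB Δ Θ s s'; rewrite IHA IHB.
- by move=> Γ A IHA B IHB Δ Θ s s'; rewrite IHA IHB.
- by move=> Γ σ A IHA Δ Θ s s'; rewrite IHA up_sub_comp.
- by move=> Γ σ A IHA Δ Θ s s'; rewrite IHA up_sub_comp.
Qed.

Lemma up_sub_Var Γ τ :
  up_sub (τ := τ) (fun σ (v : var Γ σ) => Var v) = fun σ v => Var v.
Proof. by apply: sub_ext; apply: var_inv. Qed.

Lemma sub_form_Var Γ (A : form Γ) : sub_form A (fun σ v => Var v) = A.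
Proof.
elim: A => //= {Γ}.
- by move=> Γ t u; rewrite !sub_tm_Var.
- by move=> Γ t u; rewrite !sub_tm_Var.
- by move=> Γ A -> B ->.
- by move=> Γ A -> B ->.
- by move=> Γ A -> B ->.
- by move=> Γ σ A IHA; rewrite up_sub_Var IHA.
- by move=> Γ σ A IHA; rewrite up_sub_Var IHA.
Qed.

Lemma sub_ren_form Γ (A : form Γ) Δ Θ (r : ren Γ Δ) (s : sub Δ Θ) :
  sub_form (ren_form A r) s = sub_form A (fun σ v => s σ (r σ v)).
Proof. by rewrite ren_form_sub sub_sub_form. Qed.

Lemma ren_sub_form Γ (A : form Γ) Δ Θ (s : sub Γ Δ) (r : ren Δ Θ) :
  ren_form (sub_form A s) r = sub_form A (fun σ v => ren_tm r (s σ v)).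
Proof.
rewrite ren_form_sub sub_sub_form; apply: sub_form_ext => ? ?.
by rewrite ren_tm_sub.
Qed.

Lemma inst_sub_up Γ Δ τ (A : form (τ :: Γ)) (s : sub Γ Δ) (t : tm Δ τ) :
  inst (sub_form A (up_sub s)) t = sub_form A (scons t s).
Proof.
rewrite /inst sub_sub_form; apply: sub_form_ext; apply: var_inv => //= σ v.
by rewrite sub_ren_tm /= sub_tm_Var.
Qed.

Lemma sub_inst Γ Δ τ (A : form (τ :: Γ)) (s : sub Γ Δ) (t : tm Γ τ) :
  sub_form (inst A t) s = inst (sub_form A (up_sub s)) (sub_tm s t).
Proof.
rewrite inst_sub_up /inst sub_sub_form; apply: sub_form_ext.
by apply: var_inv.
Qed.

Lemma sub_form_shift Γ Δ τ (A : form Γ) (s : sub Γ Δ) :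
  sub_form (ren_form A shift) (up_sub (τ := τ) s) = ren_form (sub_form A s) shift.
Proof. by rewrite sub_ren_form ren_sub_form. Qed.

(** This is what lets a derivation be moved to another context: the instances of the axioms that it
    uses remain axioms. *)
Definition sub_closed (T : theory) : Prop :=
  forall Γ Δ (A : form Γ) (s : sub Γ Δ), T Γ A -> T Δ (sub_form A s).

Section Derivations.
Variable T : theory.
Arguments prv_hyp {T Γ H A}.

Lemma prv_weaken Γ (G G' : list (form Γ)) A : incl G G' -> prv T G A -> prv T G' A.
Proof.
move=> i p; move: G' i; elim: p => {G A Γ}.
- by move=> Γ G A inG G' i; apply: prv_hyp; apply: i.
- by move=> *; apply: prv_ax.
- by move=> *; apply: prv_and_intro; auto.
- by move=> Γ G A B _ IH G' i; apply: prv_and_elim1 (IH _ i).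
- by move=> Γ G A B _ IH G' i; apply: prv_and_elim2 (IH _ i).
- by move=> *; apply: prv_or_intro1; auto.
- by move=> *; apply: prv_or_intro2; auto.
- move=> Γ G A B C _ IH _ IHA _ IHB G' i; apply: prv_or_elim (IH _ i) _ _.
  + by apply: IHA => C' [->|?]; [left | right; apply: i].
  + by apply: IHB => C' [->|?]; [left | right; apply: i].
- move=> Γ G A B _ IH G' i; apply: prv_imp_intro; apply: IH => C' [->|?];
    [by left | by right; apply: i].
- by move=> Γ G A B _ IH _ IHA G' i; apply: prv_imp_elim (IH _ i) (IHA _ i).
- move=> Γ G A _ IH G' i; apply: prv_raa; apply: IH => C' [->|?];
    [by left | by right; apply: i].
- move=> Γ G σ A _ IH G' i; apply: prv_all_intro; apply: IH; exact: incl_map.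
- by move=> Γ G σ A t _ IH G' i; apply: prv_all_elim (IH _ i).
- by move=> Γ G σ A t _ IH G' i; apply: prv_ex_intro (IH _ i).
- move=> Γ G σ A C _ IH _ IHC G' i; apply: prv_ex_elim (IH _ i) _.
  apply: IHC => C' [->|?]; first by left.
  by right; apply: (incl_map _ i).
- by move=> *; apply: prv_eq_refl.
- by move=> Γ G A s t _ IH _ IHA G' i; apply: prv_eq_subst (IH _ i) (IHA _ i).
Qed.

Lemma prv_sub Γ (G : list (form Γ)) A Δ (s : sub Γ Δ) : sub_closed T ->
  prv T G A -> prv T (List.map (fun B => sub_form B s) G) (sub_form A s).
Proof.
move=> cT p; move: Δ s; elim: p => {G A Γ}.
- by move=> Γ G A inG Δ s; apply: prv_hyp; apply: (in_map (fun B => sub_form B s)).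
- by move=> Γ G A a Δ s; apply: prv_ax; apply: cT.
- by move=> Γ G A B _ IHA _ IHB Δ s; apply: prv_and_intro; [apply: IHA | apply: IHB].
- by move=> Γ G A B _ IH Δ s; apply: prv_and_elim1 (IH _ s).
- by move=> Γ G A B _ IH Δ s; apply: prv_and_elim2 (IH _ s).
- by move=> Γ G A B _ IH Δ s; apply: prv_or_intro1; apply: IH.
- by move=> Γ G A B _ IH Δ s; apply: prv_or_intro2; apply: IH.
- by move=> Γ G A B C _ IH _ IHA _ IHB Δ s;
    apply: prv_or_elim (IH _ s) (IHA _ s) (IHB _ s).
- by move=> Γ G A B _ IH Δ s; apply: prv_imp_intro; apply: IH.
- by move=> Γ G A B _ IH _ IHA Δ s; apply: prv_imp_elim (IH _ s) (IHA _ s).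
- by move=> Γ G A _ IH Δ s; apply: prv_raa; apply: IH.
- move=> Γ G σ A _ IH Δ s; apply: prv_all_intro.
  have := IH _ (up_sub s); rewrite !map_map.
  by under map_ext => B do rewrite sub_form_shift.
- move=> Γ G σ A t _ IH Δ s; rewrite sub_inst; exact: prv_all_elim (IH _ s).
- move=> Γ G σ A t _ IH Δ s; apply: (prv_ex_intro (t := sub_tm s t)).
  by rewrite -sub_inst; apply: IH.
- move=> Γ G σ A C _ IH _ IHC Δ s; apply: prv_ex_elim (IH _ s) _.
  have := IHC _ (up_sub s); rewrite /= sub_form_shift !map_map.
  by under map_ext => B do rewrite sub_form_shift.
- by move=> *; apply: prv_eq_refl.
- move=> Γ G A t u _ IH _ IHA Δ s; rewrite sub_inst; apply: prv_eq_subst (IH _ s) _.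
  by rewrite -sub_inst; apply: IHA.
Qed.

Lemma prv_shift Γ (G : list (form Γ)) A τ : sub_closed T ->
  prv T G A -> prv T (List.map (fun B => ren_form B shift) G) (ren_form A (shift (τ := τ))).
Proof.
move=> cT /(prv_sub (fun σ v => Var (shift (τ := τ) σ v)) cT).
rewrite ren_form_sub.
by under [X in _ -> prv _ X _]map_ext => B do rewrite ren_form_sub.
Qed.

Lemma prv_bot_elim Γ (G : list (form Γ)) A : prv T G Bot -> prv T G A.
Proof. by move=> p; apply: prv_raa; apply: prv_weaken p => B; right. Qed.

Lemma prv_neg_intro Γ (G : list (form Γ)) A : prv T (A :: G) Bot -> prv T G (Neg A).
Proof. exact: prv_imp_intro. Qed.

Lemma prv_cut Γ (G : list (form Γ)) A B : prv T G A -> prv T (A :: G) B -> prv T G B.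
Proof. by move=> pA /prv_imp_intro pB; apply: prv_imp_elim pB pA. Qed.

Lemma prv_head Γ (G : list (form Γ)) A : prv T (A :: G) A.
Proof. by apply: prv_hyp; left. Qed.

(** The classical step by which universal formulas are later reduced to witnesses of existential
    ones. *)
Lemma prv_not_all Γ (G : list (form Γ)) σ (A : form (σ :: Γ)) :
  prv T G (Neg (All A)) -> prv T G (Ex (Neg A)).
Proof.
move=> p; apply: prv_raa; apply: prv_imp_elim (prv_weaken _ p) _; first by move=> ?; right.
apply: prv_all_intro; apply: prv_raa.
apply: (prv_imp_elim (A := ren_form (Ex (Neg A)) shift)).
  by apply: prv_hyp; right; left.
apply: (prv_ex_intro (t := Var vz)).
have -> : inst (ren_form (Neg A) (up_ren shift)) (Var vz) = Neg A.
  rewrite /inst sub_ren_form -[RHS]sub_form_Var; congr sub_form.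
  by apply: sub_ext; apply: var_inv.
exact: prv_head.
Qed.

End Derivations.

(** * The Henkin construction *)

Definition node (k x y : nat) : nat := Cantor.to_nat (k, Cantor.to_nat (x, y)).

Lemma node_inj k x y k' x' y' : node k x y = node k' x' y' -> k = k' /\ x = x' /\ y = y'.
Proof.
by move=> e; have /pair_equal_spec [-> e'] := Cantor.to_nat_inj _ _ e;
  have /pair_equal_spec := Cantor.to_nat_inj _ _ e'.
Qed.

Fixpoint ty_code (σ : ty) : nat :=
  match σ with N => node 0 0 0 | Arr σ τ => node 1 (ty_code σ) (ty_code τ) end.

Fixpoint var_code Γ σ (v : var Γ σ) : nat :=
  match v with vz _ _ => 0 | vs _ _ _ v => (var_code v).+1 end.

(** Injectivity is claimed at a fixed context and type. So an application records its argument type,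
    which the result type does not determine, while the types of the combinators can be read off the
    index. *)
Fixpoint tm_code Γ σ (t : tm Γ σ) : nat :=
  match t with
  | Var _ v => node 0 (var_code v) 0
  | App σ τ t u => node 1 (ty_code σ) (node 0 (tm_code t) (tm_code u))
  | Zero => node 2 0 0
  | One => node 3 0 0
  | Plus => node 4 0 0
  | Times => node 5 0 0
  | CombK _ _ => node 6 0 0
  | CombS _ _ _ => node 7 0 0
  | Rec0 => node 8 0 0
  end.

Fixpoint form_code Γ (A : form Γ) : nat :=
  match A with
  | Eq _ t u => node 0 (tm_code t) (tm_code u)
  | Lt _ t u => node 1 (tm_code t) (tm_code u)
  | Bot _ => node 2 0 0
  | And _ A B => node 3 (form_code A) (form_code B)
  | Or _ A B => node 4 (form_code A) (form_code B)
  | Imp _ A B => node 5 (form_code A) (form_code B)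
  | All _ σ A => node 6 (ty_code σ) (form_code A)
  | Ex _ σ A => node 7 (ty_code σ) (form_code A)
  end.

Lemma ty_code_inj σ : forall τ, ty_code σ = ty_code τ -> σ = τ.
Proof.
elim: σ => [|σ IHσ τ IHτ] [|σ' τ'] //=; try by case/node_inj.
by case/node_inj=> _ [/IHσ -> /IHτ ->].
Qed.

Lemma var_code_inj Γ σ (v : var Γ σ) : forall w : var Γ σ, var_code v = var_code w -> v = w.
Proof.
elim: v => {Γ σ} [Γ σ w|Γ σ τ v IH w]; dependent destruction w => //=.
by case=> /IH ->.
Qed.

(** Equating the types of [CombK] and [CombS] forces an equation of this shape; its refutation
    closes the two mixed cases of [tm_code_inj]. *)
Lemma Arr_acyclic σ τ : (σ ⇒ τ) <> τ.
Proof. by elim: τ σ => [|τ1 _ τ2 IH] σ // [_ /IH]. Qed.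

Lemma tm_code_inj Γ σ (t : tm Γ σ) : forall u : tm Γ σ, tm_code t = tm_code u -> t = u.
Proof.
elim: t => {σ} [σ v|σ τ t IHt u IHu| | | | |σ τ|ρ σ τ|] w; dependent destruction w => //=;
  try by case/node_inj.
- by case/node_inj=> _ [/var_code_inj ->].
- case/node_inj=> _ [/ty_code_inj e]; subst.
  by case/node_inj=> _ [/IHt -> /IHu ->].
- by case: (@Arr_acyclic σ0 τ0).
- by case: (@Arr_acyclic σ τ).
Qed.

Lemma form_code_inj Γ (A : form Γ) : forall B : form Γ, form_code A = form_code B -> A = B.
Proof.
elim: A => {Γ} [Γ t u|Γ t u|Γ|Γ A IHA B IHB|Γ A IHA B IHB|Γ A IHA B IHB|Γ σ A IHA|Γ σ A IHA] C;
  dependent destruction C => //=; try by case/node_inj.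
- by case/node_inj=> _ [/tm_code_inj -> /tm_code_inj ->].
- by case/node_inj=> _ [/tm_code_inj -> /tm_code_inj ->].
- by case/node_inj=> _ [/IHA -> /IHB ->].
- by case/node_inj=> _ [/IHA -> /IHB ->].
- by case/node_inj=> _ [/IHA -> /IHB ->].
- by case/node_inj=> _ [/ty_code_inj e]; subst=> /IHA ->.
- by case/node_inj=> _ [/ty_code_inj e]; subst=> /IHA ->.
Qed.

Definition form_enum Γ (n : nat) : form Γ :=
  epsilon (inhabits Bot) (fun A => form_code A = n).

Lemma form_enum_code Γ (A : form Γ) : form_enum Γ (form_code A) = A.
Proof.
apply: form_code_inj.
exact: (epsilon_spec (inhabits Bot) (fun B => form_code B = form_code A)
  (ex_intro _ A erefl)).
Qed.

Fixpoint closed_tm (σ : ty) Γ : tm Γ σ :=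
  match σ with N => Zero | Arr σ τ => App (CombK τ σ) (closed_tm τ Γ) end.

Section Completeness.
Variable T : theory.
Hypothesis T_sub : sub_closed T.

Definition consistent Γ (G : list (form Γ)) : Prop := ~ prv T G Bot.

(** Each step of the construction adds exactly one variable: the Henkin witness of an existential
    formula, and a dummy of type [N] otherwise. *)
Definition witness Γ (A : form Γ) : {σ : ty & list (form (σ :: Γ))} :=
  match A with
  | Ex Γ' σ B => existT (fun σ => list (form (σ :: Γ'))) σ [B]
  | _ => existT _ N []
  end.

Lemma witness_Ex Γ (A : form Γ) σ (B : form (σ :: Γ)) : A = Ex B ->
  exists v : var (projT1 (witness A) :: Γ) σ,
    In (sub_form B (scons (P := tm _) (Var v) (fun _ w => Var (vs w)))) (projT2 (witness A)).
Proof.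
move=> -> /=; exists vz; left; rewrite -[LHS]sub_form_Var; congr sub_form.
by apply: sub_ext; apply: var_inv.
Qed.

(** A contradiction in the larger context could be specialised to a closed term, which every finite
    type has. *)
Lemma consistent_shift Γ (G : list (form Γ)) σ : consistent G ->
  consistent (List.map (fun B => ren_form B (shift (τ := σ))) G).
Proof.
move=> c p; apply: c; have q := prv_all_intro p.
exact: (prv_all_elim (closed_tm σ Γ) q).
Qed.

Lemma consistent_witness Γ (G : list (form Γ)) A : consistent (A :: G) ->
  consistent (projT2 (witness A) ++
    List.map (fun B => ren_form B shift) (A :: G))%list.
Proof.
case: A G => {Γ} [Γ t u|Γ t u|Γ|Γ A B|Γ A B|Γ A B|Γ σ B|Γ σ B] G c;
  try exact: (consistent_shift c).
by move=> p; apply: c; apply: (prv_ex_elim (C := Bot) (prv_head _ _ _) p).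
Qed.

(* The sequence of contexts and hypotheses of the Henkin construction.  [queue k i] is the
   [i]-th formula of the [k]-th last context, weakened to the current one. *)
Record stage := Stage {
  scope : ctx;
  hyps : list (form scope);
  queue : nat -> nat -> form scope }.

(** Step [n], the code of [(m, i)], treats the [i]-th formula over the context of stage [m]; that
    stage has been reached because [m <= n]. *)
Definition current n (s : stage) : form (scope s) :=
  let: (m, i) := Cantor.of_nat n in queue s (n - m) i.

Definition next n (s : stage) : stage :=
  let A := current n s in
  Stage
    (if excluded_middle_informative (consistent (A :: hyps s)) then
       (projT2 (witness A) ++ List.map (fun B => ren_form B shift) (A :: hyps s))%list
     else List.map (fun B => ren_form B shift) (hyps s))
    (fun k i => if k is k'.+1 then ren_form (queue s k' i) shift else form_enum _ i).

Variable G0 : list (form []).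
Hypothesis G0_consistent : consistent G0.

Fixpoint stages n : stage :=
  if n is n'.+1 then next n' (stages n') else Stage G0 (fun _ i => form_enum _ i).

Notation Γ_ n := (scope (stages n)).
Notation G_ n := (hyps (stages n)).

Lemma stages_consistent n : consistent (G_ n).
Proof.
elim: n => //= n IH; case: excluded_middle_informative => c /=.
  exact: consistent_witness.
exact: consistent_shift.
Qed.

Lemma hyps_next n : incl (List.map (fun B => ren_form B shift) (G_ n)) (G_ n.+1).
Proof.
move=> B inB /=; case: excluded_middle_informative => c //=.
by apply: in_or_app; right; right.
Qed.

Lemma prv_next n (A : form (Γ_ n)) : prv T (G_ n) A -> prv T (G_ n.+1) (ren_form A shift).
Proof. by move=> p; apply: prv_weaken (@hyps_next n) _; apply: prv_shift. Qed.

(** A formula of the limit language is a sequence of formulas, one per stage, that from some stage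
    on are weakenings of one another. Truth in the limit is derivability at all late stages. *)
Definition form_thread (a : forall n, form (Γ_ n)) k : Prop :=
  forall n, k <= n -> a n.+1 = ren_form (a n) shift.

Definition eventually (a : forall n, form (Γ_ n)) : Prop :=
  exists k, forall n, k <= n -> prv T (G_ n) (a n).

Lemma form_thread_stable a k n : form_thread a k -> k <= n -> prv T (G_ n) (a n) ->
  eventually a.
Proof.
move=> th kn p; exists n => m /subnK <-; elim: (m - n) => [|d IH] //.
rewrite addSn th; first exact: prv_next.
exact: leq_trans kn (leq_addl _ _).
Qed.

Lemma eventually_imp (a b : forall n, form (Γ_ n)) k :
  (forall n, k <= n -> prv T (G_ n) (a n) -> prv T (G_ n) (b n)) ->
  eventually a -> eventually b.
Proof.
move=> i [k' pa]; exists (maxn k k') => n; rewrite geq_max => /andP[kn k'n].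
by apply: i => //; apply: pa.
Qed.

Lemma eventually_imp2 (a b c : forall n, form (Γ_ n)) :
  (forall n, prv T (G_ n) (a n) -> prv T (G_ n) (b n) -> prv T (G_ n) (c n)) ->
  eventually a -> eventually b -> eventually c.
Proof.
move=> i [k pa] [k' pb]; exists (maxn k k') => n; rewrite geq_max => /andP[kn k'n].
by apply: i; [apply: pa | apply: pb].
Qed.

Lemma eventually_consistent a : eventually a -> eventually (fun n => Neg (a n)) -> False.
Proof.
move=> pa na.
have [k /(_ k (leqnn k))] : eventually (fun n => Bot).
  by apply: eventually_imp2 pa na => n p q; apply: prv_imp_elim q p.
exact: stages_consistent.
Qed.

Lemma queue0 k i : queue (stages k) 0 i = form_enum _ i.
Proof. by case: k. Qed.

(** The formula [a k] has an index [i] in its own context, comes up at the step coded by [(k, i)],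
    which is at least [k], and has by then been weakened to the member of the thread at that
    step. *)
Lemma thread_current a k : form_thread a k -> exists2 n, k <= n & current n (stages n) = a n.
Proof.
move=> th; set i := form_code (a k); exists (Cantor.to_nat (k, i)).
  by have := Cantor.to_nat_non_decreasing k i => /leP; apply: leq_trans; exact: leq_addl.
rewrite /current Cantor.cancel_of_to.
have kn : k <= Cantor.to_nat (k, i).
  by have := Cantor.to_nat_non_decreasing k i => /leP; apply: leq_trans; exact: leq_addl.
move: (Cantor.to_nat _) kn => n /subnK <-; rewrite addnK.
elim: (n - k) => [|d IH] /=; last by rewrite IH -th // leq_addl.
by rewrite queue0 /i form_enum_code.
Qed.

Lemma eventually_complete a k : form_thread a k ->
  eventually a \/ eventually (fun n => Neg (a n)).
Proof.
move=> th; have [n kn cur] := thread_current th.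
case: (excluded_middle_informative (consistent (current n (stages n) :: G_ n))) => c.
  left; apply: (form_thread_stable th (n := n.+1)); first exact: leqW.
  rewrite th //=; case: excluded_middle_informative => // ?; rewrite -cur.
  by apply: prv_hyp; apply: in_or_app; right; left.
right; apply: (form_thread_stable (k := k) (n := n)) => //.
  by move=> m km; rewrite th.
by apply: prv_neg_intro; rewrite -cur; apply: NNPP.
Qed.

(** When its turn comes, the existential formula is derivable, hence consistent with the hypotheses,
    and the variable added at that step is its witness. *)
Lemma eventually_Ex σ (b : forall n, form (σ :: Γ_ n)) k :
  (forall n, k <= n -> b n.+1 = ren_form (b n) (up_ren shift)) ->
  eventually (fun n => Ex (b n)) ->
  exists2 n, k <= n & exists v : var (Γ_ n.+1) σ,
    prv T (G_ n.+1) (inst (b n.+1) (Var v)).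
Proof.
move=> thb ev; have th : form_thread (fun n => Ex (b n)) k by move=> n kn /=; rewrite thb.
case: ev => k' ev.
have th' : form_thread (fun n => Ex (b n)) (maxn k k').
  by move=> n; rewrite geq_max => /andP[kn _]; apply: th.
have [n] := thread_current th'; rewrite geq_max => /andP[kn k'n] cur.
exists n => //; have [v inv] := witness_Ex cur; exists v.
have -> : inst (b n.+1) (Var v) =
    sub_form (b n) (scons (P := tm _) (Var v) (fun _ w => Var (vs w))).
  rewrite thb // /inst sub_ren_form; apply: sub_form_ext.
  by apply: var_inv.
apply: prv_hyp => /=; case: excluded_middle_informative => [c|c].
  by apply: in_or_app; left.
case: c => p; apply: (@stages_consistent n); apply: prv_cut p; rewrite cur; exact: ev.
Qed.

Definition coherent σ (t : forall n, tm (Γ_ n) σ) k : Prop :=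
  forall n, k <= n -> t n.+1 = ren_tm shift (t n).

Definition thread σ : Type :=
  {t : forall n, tm (Γ_ n) σ | exists k, coherent t k}.

#[local] Arguments PeanoNat.Nat.eq_dec : simpl never.

(** Stages before [k] have no counterpart of [t] and receive a closed term. At stage [k] itself, [t]
    has to be transported along an equation between stage numbers. *)
Fixpoint extend_tm σ k (t : tm (Γ_ k) σ) n : tm (Γ_ n) σ :=
  if n is n'.+1 then
    match PeanoNat.Nat.eq_dec k n'.+1 with
    | left e => eq_rect k (fun k => tm (Γ_ k) σ) t n'.+1 e
    | right _ => ren_tm shift (extend_tm t n')
    end
  else match PeanoNat.Nat.eq_dec k 0 with
    | left e => eq_rect k (fun k => tm (Γ_ k) σ) t 0 e
    | right _ => closed_tm σ _
    end.

Lemma extend_tm_coherent σ k (t : tm (Γ_ k) σ) : coherent (extend_tm t) k.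
Proof.
move=> n kn; rewrite /= ; case: PeanoNat.Nat.eq_dec => // e; exfalso.
by move: kn; rewrite e ltnn.
Qed.

Lemma extend_tm_refl σ k (t : tm (Γ_ k) σ) : extend_tm t k = t.
Proof.
case: k t => [|k] t /=.
  by case: (PeanoNat.Nat.eq_dec 0 0) => // e; rewrite (Eqdep_dec.UIP_refl_nat _ e).
by case: (PeanoNat.Nat.eq_dec k.+1 k.+1) => // e; rewrite (Eqdep_dec.UIP_refl_nat _ e).
Qed.

Definition extend_thread σ k (t : tm (Γ_ k) σ) : thread σ :=
  exist _ (extend_tm t) (ex_intro _ k (extend_tm_coherent t)).

Definition tapp σ τ (f : thread (σ ⇒ τ)) (x : thread σ) : thread τ.
Proof.
exists (fun n => App (sval f n) (sval x n)).
case: f x => [f [k fk]] [x [l xl]]; exists (maxn k l) => n.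
by rewrite geq_max => /andP[kn ln] /=; rewrite fk // xl.
Defined.

Definition tenv Γ : Type := forall σ, var Γ σ -> thread σ.

Definition tsub Γ (ρ : tenv Γ) n : sub Γ (Γ_ n) := fun σ v => sval (ρ σ v) n.

Lemma tsub_coherent Γ (ρ : tenv Γ) : exists k, forall n, k <= n ->
  tsub ρ n.+1 = fun σ v => ren_tm shift (tsub ρ n v).
Proof.
elim: Γ ρ => [|τ Γ IH] ρ.
  by exists 0 => n _; apply: sub_ext => σ v; dependent destruction v.
have [k IHk] := IH (fun σ v => ρ σ (vs v)); have [l ρl] := svalP (ρ τ vz).
exists (maxn k l) => n; rewrite geq_max => /andP[kn ln]; apply: sub_ext; apply: var_inv.
  exact: ρl.
move=> σ v; have /(congr1 (fun s => s σ v)) := IHk _ kn; exact.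
Qed.

Definition forces Γ (A : form Γ) (ρ : tenv Γ) : Prop :=
  eventually (fun n => sub_form A (tsub ρ n)).

Lemma sub_thread Γ (A : form Γ) (ρ : tenv Γ) :
  exists k, form_thread (fun n => sub_form A (tsub ρ n)) k.
Proof.
have [k ρk] := tsub_coherent ρ; exists k => n kn.
by rewrite ρk // ren_sub_form.
Qed.

Lemma forces_Neg Γ (A : form Γ) ρ : forces (Neg A) ρ <-> ~ forces A ρ.
Proof.
split; first by move=> nA pA; exact: eventually_consistent pA nA.
move=> nA; have [k th] := sub_thread A ρ.
by case: (eventually_complete th).
Qed.

Lemma forces_Bot Γ ρ : ~ forces (@Bot Γ) ρ.
Proof. by case=> k /(_ k (leqnn k)); apply: stages_consistent. Qed.

Lemma forces_And Γ (A B : form Γ) ρ : forces (And A B) ρ <-> forces A ρ /\ forces B ρ.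
Proof.
split=> [p|[pA pB]].
  split; apply: (eventually_imp (k := 0)) p => n _ /=;
  [exact: prv_and_elim1 | exact: prv_and_elim2].
by apply: eventually_imp2 pA pB => n /=; apply: prv_and_intro.
Qed.

Lemma forces_Imp Γ (A B : form Γ) ρ : forces (Imp A B) ρ <-> (forces A ρ -> forces B ρ).
Proof.
split=> [p pA|i].
  by apply: eventually_imp2 p pA => n /=; apply: prv_imp_elim.
case: (classic (forces A ρ)) => [/i|/forces_Neg].
  apply: (eventually_imp (k := 0)) => n _ /= p; apply: prv_imp_intro.
  by apply: prv_weaken p => C ?; right.
apply: (eventually_imp (k := 0)) => n _ /= p; apply: prv_imp_intro; apply: prv_bot_elim.
apply: prv_imp_elim (prv_head _ _ _); apply: prv_weaken p => C ?; by right.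
Qed.

Lemma forces_Or Γ (A B : form Γ) ρ : forces (Or A B) ρ <-> forces A ρ \/ forces B ρ.
Proof.
split; last first.
  case; apply: (eventually_imp (k := 0)) => n _ /=; [exact: prv_or_intro1 | exact: prv_or_intro2].
move=> p; apply: NNPP => /not_or_and [/forces_Neg nA /forces_Neg nB].
have: eventually (fun n => Bot).
  have nAB : forces (And (Neg A) (Neg B)) ρ by apply/forces_And.
  apply: eventually_imp2 p nAB => n /= p q; apply: prv_or_elim p _ _.
    apply: prv_imp_elim (prv_head _ _ _); apply: (prv_weaken _ (prv_and_elim1 q)) => C ?; by right.
  apply: prv_imp_elim (prv_head _ _ _); apply: (prv_weaken _ (prv_and_elim2 q)) => C ?; by right.
by case=> k /(_ k (leqnn k)); apply: stages_consistent.
Qed.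

Lemma tsub_scons Γ σ (ρ : tenv Γ) (x : thread σ) n :
  tsub (scons x ρ) n = scons (P := tm (Γ_ n)) (sval x n) (tsub ρ n).
Proof. by apply: sub_ext; apply: var_inv. Qed.

Lemma forces_Ex Γ σ (A : form (σ :: Γ)) ρ :
  forces (Ex A) ρ <-> exists x : thread σ, forces A (scons x ρ).
Proof.
split=> [p|[x]]; last first.
  apply: (eventually_imp (k := 0)) => n _ /=; rewrite tsub_scons => p.
  by apply: (prv_ex_intro (t := sval x n)); rewrite inst_sub_up.
have [k ρk] := tsub_coherent ρ.
have [|n kn [v pv]] := eventually_Ex (b := fun n => sub_form A (up_sub (tsub ρ n))) (k := k) _ p.
  move=> n kn; rewrite ρk // ren_sub_form; congr sub_form.
  apply: sub_ext; apply: var_inv => //= τ w.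
  by rewrite !ren_tm_sub !sub_sub_tm.
exists (extend_thread (Var v)).
have [l th] := sub_thread A (scons (extend_thread (Var v)) ρ).
have th' : form_thread (fun n => sub_form A (tsub (scons (extend_thread (Var v)) ρ) n)) n.+1.
  move=> m nm; rewrite !tsub_scons ρk; last exact: leq_trans kn (ltnW nm).
  rewrite ren_sub_form; apply: sub_form_ext; apply: var_inv => //=.
  rewrite [in LHS]/=; case: PeanoNat.Nat.eq_dec => // e; exfalso.
  by move: nm; rewrite -ltnS -e ltnn.
apply: (form_thread_stable th' (leqnn _)).
rewrite tsub_scons; move: pv; rewrite inst_sub_up; congr prv; congr sub_form; congr scons.
exact/esym/(extend_tm_refl (k := n.+1) (Var v)).
Qed.

Lemma forces_All Γ σ (A : form (σ :: Γ)) ρ :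
  forces (All A) ρ <-> forall x : thread σ, forces A (scons x ρ).
Proof.
split=> [p x|i].
  apply: (eventually_imp (k := 0)) p => n _ /= /(prv_all_elim (sval x n)).
  by rewrite inst_sub_up tsub_scons.
apply: NNPP => /forces_Neg p.
have /forces_Ex [x] : forces (Ex (Neg A)) ρ.
  by apply: (eventually_imp (k := 0)) p => n _ /=; apply: prv_not_all.
by move/forces_Neg; apply.
Qed.

Lemma forces_ax Γ (A : form Γ) ρ : T A -> forces A ρ.
Proof. by move=> a; exists 0 => n _; apply: prv_ax; apply: T_sub. Qed.

Lemma forces_G0 A ρ : In A G0 -> forces A ρ.
Proof.
move=> inA; have [k th] := sub_thread A ρ.
have th0 : form_thread (fun n => sub_form A (tsub ρ n)) 0.
  move=> n _; rewrite ren_sub_form; apply: sub_form_ext => σ v.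
  by dependent destruction v.
apply: (form_thread_stable th0 (leqnn 0)); apply: prv_hyp => /=.
suff -> : sub_form A (tsub ρ 0) = A by [].
rewrite -[RHS]sub_form_Var; apply: sub_form_ext => σ v.
by dependent destruction v.
Qed.

End Completeness.

(** * Extensional models and completeness *)

Section Quotient.
Variables (T : Type) (R : T -> T -> Prop).
Hypothesis R_refl : forall x, R x x.
Hypothesis R_sym : forall x y, R x y -> R y x.
Hypothesis R_trans : forall x y z, R x y -> R y z -> R x z.

Definition quotient : Type := {P : T -> Prop | exists x, P = R x}.

Definition class (x : T) : quotient := exist _ (R x) (ex_intro _ x erefl).

Definition repr (P : quotient) : T :=
  proj1_sig (constructive_indefinite_description _ (svalP P)).

Lemma quotient_eq (P Q : quotient) : sval P = sval Q -> P = Q.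
Proof.
case: P Q => [P p] [Q q] /= PQ; subst Q; f_equal.
exact: Classical_Prop.proof_irrelevance.
Qed.

Lemma class_eq x y : R x y -> class x = class y.
Proof.
move=> xy; apply: quotient_eq; apply: functional_extensionality => z.
by apply: propositional_extensionality; split; apply: R_trans => //; apply: R_sym.
Qed.

Lemma class_inj x y : class x = class y -> R x y.
Proof. by move=> /(congr1 sval) /= ->. Qed.

Lemma class_repr (P : quotient) : class (repr P) = P.
Proof.
apply: quotient_eq; rewrite /repr /=.
by case: constructive_indefinite_description.
Qed.

End Quotient.

(** By [app_ext], elements of arrow type are determined by their values, so pointwise equality at
    every type is interpreted by identity and may be rewritten with. *)
Record model := Model {
  dom :> ty -> Type;
  app : forall σ τ, dom (σ ⇒ τ) -> dom σ -> dom τ;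
  app_ext : forall σ τ (f g : dom (σ ⇒ τ)), (forall x, app f x = app g x) -> f = g;
  m_zero : dom N;
  m_one : dom N;
  m_plus : dom (N ⇒ N ⇒ N);
  m_times : dom (N ⇒ N ⇒ N);
  m_K : forall σ τ, dom (σ ⇒ τ ⇒ σ);
  m_S : forall ρ σ τ, dom ((ρ ⇒ σ ⇒ τ) ⇒ (ρ ⇒ σ) ⇒ ρ ⇒ τ);
  m_rec : dom (ty1 ⇒ N ⇒ N ⇒ N);
  m_lt : dom N -> dom N -> Prop }.

Definition env (M : model) (Γ : ctx) : Type := forall σ, var Γ σ -> M σ.

Fixpoint eval (M : model) Γ (ρ : env M Γ) σ (t : tm Γ σ) : M σ :=
  match t in tm _ σ return M σ with
  | Var _ v => ρ _ v
  | App _ _ t u => app (eval ρ t) (eval ρ u)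
  | Zero => m_zero M
  | One => m_one M
  | Plus => m_plus M
  | Times => m_times M
  | CombK σ τ => m_K M σ τ
  | CombS ρ σ τ => m_S M ρ σ τ
  | Rec0 => m_rec M
  end.

Fixpoint sat (M : model) Γ (A : form Γ) : env M Γ -> Prop :=
  match A in form Γ return env M Γ -> Prop with
  | Eq _ t u => fun ρ => eval ρ t = eval ρ u
  | Lt _ t u => fun ρ => m_lt (eval ρ t) (eval ρ u)
  | Bot _ => fun ρ => False
  | And _ A B => fun ρ => sat A ρ /\ sat B ρ
  | Or _ A B => fun ρ => sat A ρ \/ sat B ρ
  | Imp _ A B => fun ρ => sat A ρ -> sat B ρ
  | All _ σ A => fun ρ => forall x : M σ, sat A (scons x ρ)
  | Ex _ σ A => fun ρ => exists x : M σ, sat A (scons x ρ)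
  end.

Definition models (M : model) (T : theory) : Prop :=
  forall Γ (A : form Γ) (ρ : env M Γ), T Γ A -> sat A ρ.

Definition extensional (T : theory) : Prop := forall Γ ρ τ,
  T Γ (∀ x : ρ, ∀ y : ρ, ∀ φ : ρ ⇒ τ, eq_at ↑x ↑y → eq_at (φ · ↑x) (φ · ↑y))%L.

Section Collapse.
Variable T : theory.
Hypothesis T_sub : sub_closed T.
Hypothesis T_ext : extensional T.
Variable G0 : list (form []).
Hypothesis G0_consistent : consistent T G0.

Notation thread := (thread T G0).
Notation forces := (@forces T G0 _).

Lemma thread_eq σ (x y : thread σ) : (forall n, sval x n = sval y n) -> x = y.
Proof.
case: x y => [x px] [y py] /= e.
have xy : x = y by apply: functional_extensionality_dep.
by subst y; f_equal; apply: Classical_Prop.proof_irrelevance.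
Qed.

Definition default_env Γ : tenv T G0 Γ :=
  fun σ _ => @extend_thread T G0 σ 0 (closed_tm σ _).

Definition teval Γ (ρ : tenv T G0 Γ) σ (t : tm Γ σ) : thread σ.
Proof.
exists (fun n => sub_tm (tsub ρ n) t).
have [k ρk] := tsub_coherent ρ; exists k => n kn.
by rewrite ρk // ren_sub_tm.
Defined.

Lemma teval_App Γ (ρ : tenv T G0 Γ) σ τ (t : tm Γ (σ ⇒ τ)) (u : tm Γ σ) :
  teval ρ (App t u) = tapp (teval ρ t) (teval ρ u).
Proof. exact: thread_eq. Qed.

Lemma teval_Var Γ (ρ : tenv T G0 Γ) σ (v : var Γ σ) : teval ρ (Var v) = ρ σ v.
Proof. exact: thread_eq. Qed.

Lemma teval_shift Γ (ρ : tenv T G0 Γ) σ τ (x : thread τ) (t : tm Γ σ) :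
  teval (scons x ρ) (ren_tm shift t) = teval ρ t.
Proof. by apply: thread_eq => n /=; rewrite sub_ren_tm. Qed.

Definition eqv0 (x y : thread N) : Prop :=
  eventually (T := T) (G0 := G0) (fun n => Eq (sval x n) (sval y n)).

Fixpoint eqv σ : thread σ -> thread σ -> Prop :=
  match σ with
  | N => eqv0
  | Arr σ τ => fun f g => forall x : thread σ, eqv (tapp f x) (tapp g x)
  end.

Lemma forces_eq_at τ : forall Γ (s t : tm Γ τ) (ρ : tenv T G0 Γ),
  forces (eq_at s t) ρ <-> eqv (teval ρ s) (teval ρ t).
Proof.
elim: τ => [|σ _ τ IH] Γ s t ρ //=.
rewrite forces_All //; split=> p x; have := p x; rewrite IH !teval_App !teval_shift teval_Var //.
Qed.

Lemma eqv_refl σ (x : thread σ) : eqv x x.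
Proof. elim: σ x => [|σ _ τ IH] x //=; by exists 0%N => n _; apply: prv_eq_refl. Qed.

Lemma prv_eq_sym Γ (G : list (form Γ)) s t : prv T G (Eq s t) -> prv T G (Eq t s).
Proof.
move=> p; have := prv_eq_subst (A := Eq (Var vz) (ren_tm shift s)) p.
by rewrite /inst /= !sub_ren_tm /= !sub_tm_Var; apply; apply: prv_eq_refl.
Qed.

Lemma prv_eq_trans Γ (G : list (form Γ)) s t u :
  prv T G (Eq s t) -> prv T G (Eq t u) -> prv T G (Eq s u).
Proof.
move=> p q; have := prv_eq_subst (A := Eq (ren_tm shift s) (Var vz)) q.
by rewrite /inst /= !sub_ren_tm /= !sub_tm_Var; apply.
Qed.

Lemma prv_Lt_subst Γ (G : list (form Γ)) s t s' t' :
  prv T G (Eq s s') -> prv T G (Eq t t') -> prv T G (Lt s t) -> prv T G (Lt s' t').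
Proof.
move=> p q r; have := prv_eq_subst (A := Lt (ren_tm shift s') (Var vz)) q.
rewrite /inst /= !sub_ren_tm /= !sub_tm_Var; apply.
have := prv_eq_subst (A := Lt (Var vz) (ren_tm shift t)) p.
by rewrite /inst /= !sub_ren_tm /= !sub_tm_Var; apply.
Qed.

Lemma eqv_sym σ (x y : thread σ) : eqv x y -> eqv y x.
Proof.
elim: σ x y => [|σ _ τ IH] x y /= p; last by move=> z; apply: IH.
by apply: (eventually_imp (k := 0%N)) p => n _; apply: prv_eq_sym.
Qed.

Lemma eqv_trans σ (x y z : thread σ) : eqv x y -> eqv y z -> eqv x z.
Proof.
elim: σ x y z => [|σ _ τ IH] x y z /= p q; last by move=> w; apply: IH (p w) (q w).
by apply: eventually_imp2 p q => n; apply: prv_eq_trans.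
Qed.

(** That a functional respects [eqv] of its arguments is the extensionality axiom, read in the model
    of threads. It makes application well defined on classes. *)
Lemma eqv_tapp σ τ (f g : thread (σ ⇒ τ)) (x y : thread σ) :
  eqv f g -> eqv x y -> eqv (tapp f x) (tapp g y).
Proof.
move=> fg xy; apply: eqv_trans (fg x) _.
have /forces_All -/(_ T_sub G0_consistent x) := forces_ax T_sub (default_env (Γ := [])) (T_ext [] σ τ).
move=> /forces_All -/(_ T_sub G0_consistent y) /forces_All -/(_ T_sub G0_consistent g).
move=> /forces_Imp -/(_ T_sub G0_consistent).
by rewrite !forces_eq_at !teval_App !teval_Var /=; apply.
Qed.

Definition collapse σ : Type := quotient (@eqv σ).

Definition cls σ (x : thread σ) : collapse σ := class (@eqv σ) x.
Definition rep σ (P : collapse σ) : thread σ := repr P.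

Lemma cls_eq σ (x y : thread σ) : eqv x y -> cls x = cls y.
Proof. exact: class_eq (@eqv_sym σ) (@eqv_trans σ) _ _. Qed.

Lemma eqv_cls σ (x y : thread σ) : cls x = cls y -> eqv x y.
Proof. exact: class_inj (@eqv_refl σ) _ _. Qed.

Lemma rep_cls σ (P : collapse σ) : cls (rep P) = P.
Proof. exact: class_repr. Qed.

Lemma eqv_rep σ (x : thread σ) : eqv (rep (cls x)) x.
Proof. by apply: eqv_cls; rewrite rep_cls. Qed.

Definition capp σ τ (P : collapse (σ ⇒ τ)) (Q : collapse σ) : collapse τ :=
  cls (tapp (rep P) (rep Q)).

Lemma capp_cls σ τ (f : thread (σ ⇒ τ)) (x : thread σ) :
  capp (cls f) (cls x) = cls (tapp f x).
Proof. by apply: cls_eq; apply: eqv_tapp; apply: eqv_rep. Qed.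

Lemma capp_ext σ τ (P Q : collapse (σ ⇒ τ)) :
  (forall x, capp P x = capp Q x) -> P = Q.
Proof.
move=> e; rewrite -(rep_cls P) -(rep_cls Q); apply: cls_eq => x; apply: eqv_cls.
by rewrite -!capp_cls !rep_cls.
Qed.

Definition clt (P Q : collapse N) : Prop :=
  eventually (T := T) (G0 := G0) (fun n => Lt (sval (rep P) n) (sval (rep Q) n)).

Lemma clt_cls (x y : thread N) :
  clt (cls x) (cls y) <-> eventually (T := T) (G0 := G0) (fun n => Lt (sval x n) (sval y n)).
Proof.
have ex := eqv_rep x; have ey := eqv_rep y; split=> p.
  have pp := eventually_imp2 (fun n => @prv_and_intro T _ _ _ _) ex ey.
  apply: eventually_imp2 pp p => n pq.
  by apply: prv_Lt_subst; [apply: prv_and_elim1 pq | apply: prv_and_elim2 pq].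
have pp := eventually_imp2 (fun n => @prv_and_intro T _ _ _ _) (eqv_sym ex) (eqv_sym ey).
apply: eventually_imp2 pp p => n pq.
by apply: prv_Lt_subst; [apply: prv_and_elim1 pq | apply: prv_and_elim2 pq].
Qed.

Definition cconst σ (c : forall Γ, tm Γ σ) : collapse σ :=
  cls (teval (default_env (Γ := [])) (c [])).

Definition henkin : model :=
  Model capp_ext (cconst (@Zero)) (cconst (@One)) (cconst (@Plus)) (cconst (@Times))
    (fun σ τ => cconst (fun Γ => CombK σ τ)) (fun ρ σ τ => cconst (fun Γ => CombS ρ σ τ))
    (cconst (@Rec0)) clt.

Lemma eval_henkin Γ (ρ : tenv T G0 Γ) σ (t : tm Γ σ) :
  eval (M := henkin) (fun σ v => cls (ρ σ v)) t = cls (teval ρ t).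
Proof.
elim: t => {σ} [σ v|σ τ t IHt u IHu| | | | |σ τ|ρ' σ τ|] /=;
  try by congr cls; apply: thread_eq.
by rewrite IHt IHu capp_cls teval_App.
Qed.

Lemma cls_scons Γ σ (x : thread σ) (ρ : tenv T G0 Γ) :
  (fun τ v => cls (scons x ρ v)) = scons (P := henkin) (cls x) (fun τ v => cls (ρ τ v)).
Proof. by apply: (sub_ext (P := henkin)); apply: var_inv. Qed.

Lemma sat_henkin Γ (A : form Γ) : forall ρ : tenv T G0 Γ,
  sat (M := henkin) A (fun σ v => cls (ρ σ v)) <-> forces A ρ.
Proof.
elim: A => {Γ} [Γ t u|Γ t u|Γ|Γ A IHA B IHB|Γ A IHA B IHB|Γ A IHA B IHB|Γ σ A IHA|Γ σ A IHA] ρ /=.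
- rewrite !eval_henkin; split; first by move/eqv_cls.
  by move=> p; apply: cls_eq.
- by rewrite !eval_henkin; apply: clt_cls.
- by split=> // /(forces_Bot G0_consistent).
- by rewrite forces_And // IHA IHB.
- by rewrite forces_Or // IHA IHB.
- by rewrite forces_Imp // IHA IHB.
- rewrite forces_All //; split=> p x; last rewrite -(rep_cls x).
    by apply/IHA; rewrite cls_scons.
  by have /IHA := p (rep x); rewrite cls_scons.
- rewrite forces_Ex //; split=> -[x p]; [exists (rep x) | exists (cls x)].
    by apply/IHA; rewrite cls_scons rep_cls.
  by move/IHA: p; rewrite cls_scons.
Qed.

End Collapse.

(** If [A] is not derivable, then [Neg A] by itself is consistent, and its collapsed Henkin model
    satisfies [T] but refutes [A]. *)
Theorem completeness T (A : sentence) : sub_closed T -> extensional T ->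
  (forall M, models M T -> forall ρ : env M [], sat A ρ) -> proves T A.
Proof.
move=> cT eT valid; apply: prv_raa; apply: NNPP => cons.
pose M := henkin cT eT cons.
have e Γ (ρ : env M Γ) : ρ = fun σ v => cls (rep (ρ σ v)).
  by apply: (sub_ext (P := M)) => σ v; rewrite rep_cls.
have mM : models M T by move=> Γ B ρ b; rewrite (e _ ρ) sat_henkin //; apply: forces_ax.
pose ρ0 : tenv T [Neg A] [] := @default_env _ _ _.
have /sat_henkin := valid M mM (fun σ v => cls (ρ0 σ v)).
have /forces_Neg -/(_ cT cons) : forces (Neg A) ρ0 by apply: forces_G0 => //; left.
by apply.
Qed.

(** * Closure of the axioms under substitution *)

Lemma sub_eq_at τ : forall Γ Δ (s : sub Γ Δ) (t u : tm Γ τ),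
  sub_form (eq_at t u) s = eq_at (sub_tm s t) (sub_tm s u).
Proof.
elim: τ => [|σ _ τ IH] Γ Δ s t u //=.
rewrite /all /=; congr All; rewrite IH /= /weaken; congr eq_at; congr App.
all: exact: up_sub_shift.
Qed.

Lemma quantifier_free_sub Γ (A : form Γ) : forall Δ (s : sub Γ Δ),
  quantifier_free A -> quantifier_free (sub_form A s).
Proof.
by elim: A => {Γ} // Γ A IHA B IHB Δ s /= [a b]; split; auto.
Qed.

Lemma sub_choice_instance Γ Δ σ τ (A : form (τ :: σ :: Γ)) (s : sub Γ Δ) :
  sub_form (choice_instance A) s = choice_instance (sub_form A (up_sub (up_sub s))).
Proof.
rewrite /choice_instance /=; congr Imp; rewrite /ex /all /=; congr Ex; congr All.
rewrite sub_inst /inst !sub_ren_form !sub_sub_form; apply: sub_form_ext.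
apply: var_inv => //; apply: var_inv => // ρ v.
by rewrite /= !sub_ren_tm.
Qed.

Lemma sub_induction_instance Γ Δ (A : form (N :: Γ)) (s : sub Γ Δ) :
  sub_form (induction_instance A) s = induction_instance (sub_form A (up_sub s)).
Proof.
rewrite /induction_instance /= sub_inst; congr Imp; congr And; rewrite /all; congr All => /=.
congr Imp; rewrite sub_inst /inst !sub_ren_form !sub_sub_form; apply: sub_form_ext.
apply: var_inv => // ρ v.
by rewrite /= !sub_ren_tm.
Qed.

Lemma QF_AC_sub_closed σ τ : sub_closed (QF_AC σ τ).
Proof.
move=> Γ Δ A s ax; case: ax s => {Γ A} Γ A qA s; rewrite sub_choice_instance.
by constructor; apply: quantifier_free_sub.
Qed.

Lemma RCA0ω_sub_closed : sub_closed RCA0ω.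
Proof.
move=> Γ Δ A s ax; case: ax s => {Γ A}.
- move=> Γ A inA s; apply: rca_basic.
  (* The 17 basic axioms are closed, so substitution turns each into its own copy over the new
     context. *)
  by move: inA; do 17! (case; [by move=> <-; rewrite /=; intuition | ]).
- move=> Γ σ τ s; have := rca_K Δ σ τ; congr RCA0ω.
  by rewrite /all /= sub_eq_at.
- move=> Γ ρ σ τ s; have := rca_S Δ ρ σ τ; congr RCA0ω.
  by rewrite /all /= sub_eq_at.
- move=> Γ s; exact: rca_R0_zero.
- move=> Γ s; exact: rca_R0_succ.
- move=> Γ ρ τ s; have := rca_ext Δ ρ τ; congr RCA0ω.
  by rewrite /all /= !sub_eq_at.
- move=> Γ A qA s; rewrite sub_induction_instance; apply: rca_ind.
  exact: quantifier_free_sub.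
- by move=> Γ A ax s; apply: rca_qf_ac; apply: QF_AC_sub_closed.
Qed.

Lemma just_FF_sub_closed : sub_closed just_FF.
Proof. by move=> Γ Δ A s ax; case: ax s => {Γ A} Γ s; apply: (just_FF_intro Δ). Qed.

Lemma extend_sub_closed T U : sub_closed T -> sub_closed U -> sub_closed (extend T U).
Proof.
move=> cT cU Γ Δ A s ax; case: ax s => {Γ A} Γ A a s.
  by apply: extend_l; apply: cT.
by apply: extend_r; apply: cU.
Qed.

Lemma RCA0ω_FF_QFAC21_sub_closed : sub_closed RCA0ω_FF_QFAC21.
Proof.
apply: extend_sub_closed; last exact: QF_AC_sub_closed.
by apply: extend_sub_closed; [apply: RCA0ω_sub_closed | apply: just_FF_sub_closed].
Qed.

(** * Arithmetic in a model *)

Record rca_model := RcaModel { rm :> model; rmP : models rm RCA0ω }.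

Declare Scope M_scope.
Delimit Scope M_scope with M.
Notation "f • x" := (app f x) (at level 11, left associativity) : M_scope.
Notation "0" := (m_zero _) : M_scope.
Notation "1" := (m_one _) : M_scope.
Notation "x + y" := (app (app (m_plus _) x) y) : M_scope.
Notation "x * y" := (app (app (m_times _) x) y) : M_scope.
Notation "x < y" := (m_lt x y) : M_scope.
Notation "x <= y" := (m_lt x y \/ x = y) : M_scope.
Notation "⟨ x , y ⟩" := ((x + y) * (x + y) + x)%M : M_scope.
Local Open Scope M_scope.

Definition nil_env (M : model) : env M [] := fun σ v =>
  match v in var Γ' σ' return match Γ' with [] => M σ' | _ => unit end with
  | vz _ _ => tt
  | vs _ _ _ _ => tt
  end.

Definition cI (M : model) (σ : ty) : M (σ ⇒ σ) :=
  m_S M σ (σ ⇒ σ) σ • m_K M σ (σ ⇒ σ) • m_K M σ σ.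

Lemma sat_eq_at (M : model) τ : forall Γ (s t : tm Γ τ) (ρ : env M Γ),
  sat (eq_at s t) ρ <-> eval ρ s = eval ρ t.
Proof.
have evs Γ (ρ : env M Γ) σ τ' (x : M τ') (t : tm Γ σ) :
    eval (scons (P := M) x ρ) (ren_tm shift t) = eval ρ t.
  by elim: t => //= σ' τ'' t -> u ->.
elim: τ => [|σ _ τ IH] Γ s t ρ //=; split=> [e|e x].
  by apply: app_ext => x; have /IH /= := e x; rewrite !evs.
by apply/IH => /=; rewrite !evs e.
Qed.

Lemma eval_sub (M : model) Γ Δ (s : sub Γ Δ) (ρ : env M Δ) σ (t : tm Γ σ) :
  eval ρ (sub_tm s t) = eval (fun τ v => eval ρ (s τ v)) t.
Proof. by elim: t => //= σ' τ t -> u ->. Qed.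

Lemma sat_sub (M : model) Γ (A : form Γ) : forall Δ (s : sub Γ Δ) (ρ : env M Δ),
  sat (sub_form A s) ρ <-> sat A (fun τ v => eval ρ (s τ v)).
Proof.
have up Γ' Δ (s : sub Γ' Δ) (ρ : env M Δ) σ (x : M σ) :
    (fun τ v => eval (scons x ρ) (up_sub s v)) =
    scons (P := M) x (fun τ v => eval ρ (s τ v)).
  apply: (sub_ext (P := M)); apply: var_inv => //= τ v.
  by rewrite ren_tm_sub eval_sub.
elim: A => {Γ} [Γ t u|Γ t u|Γ|Γ A IHA B IHB|Γ A IHA B IHB|Γ A IHA B IHB|Γ σ A IHA|Γ σ A IHA] Δ s ρ /=.
- by rewrite !eval_sub.
- by rewrite !eval_sub.
- by [].
- by rewrite IHA IHB.
- by rewrite IHA IHB.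
- by rewrite IHA IHB.
- by split=> p x; have := p x; rewrite IHA up.
- by split=> -[x p]; exists x; move: p; rewrite IHA up.
Qed.

Lemma sat_choice (M : model) Γ σ τ (A : form (τ :: σ :: Γ)) (ρ : env M Γ) :
  sat (choice_instance A) ρ ->
  (forall x : M σ, exists y : M τ, sat A (scons (P := M) y (scons (P := M) x ρ))) ->
  exists Y : M (σ ⇒ τ), forall x : M σ,
    sat A (scons (P := M) (Y • x) (scons (P := M) x ρ)).
Proof.
move=> ac /ac [Y HY]; exists Y => x.
have : sat (inst (ren_form A (up_ren (up_ren shift)))
    (App (Var (vs vz)) (Var vz))) (scons (P := M) x (scons (P := M) Y ρ)) := HY x.
rewrite /inst ren_form_sub sub_sub_form sat_sub; congr sat.
by apply: (sub_ext (P := M)); apply: var_inv => //; apply: var_inv.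
Qed.

Section Basic.
Variable M : rca_model.

Lemma KE σ τ (x : M σ) (y : M τ) : m_K M σ τ • x • y = x.
Proof. by have /sat_eq_at := rmP (@nil_env M) (rca_K [] σ τ) x y. Qed.

Lemma SE ρ σ τ (x : M (ρ ⇒ σ ⇒ τ)) (y : M (ρ ⇒ σ)) (z : M ρ) :
  m_S M ρ σ τ • x • y • z = x • z • (y • z).
Proof. by have /sat_eq_at := rmP (@nil_env M) (rca_S [] ρ σ τ) x y z. Qed.

Lemma IE σ (x : M σ) : cI M σ • x = x.
Proof. by rewrite /cI SE KE. Qed.

Lemma rec0 (f : M ty1) (m : M N) : m_rec M • f • m • 0 = m.
Proof. exact: (rmP (@nil_env M) (rca_R0_zero []) f m). Qed.

Lemma recS (f : M ty1) (m n : M N) : m_rec M • f • m • (n + 1) = f • (m_rec M • f • m • n).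
Proof. exact: (rmP (@nil_env M) (rca_R0_succ []) f m n). Qed.

Lemma basic k A : nth_error (basic_axioms []) k = Some A -> sat A (@nil_env M).
Proof. by move=> e; apply: rmP; apply: rca_basic; apply: nth_error_In e. Qed.

Implicit Types x y z : M N.

Lemma addA x y z : (x + y) + z = x + (y + z).
Proof. exact: (basic (k := 0) erefl x y z). Qed.
Lemma addC x y : x + y = y + x.
Proof. exact: (basic (k := 1) erefl x y). Qed.
Lemma addx0 x : x + 0 = x.
Proof. exact: (basic (k := 2) erefl x). Qed.
Lemma mulA x y z : (x * y) * z = x * (y * z).
Proof. exact: (basic (k := 3) erefl x y z). Qed.
Lemma mulC x y : x * y = y * x.
Proof. exact: (basic (k := 4) erefl x y). Qed.
Lemma mulx1 x : x * 1 = x.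
Proof. exact: (basic (k := 5) erefl x). Qed.
Lemma mulx0 x : x * 0 = 0.
Proof. exact: (basic (k := 6) erefl x). Qed.
Lemma mulDr x y z : x * (y + z) = x * y + x * z.
Proof. exact: (basic (k := 7) erefl x y z). Qed.
Lemma mlt_irr x : ~ x < x.
Proof. exact: (basic (k := 8) erefl x). Qed.
Lemma mlt_trans x y z : x < y -> y < z -> x < z.
Proof. by move=> xy yz; apply: (basic (k := 9) erefl x y z). Qed.
Lemma mlt_total x y : x < y \/ x = y \/ y < x.
Proof. exact: (basic (k := 10) erefl x y). Qed.
Lemma lt_add2r x y z : x < y -> x + z < y + z.
Proof. exact: (basic (k := 11) erefl x y z). Qed.
Lemma lt_mul2r x y z : 0 < z -> x < y -> x * z < y * z.
Proof. by move=> z0 xy; apply: (basic (k := 12) erefl x y z). Qed.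
Lemma lt_sub x y : x < y -> exists z, x + z = y.
Proof. exact: (basic (k := 13) erefl x y). Qed.
Lemma mle0x x : 0 <= x.
Proof. exact: (basic (k := 14) erefl x). Qed.
Lemma lt01 : (0 : M N) < 1.
Proof. exact: (basic (k := 15) erefl). Qed.
Lemma lt0_le1 x : 0 < x -> 1 <= x.
Proof. exact: (basic (k := 16) erefl x). Qed.

(* [ring] only recognizes operations that are applied to both of their arguments. *)
Definition madd x y : M N := x + y.
Definition mmul x y : M N := x * y.
Lemma maddE x y : x + y = madd x y. Proof. by []. Qed.
Lemma mmulE x y : x * y = mmul x y. Proof. by []. Qed.

Lemma semiring : semi_ring_theory (0 : M N) 1 madd mmul eq.
Proof.
split; rewrite /madd /mmul.
- by move=> x; rewrite addC addx0.
- exact: addC.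
- by move=> x y z; rewrite addA.
- by move=> x; rewrite mulC mulx1.
- by move=> x; rewrite mulC mulx0.
- exact: mulC.
- by move=> x y z; rewrite mulA.
- by move=> x y z; rewrite mulC mulDr mulC (mulC z y).
Qed.

Lemma lt0S x : 0 < x + 1.
Proof.
case: (mle0x x) => [x0|<-]; last by rewrite addC addx0; apply: lt01.
by apply: mlt_trans x0 _; have := lt_add2r x lt01; rewrite (addC 0) addx0 addC.
Qed.

Lemma addI x y z : x + z = y + z -> x = y.
Proof.
by case: (mlt_total x y) => [/(lt_add2r z) + e|[//|/(lt_add2r z) + e]];
  rewrite e => /mlt_irr.
Qed.

Lemma lt_add2rE x y z : x + z < y + z -> x < y.
Proof.
case: (mlt_total x y) => [//|[->|/(lt_add2r z) p q]]; first by move/mlt_irr.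
by case: (mlt_irr (mlt_trans p q)).
Qed.

Lemma zero_or_succ x : x = 0 \/ exists y, x = y + 1.
Proof.
case: (mle0x x) => [/lt0_le1|->]; last by left.
case=> [/lt_sub [z <-]|<-]; right; first by exists z; rewrite addC.
by exists 0; rewrite addC addx0.
Qed.

Lemma succ_neq0 x : x + 1 <> 0.
Proof. by move=> e; have := lt0S x; rewrite e => /mlt_irr. Qed.

Lemma lt_succ x : x < x + 1.
Proof. by have := lt_add2r x lt01; rewrite addC addx0 addC. Qed.

Lemma le_addr x y : x <= x + y.
Proof.
case: (mle0x y) => [/(lt_add2r x)|<-]; last by rewrite addx0; right.
by rewrite (addC 0) addx0 addC; left.
Qed.

Lemma mltx0 x : ~ x < 0.
Proof. by case: (mle0x x) => [p q|<-]; [case: (mlt_irr (mlt_trans p q)) | exact: mlt_irr]. Qed.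

Lemma ltS_le x y : x < y + 1 -> x <= y.
Proof.
case: (mlt_total x y) => [|[|/lt_sub [z e]]]; [by left | by right |].
case: (zero_or_succ z) e => [->|[w ->]]; first by rewrite addx0; right.
have -> : y + (w + 1) = w + (y + 1) by rewrite -addA (addC y) addA.
move=> <-; have {2}-> : y + 1 = 0 + (y + 1) by rewrite (addC 0) addx0.
by move=> /lt_add2rE /mltx0.
Qed.

Lemma le_ltS x y : x <= y -> x < y + 1.
Proof. by case=> [xy|->]; [apply: mlt_trans xy _|]; apply: lt_succ. Qed.

End Basic.

(* [abs x b] is bracket abstraction: a term [h] not containing [x] with [h • x = b]. *)
Ltac abs x b :=
  lazymatch b with
  | x => let t := type of x in lazymatch t with dom ?M ?σ => constr:(cI M σ) end
  | context [x] =>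
    lazymatch b with
    | app ?f x => lazymatch f with
        | context [x] => abs_app x b
        | _ => f
        end
    | _ => abs_app x b
    end
  | _ => let t := type of x in lazymatch t with dom ?M ?σ => constr:(app (m_K M _ σ) b) end
  end
with abs_app x b :=
  lazymatch b with
  | app ?f ?a =>
    let f' := abs x f in
    let a' := abs x a in
    constr:(app (app (m_S _ _ _ _) f') a')
  end.

Lemma app_cong (M : model) σ τ (f g : M (σ ⇒ τ)) (x y : M σ) : f = g -> x = y -> f • x = g • y.
Proof. by move=> -> ->. Qed.

Lemma lam_step (M : model) σ τ (g h : M (σ ⇒ τ)) (x : M σ) b : h • x = b -> g = h -> g • x = b.
Proof. by move=> + ->. Qed.

Ltac beta :=
  lazymatch goal with
  | |- ?a = ?a => reflexivity
  | |- app (cI _ _) _ = _ => first [exact (IE _) | reflexivity]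
  | |- app (app (m_K _ _ _) _) _ = _ => first [exact (KE _ _) | reflexivity]
  | |- app (app (app (m_S _ _ _ _) _) _) _ = _ =>
      first [refine (eq_trans (SE _ _ _) _); apply: app_cong; beta | reflexivity]
  | |- _ => reflexivity
  end.

Ltac lam_core :=
  lazymatch goal with
  | |- app ?g ?x = ?b =>
      let h := abs x b in
      refine (@lam_step _ _ _ g h x b _ _); [beta | lam_core]
  | |- _ => reflexivity
  end.

(** Combinatory completeness: an element with the stated defining equation is built by abstracting
    the arguments one at a time, beginning with the last. *)
Ltac lam := eexists; intros; lam_core.

Notation cid := (constructive_indefinite_description _).

Lemma iff_sub (M : model) (P : Prop) (a b c : M N) : (P <-> b = c) -> a = b -> (P <-> a = c).
Proof. by move=> + ->. Qed.

(** * Definition by cases, truncated subtraction and characteristic terms *)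

Section Arith.
Variable M : rca_model.
Implicit Types a b c n m : M N.
Add Ring M_ring : (semiring M).

Lemma ind_app (f : M ty1) : f • 0 = 0 -> (forall n, f • n = 0 -> f • (n + 1) = 0) ->
  forall n, f • n = 0.
Proof.
move=> f0 fS; apply: (rmP (scons (P := M) f (@nil_env M))
  (@rca_ind [ty1] (Eq (App (Var (vs vz)) (Var vz)) Zero) _)).
all: by [].
Qed.

Lemma qf_ac10 Γ (A : form (N :: ty1 :: Γ)) (ρ : env M Γ) : quantifier_free A ->
  (forall x : M ty1, exists y, sat A (scons (P := M) y (scons (P := M) x ρ))) ->
  exists Y : M ty2, forall x : M ty1,
    sat A (scons (P := M) (Y • x) (scons (P := M) x ρ)).
Proof. by move=> qA; apply: sat_choice; apply: rmP; apply: rca_qf_ac; constructor. Qed.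

(** Definition by cases on zero: iterating the constant function [b] from [a] gives [a] at 0 and [b]
    at every successor. *)
Lemma select_ex : exists f : M (N ⇒ N ⇒ N ⇒ N), forall a b n,
  f • a • b • n = m_rec M • (m_K M N N • b) • a • n.
Proof. lam. Qed.

Definition select := proj1_sig (cid select_ex).

Lemma select0 a b : select • a • b • 0 = a.
Proof. by rewrite (proj2_sig (cid select_ex)) rec0. Qed.

Lemma selectS a b n : select • a • b • (n + 1) = b.
Proof. by rewrite (proj2_sig (cid select_ex)) recS KE. Qed.

(** [Rec0] iterates without access to its counter, so the predecessor comes from choice at type 1, a
    number being passed as a constant function. *)
Lemma pred_ex : exists f : M ty1, forall n, f • (n + 1) = n.
Proof.
pose y : tm [N; ty1] N := Var vz; pose x : tm [N; ty1] ty1 := Var (vs vz).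
have [|v|Y HY] := @qf_ac10 [] ((x · 0 ≐ 0 ∧ y ≐ 0) ∨ x · 0 ≐ y + 1)%L (@nil_env M).
- by rewrite /=; intuition.
- case: (zero_or_succ (v • 0)) => [e|[w e]]; first by exists 0; left.
  by exists w; right.
have [f Hf] : exists f : M ty1, forall n, f • n = Y • (m_K M N N • n) by lam.
exists f => n; rewrite Hf.
by have := HY (m_K M N N • (n + 1)); rewrite /= !KE => -[[/succ_neq0]|/addI/esym].
Qed.

Definition mpred := proj1_sig (cid pred_ex).

Lemma mpredS n : mpred • (n + 1) = n.
Proof. exact: (proj2_sig (cid pred_ex)). Qed.

Lemma choice2 (A : form [N; ty1]) : quantifier_free A ->
  (forall x : M ty1, exists y, sat A (scons (P := M) y (scons (P := M) x (@nil_env M)))) ->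
  exists f : M (N ⇒ N ⇒ N), forall a b, exists2 x : M ty1, x • 0 = a /\ x • 1 = b &
    sat A (scons (P := M) (f • a • b) (scons (P := M) x (@nil_env M))).
Proof.
move=> qA /(qf_ac10 qA) [Y HY].
have [f Hf] : exists f : M (N ⇒ N ⇒ N), forall a b, f • a • b = Y • (select • a • b) by lam.
exists f => a b; exists (select • a • b); last by rewrite Hf.
by rewrite select0; have := selectS a b 0; rewrite (addC 0) addx0.
Qed.

(** Truncated subtraction is obtained from choice as well; it is the source of the terms that
    represent [=] and [<]. *)
Lemma monus_ex : exists f : M (N ⇒ N ⇒ N), forall a b,
  a < b /\ f • a • b = 0 \/ a = b + f • a • b.
Proof.
pose y : tm [N; ty1] N := Var vz; pose x : tm [N; ty1] ty1 := Var (vs vz).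
have [|v|f Hf] := @choice2 ((x · 0 ≺ x · 1 ∧ y ≐ 0) ∨ x · 0 ≐ x · 1 + y)%L.
- by rewrite /=; intuition.
- case: (mlt_total (v • 0) (v • 1)) => [e|[e|/lt_sub [z e]]].
  + by exists 0; left.
  + by exists 0; right; rewrite /= e addx0.
  + by exists z; right.
by exists f => a b; have [x' [<- <-]] := Hf a b.
Qed.

Definition monus := proj1_sig (cid monus_ex).
Definition monusP : forall a b, a < b /\ monus • a • b = 0 \/ a = b + monus • a • b :=
  proj2_sig (cid monus_ex).

Lemma monus_eq0 a b : monus • a • b = 0 <-> a <= b.
Proof.
case: (monusP a b) => [[ab ->]|e]; first by split=> // _; left.
split=> [e'|]; first by right; rewrite e e' addx0.
case: (zero_or_succ (monus • a • b)) e => [//|[w ->]] -> [p|e]; exfalso.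
  by case: (le_addr b (w + 1)) => [/(mlt_trans p)|q]; [|move: p; rewrite -q]; apply: mlt_irr.
by apply: (@succ_neq0 M w); apply: (@addI M _ _ b); rewrite addC e (addC 0) addx0.
Qed.

Lemma le_lt_irr a b : a <= b -> b < a -> False.
Proof. by case=> [ab ba|->]; [apply: mlt_irr (mlt_trans ab ba) | apply: mlt_irr]. Qed.

Lemma lt_succ_le a b : a < b <-> a + 1 <= b.
Proof.
split=> [|[|<-]]; [|by apply: mlt_trans; apply: lt_succ | exact: lt_succ].
case: (mlt_total (a + 1) b) => [|[]]; [by left | by right |].
by move=> /ltS_le ba ab; case: (le_lt_irr ba ab).
Qed.

Lemma mle_anti a b : a <= b -> b <= a -> a = b.
Proof. by case=> // ab ba; case: (le_lt_irr ba ab). Qed.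

Lemma monus_self a : monus • a • a = 0.
Proof. by apply/monus_eq0; right. Qed.

Lemma add_eq0 a b : a + b = 0 <-> a = 0 /\ b = 0.
Proof.
split=> [|[-> ->]]; last exact: addx0.
case: (zero_or_succ b) => [->|[w ->]]; first by rewrite addx0.
by rewrite -addA => /succ_neq0.
Qed.

Lemma mul_eq0 a b : a * b = 0 <-> a = 0 \/ b = 0.
Proof.
split=> [|[->|->]]; [|by rewrite mulC mulx0|exact: mulx0].
case: (zero_or_succ b) => [->|[w ->]]; first by right.
by rewrite mulDr mulx1 => /add_eq0 [_ ->]; left.
Qed.

Lemma one_neq0 : (1 : M N) <> 0.
Proof. by move=> e; have := @lt01 M; rewrite e => /mlt_irr. Qed.

Lemma add0x a : 0 + a = a.
Proof. by rewrite addC addx0. Qed.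

(** Here and below, a term represents a predicate by vanishing exactly where it holds, so
    conjunction becomes a sum and disjunction a product. *)
Lemma refl_eq a b : a = b <-> monus • a • b + monus • b • a = 0.
Proof.
rewrite add_eq0 !monus_eq0; split=> [->|[ab ba]]; first by split; right.
exact: mle_anti.
Qed.

Lemma refl_lt a b : a < b <-> monus • (a + 1) • b = 0.
Proof. by rewrite monus_eq0 lt_succ_le. Qed.

Lemma refl_and (P Q : Prop) a b : (P <-> a = 0) -> (Q <-> b = 0) -> (P /\ Q <-> a + b = 0).
Proof. by move=> -> ->; rewrite add_eq0. Qed.

Lemma refl_or (P Q : Prop) a b : (P <-> a = 0) -> (Q <-> b = 0) -> (P \/ Q <-> a * b = 0).
Proof. by move=> -> ->; rewrite mul_eq0. Qed.

Lemma refl_not (P : Prop) a : (P <-> a = 0) -> (~ P <-> monus • 1 • a = 0).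
Proof.
move=> ->; rewrite monus_eq0; split=> [|].
  by case: (mle0x a) => [/lt0_le1|<-].
by move=> p e; move: p; rewrite e => -[/mltx0|/one_neq0].
Qed.

Lemma refl_imp (P Q : Prop) a b : (P <-> a = 0) -> (Q <-> b = 0) ->
  ((P -> Q) <-> monus • 1 • a * b = 0).
Proof.
move=> p q; rewrite -(refl_or (refl_not p) q).
by split=> [i|[]//]; case: (classic P) => [/i|]; [right | left].
Qed.

Lemma refl_iff (P Q : Prop) a b : (P <-> a = 0) -> (Q <-> b = 0) ->
  ((P <-> Q) <-> monus • 1 • a * b + monus • 1 • b * a = 0).
Proof. by move=> p q; apply: refl_and; apply: refl_imp. Qed.

Lemma refl_True : True <-> (0 : M N) = 0.
Proof. by []. Qed.

Lemma refl_False : False <-> (1 : M N) = 0.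
Proof. by split=> // /one_neq0. Qed.

End Arith.

(** Placeholders: the first two are redefined once bounded search is available, the other two once
    there is a functional for (∃²). *)
Ltac refl_ball := fail.
Ltac refl_bex := fail.
Ltac refl_all := fail.
Ltac refl_ex := fail.
Ltac refl_hyp := match goal with H : context [_ <-> app _ _ = m_zero _] |- _ => eapply H end.

(* [refl_prop] proves [P <-> ?b = 0] for an open term [?b] of the model. *)
Ltac refl_prop :=
  lazymatch goal with
  | |- (True <-> _) => exact (refl_True _)
  | |- (False <-> _) => exact (refl_False _)
  | |- ((_ /\ _) <-> _) => eapply refl_and; [refl_prop | refl_prop]
  | |- ((_ \/ _) <-> _) => eapply refl_or; [refl_prop | refl_prop]
  | |- ((_ <-> _) <-> _) => eapply refl_iff; [refl_prop | refl_prop]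
  | |- ((~ _) <-> _) => eapply refl_not; refl_prop
  | |- (@eq (dom _ N) _ _ <-> _) => eapply refl_eq
  | |- (m_lt _ _ <-> _) => eapply refl_lt
  | |- ((forall i, m_lt i _ -> _) <-> _) => refl_ball
  | |- ((exists i, m_lt i _ /\ _) <-> _) => refl_bex
  | |- ((forall i : dom _ N, _) <-> _) => refl_all
  | |- ((exists i : dom _ N, _) <-> _) => refl_ex
  | |- ((_ -> _) <-> _) => eapply refl_imp; [refl_prop | refl_prop]
  | |- _ => refl_hyp
  end.

Ltac refl := eexists; intros; eapply iff_sub; [refl_prop | lam_core].

(** * The ordered field of fractions *)

Ltac mring := rewrite ?maddE ?mmulE; ring.

Definition asb (P : Prop) : bool := if excluded_middle_informative P then true else false.

Lemma asbP (P : Prop) : reflect P (asb P).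
Proof. by rewrite /asb; case: excluded_middle_informative => p; constructor. Qed.

(* The triple [(a, b, c)] stands for the fraction [(a - b) / (c + 1)]. *)
Record ratio (M : rca_model) := Ratio { rpos : M N; rneg : M N; rden : M N }.

Section Ratio.
Variable M : rca_model.
Add Ring M_ring : (semiring M).
Implicit Types p q r : ratio M.

Definition ratio_eq p q : Prop :=
  rpos p * (rden q + 1) + rneg q * (rden p + 1) = rpos q * (rden p + 1) + rneg p * (rden q + 1).

Lemma mulI (x y z : M N) : x * (z + 1) = y * (z + 1) -> x = y.
Proof.
by case: (mlt_total x y) => [/(lt_mul2r (lt0S z)) + e|[//|/(lt_mul2r (lt0S z)) + e]];
  rewrite e => /mlt_irr.
Qed.

Lemma ratio_eq_sym p q : ratio_eq p q -> ratio_eq q p.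
Proof. by rewrite /ratio_eq. Qed.

Lemma ratio_eq_trans p q r : ratio_eq p q -> ratio_eq q r -> ratio_eq p r.
Proof.
rewrite /ratio_eq; case: p q r => [a b c] [a' b' c'] [a'' b'' c''] /= e1 e2.
(* The semiring has no subtraction: after multiplying by the middle denominator, the terms in [a']
   and [b'] are added to both sides and cancelled. *)
apply: (@mulI _ _ c').
apply: (@addI _ _ _ (a' * (c + 1) * (c'' + 1) + b' * (c + 1) * (c'' + 1))).
transitivity ((a * (c' + 1) + b' * (c + 1)) * (c'' + 1) +
  (a' * (c'' + 1) + b'' * (c' + 1)) * (c + 1)); first by mring.
by rewrite e1 e2; mring.
Qed.

(** These are the rationals in the sense of the model. Their structure of an ordered field opens the
    estimates below to [field] and [lra]. *)
Definition frac : Type := quotient ratio_eq.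

Definition fcls p : frac := class ratio_eq p.
Definition frep (x : frac) : ratio M := repr x.

Lemma fcls_eq p q : ratio_eq p q -> fcls p = fcls q.
Proof. exact: class_eq ratio_eq_sym ratio_eq_trans _ _. Qed.

Lemma ratio_eq_cls p q : fcls p = fcls q -> ratio_eq p q.
Proof. exact: class_inj (fun p => erefl) _ _. Qed.

Lemma frep_cls (x : frac) : fcls (frep x) = x.
Proof. exact: class_repr. Qed.

Lemma fclsP (P : frac -> Prop) : (forall p, P (fcls p)) -> forall x, P x.
Proof. by move=> Pp x; rewrite -(frep_cls x). Qed.

Lemma ratio_eq_rep p : ratio_eq (frep (fcls p)) p.
Proof. by apply: ratio_eq_cls; rewrite frep_cls. Qed.

(** Denominators are stored as predecessors, and [(c + 1) * (c' + 1) = (c * c' + c + c') + 1]. *)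
Definition ratio_add p q : ratio M :=
  Ratio (rpos p * (rden q + 1) + rpos q * (rden p + 1))
    (rneg p * (rden q + 1) + rneg q * (rden p + 1)) (rden p * rden q + rden p + rden q).
Definition ratio_mul p q : ratio M :=
  Ratio (rpos p * rpos q + rneg p * rneg q) (rpos p * rneg q + rneg p * rpos q)
    (rden p * rden q + rden p + rden q).
Definition ratio_opp p : ratio M := Ratio (rneg p) (rpos p) (rden p).

Definition fadd (x y : frac) : frac := fcls (ratio_add (frep x) (frep y)).
Definition fmul (x y : frac) : frac := fcls (ratio_mul (frep x) (frep y)).
Definition fopp (x : frac) : frac := fcls (ratio_opp (frep x)).

Lemma fadd_cls p q : fadd (fcls p) (fcls q) = fcls (ratio_add p q).
Proof.
apply: fcls_eq; move: (ratio_eq_rep p) (ratio_eq_rep q); rewrite /ratio_eq /=.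
move: (frep _) (frep _) => [a' b' c'] [a b c]; case: p q => [x y z] [x' y' z'] /= e e'.
transitivity ((a * (z + 1) + y * (c + 1)) * ((c' + 1) * (z' + 1)) +
  (a' * (z' + 1) + y' * (c' + 1)) * ((c + 1) * (z + 1))); first by mring.
by rewrite e e'; mring.
Qed.

Lemma ratio_mul_eq p q r : ratio_eq p q -> ratio_eq (ratio_mul p r) (ratio_mul q r).
Proof.
rewrite /ratio_eq; case: p q r => [a b c] [a' b' c'] [x y z] /= e.
transitivity ((a * (c' + 1) + b' * (c + 1)) * x * (z + 1) +
  (a' * (c + 1) + b * (c' + 1)) * y * (z + 1)); first by mring.
transitivity ((a' * (c + 1) + b * (c' + 1)) * x * (z + 1) +
  (a * (c' + 1) + b' * (c + 1)) * y * (z + 1)); first by rewrite e.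
by mring.
Qed.

Lemma ratio_mulC p q : ratio_eq (ratio_mul p q) (ratio_mul q p).
Proof. by rewrite /ratio_eq /=; mring. Qed.

Lemma fmul_cls p q : fmul (fcls p) (fcls q) = fcls (ratio_mul p q).
Proof.
apply: fcls_eq; apply: ratio_eq_trans (ratio_mul_eq _ (ratio_eq_rep p)) _.
apply: ratio_eq_trans (ratio_mulC _ _) _; apply: ratio_eq_trans (ratio_mulC _ _).
exact: ratio_mul_eq (ratio_eq_rep q).
Qed.

Lemma fopp_cls p : fopp (fcls p) = fcls (ratio_opp p).
Proof.
apply: fcls_eq; move: (ratio_eq_rep p); rewrite /ratio_eq /= => e.
by rewrite addC -e addC.
Qed.

Definition embed (n : M N) : frac := fcls (Ratio n 0 0).

Lemma faddA : associative fadd.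
Proof.
elim/fclsP=> p; elim/fclsP=> q; elim/fclsP=> r; rewrite !fadd_cls; apply: fcls_eq.
by rewrite /ratio_eq /=; mring.
Qed.

Lemma faddC : commutative fadd.
Proof.
elim/fclsP=> p; elim/fclsP=> q; rewrite !fadd_cls; apply: fcls_eq.
by rewrite /ratio_eq /=; mring.
Qed.

Lemma fadd0 : left_id (embed 0) fadd.
Proof. by elim/fclsP=> p; rewrite fadd_cls; apply: fcls_eq; rewrite /ratio_eq /=; mring. Qed.

Lemma faddN : left_inverse (embed 0) fopp fadd.
Proof.
by elim/fclsP=> p; rewrite fopp_cls fadd_cls; apply: fcls_eq; rewrite /ratio_eq /=; mring.
Qed.

Lemma fmulA : associative fmul.
Proof.
elim/fclsP=> p; elim/fclsP=> q; elim/fclsP=> r; rewrite !fmul_cls; apply: fcls_eq.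
by rewrite /ratio_eq /=; mring.
Qed.

Lemma fmulC : commutative fmul.
Proof. by elim/fclsP=> p; elim/fclsP=> q; rewrite !fmul_cls; apply: fcls_eq; apply: ratio_mulC. Qed.

Lemma fmul1 : left_id (embed 1) fmul.
Proof. by elim/fclsP=> p; rewrite fmul_cls; apply: fcls_eq; rewrite /ratio_eq /=; mring. Qed.

Lemma fmulDl : left_distributive fmul fadd.
Proof.
elim/fclsP=> p; elim/fclsP=> q; elim/fclsP=> r; rewrite !(fmul_cls, fadd_cls); apply: fcls_eq.
by rewrite /ratio_eq /=; mring.
Qed.

Lemma embed_inj : injective embed.
Proof.
have e (z : M N) : z * (0 + 1) + 0 * (0 + 1) = z by mring.
by move=> x y /ratio_eq_cls; rewrite /ratio_eq /= !e.
Qed.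

Lemma fone_neq0 : embed 1 <> embed 0.
Proof. by move=> /embed_inj /one_neq0. Qed.

Lemma fmulV_ex x : exists y, x <> embed 0 -> fmul y x = embed 1.
Proof.
elim/fclsP: x => -[a b c].
case: (mlt_total a b) => [/lt_sub [z e]|[->|/lt_sub [z e]]].
- case: (zero_or_succ z) e => [->|[w ->] e].
    by exists (embed 0) => -[]; apply: fcls_eq; rewrite /ratio_eq /= -e; mring.
  exists (fcls (Ratio 0 (c + 1) w)) => _; rewrite fmul_cls; apply: fcls_eq.
  by rewrite /ratio_eq /= -e; mring.
- by exists (embed 0) => -[]; apply: fcls_eq; rewrite /ratio_eq /=; mring.
- case: (zero_or_succ z) e => [->|[w ->] e].
    by exists (embed 0) => -[]; apply: fcls_eq; rewrite /ratio_eq /= -e; mring.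
  exists (fcls (Ratio (c + 1) 0 w)) => _; rewrite fmul_cls; apply: fcls_eq.
  by rewrite /ratio_eq /= -e; mring.
Qed.

Definition finv (x : frac) : frac :=
  if asb (x = embed 0) then embed 0 else proj1_sig (cid (fmulV_ex x)).

Lemma finv0 : finv (embed 0) = embed 0.
Proof. by rewrite /finv; case: asbP. Qed.

Lemma fmulV x : x <> embed 0 -> fmul (finv x) x = embed 1.
Proof. by move=> x0; rewrite /finv; case: asbP => // _; exact: proj2_sig (cid (fmulV_ex x)) x0. Qed.

Definition fnonneg (x : frac) : Prop := exists2 p, x = fcls p & rneg p <= rpos p.

Lemma fnonneg_cls p : fnonneg (fcls p) <-> rneg p <= rpos p.
Proof.
split=> [|?]; last by exists p.
case: p => [a b c] [[a' b' c'] /ratio_eq_cls]; rewrite /ratio_eq /= => e ba'.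
case: (mlt_total a b) => [ab|[->|]]; [exfalso | by right | by left].
have lt := lt_mul2r (lt0S c') ab; apply: (@le_lt_irr _ (b * (c' + 1) + b' * (c + 1))
  (a' * (c + 1) + b * (c' + 1))); last by rewrite -e; apply: lt_add2r.
rewrite addC; case: ba' => [/(lt_mul2r (lt0S c))/(lt_add2r (b * (c' + 1)))|->]; [by left | by right].
Qed.

Definition fle x y := asb (fnonneg (fadd y (fopp x))).
Definition flt x y := (asb (y <> x)) && fle x y.
Definition fnorm x := if asb (fnonneg x) then x else fopp x.

Lemma frac_eqP : eq_axiom (fun x y : frac => asb (x = y)).
Proof. by move=> x y; apply: asbP. Qed.
HB.instance Definition _ := hasDecEq.Build frac frac_eqP.

Definition frac_find (P : pred frac) (n : nat) : option frac :=
  if asb (exists x, P x) then Some (epsilon (inhabits (embed 0)) P) else None.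

Lemma frac_find_correct P n x : frac_find P n = Some x -> P x.
Proof.
rewrite /frac_find; case: asbP => // ex [<-].
exact: (epsilon_spec (inhabits (embed 0)) (fun x => P x) ex).
Qed.
Lemma frac_find_complete (P : pred frac) : (exists x, P x) -> exists n, frac_find P n.
Proof. by move=> ex; exists 0%N; rewrite /frac_find; case: asbP. Qed.
Lemma frac_find_ext P Q : P =1 Q -> frac_find P =1 frac_find Q.
Proof. by move=> /functional_extensionality ->. Qed.
HB.instance Definition _ := hasChoice.Build frac frac_find_correct frac_find_complete frac_find_ext.

HB.instance Definition _ := GRing.isZmodule.Build frac faddA faddC fadd0 faddN.
Lemma fone_neq0b : embed 1 != embed 0.
Proof. by apply/eqP; apply: fone_neq0. Qed.
HB.instance Definition _ :=
  GRing.Zmodule_isComNzRing.Build frac fmulA fmulC fmul1 fmulDl fone_neq0b.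
Lemma fmulVb (x : frac) : x != embed 0 -> fmul (finv x) x = embed 1.
Proof. by move/eqP; apply: fmulV. Qed.
HB.instance Definition _ := GRing.ComNzRing_isField.Build frac fmulVb finv0.

Lemma fnonnegN p : fnonneg (fopp (fcls p)) <-> rpos p <= rneg p.
Proof. by rewrite fopp_cls fnonneg_cls. Qed.

Lemma fsub0 (x : frac) : fadd x (fopp (embed 0)) = x.
Proof. by rewrite -[RHS]fadd0 faddC; congr fadd; rewrite fopp_cls. Qed.

Lemma fle0 x : fle (embed 0) x = asb (fnonneg x).
Proof. by rewrite /fle fsub0. Qed.

Lemma fle_0 x : fle x (embed 0) = asb (fnonneg (fopp x)).
Proof. by rewrite /fle fadd0. Qed.

Lemma le_add2 (a b c d : M N) : a <= b -> c <= d -> a + c <= b + d.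
Proof.
move=> ab cd; case: ab => [ab|->]; case: cd => [cd|->]; try by right.
- left; apply: mlt_trans (lt_add2r c ab) _; rewrite !(addC b); exact: lt_add2r.
- by left; apply: lt_add2r.
- by left; rewrite !(addC b); apply: lt_add2r.
Qed.

Lemma le_mul2r (a b c : M N) : a <= b -> a * c <= b * c.
Proof.
case: (mle0x c) => [c0|<- _]; last by rewrite !mulx0; right.
by case=> [ab|->]; [left; apply: lt_mul2r | right].
Qed.

Lemma fle0_add x y : fle (embed 0) x -> fle (embed 0) y -> fle (embed 0) (fadd x y).
Proof.
rewrite !fle0; elim/fclsP: x => p; elim/fclsP: y => q /asbP + /asbP +.
rewrite fadd_cls => /fnonneg_cls p0 /fnonneg_cls q0; apply/asbP/fnonneg_cls => /=.
by apply: le_add2; apply: le_mul2r.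
Qed.

Lemma fle0_mul x y : fle (embed 0) x -> fle (embed 0) y -> fle (embed 0) (fmul x y).
Proof.
rewrite !fle0; elim/fclsP: x => -[a b c]; elim/fclsP: y => -[a' b' c'] /asbP + /asbP +.
rewrite fmul_cls => /fnonneg_cls /= p0 /fnonneg_cls /= q0; apply/asbP/fnonneg_cls => /=.
have sub (x y : M N) : x <= y -> exists z, y = x + z.
  by case=> [/lt_sub [z <-]|->]; [exists z | exists 0; rewrite addx0].
have [u ->] := sub _ _ p0; have [v ->] := sub _ _ q0.
have -> : (b + u) * (b' + v) + b * b' = ((b + u) * b' + b * (b' + v)) + u * v by mring.
exact: le_addr.
Qed.

Lemma fle0_anti x : fle (embed 0) x -> fle x (embed 0) -> x = embed 0.
Proof.
rewrite fle0 fle_0; elim/fclsP: x => -[a b c] /asbP/fnonneg_cls/= ab /asbP/fnonnegN/= ba.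
by apply: fcls_eq; rewrite /ratio_eq /= (mle_anti ab ba); mring.
Qed.

Lemma fsub_ge0 (x y : frac) : fle (embed 0) (fadd y (fopp x)) = fle x y.
Proof. by rewrite fle0. Qed.

Lemma fle0_total x : fle (embed 0) x || fle x (embed 0).
Proof.
rewrite fle0 fle_0; elim/fclsP: x => -[a b c]; apply/orP.
case: (mlt_total b a) => [ab|[ab|ab]]; [left|left|right]; apply/asbP.
- by apply/fnonneg_cls; left.
- by apply/fnonneg_cls; right.
- by apply/fnonnegN; left.
Qed.

Lemma fnormN (x : frac) : fnorm (fopp x) = fnorm x.
Proof.
have NN : fopp (fopp x) = x by elim/fclsP: x => -[a b c]; rewrite !fopp_cls.
have := fle0_total x; rewrite fle0 fle_0 /fnorm NN.
case: asbP => xp; case: asbP => xn //= _.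
have x0 : x = embed 0 by apply: fle0_anti; rewrite ?fle0 ?fle_0; apply/asbP.
by rewrite x0 fopp_cls.
Qed.

Lemma fge0_norm x : fle (embed 0) x -> fnorm x = x.
Proof. by rewrite fle0 /fnorm => ->. Qed.

Lemma flt_def (x y : frac) : flt x y = (y != x) && fle x y.
Proof. by rewrite /flt; congr andb; apply/asbP/idP => /eqP. Qed.

HB.instance Definition _ := Num.IntegralDomain_isLeReal.Build frac
  fle0_add fle0_mul fle0_anti fsub_ge0 fle0_total fnormN fge0_norm flt_def.

End Ratio.

(** * Numbers of the model as fractions *)

Section Embed.
Variable M : rca_model.
Add Ring M_ring' : (semiring M).
Implicit Types x y : M N.
Local Open Scope ring_scope.

Notation e := (@embed M).
Notation F := (frac M).

Lemma embed0 : e 0%M = 0. Proof. by []. Qed.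
Lemma embed1 : e 1%M = 1. Proof. by []. Qed.
Lemma embedD x y : e (x + y)%M = e x + e y.
Proof. by rewrite /GRing.add /= fadd_cls; apply: fcls_eq; rewrite /ratio_eq /=; mring. Qed.
Lemma embedM x y : e (x * y)%M = e x * e y.
Proof. by rewrite /GRing.mul /= fmul_cls; apply: fcls_eq; rewrite /ratio_eq /=; mring. Qed.

Lemma embed_le x y : e x <= e y <-> (x <= y)%M.
Proof.
have -> : (e x <= e y) = asb (fnonneg (e y - e x)) by [].
have -> : e y - e x = fcls (Ratio y x 0%M).
  rewrite /GRing.add /GRing.opp /= fopp_cls fadd_cls; apply: fcls_eq.
  by rewrite /ratio_eq /=; mring.
by split=> [/asbP/fnonneg_cls|?]; last apply/asbP/fnonneg_cls.
Qed.

Lemma embed_eq x y : e x = e y <-> x = y.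
Proof. by split=> [/embed_inj|->]. Qed.

Lemma embed_lt x y : e x < e y <-> (x < y)%M.
Proof.
rewrite Order.POrderTheory.lt_neqAle; split.
  by move=> /andP[/eqP n /embed_le [//|xy]]; case: n; rewrite xy.
move=> xy; apply/andP; split; last by apply/embed_le; left.
by apply/eqP => /embed_eq xy'; move: xy; rewrite xy' => /mlt_irr.
Qed.

Lemma embed_ge0 x : 0 <= e x.
Proof. by apply/(embed_le 0%M x); apply: mle0x. Qed.

Lemma embed_lt_succ x y : (x < y)%M <-> e x + 1 <= e y.
Proof. by rewrite lt_succ_le -embed_le embedD embed1. Qed.

Lemma embed_le_succ x y : (x <= y)%M <-> e x < e y + 1.
Proof. by rewrite -embed1 -embedD embed_lt; split; [apply: le_ltS | apply: ltS_le]. Qed.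
End Embed.

Definition embedE := (embedD, embedM, embed0, embed1).

(* As the model is discretely ordered, [a < b] is passed to [lra] as [a + 1 <= b]. *)
Ltac embed_hyps :=
  repeat match goal with
  | H : m_lt _ _ \/ _ = _ |- _ => apply embed_le in H; rewrite ?embedE in H
  | H : m_lt _ _ |- _ => apply embed_lt_succ in H; rewrite ?embedE in H
  | H : @eq (dom _ N) _ _ |- _ => apply embed_eq in H; rewrite ?embedE in H
  end.
Ltac embed_goal :=
  lazymatch goal with
  | |- m_lt _ _ \/ _ = _ => apply embed_le_succ; rewrite ?embedE
  | |- m_lt _ _ => apply embed_lt; rewrite ?embedE
  | |- @eq (dom _ N) _ _ => apply embed_eq; rewrite ?embedE
  | |- False => idtac
  end.
Ltac embed_atom x :=
  let y := fresh "y" in let H := fresh "H" in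
  pose proof (embed_ge0 x) as H; set (y := embed x) in *; clearbody y.
Ltac embed_atoms :=
  repeat match goal with
  | |- context [embed ?x] => embed_atom x
  | H : context [embed ?x] |- _ => embed_atom x
  end.
Ltac mlra := embed_hyps; embed_goal; embed_atoms; lra.
Ltac mnra := embed_hyps; embed_goal; embed_atoms; nra.

(** * Primitive recursion and finite sequences *)

Section Recursion.
Variable M : rca_model.
Implicit Types a b c n m i : M N.

Lemma ind (P : M N -> Prop) : (exists f : M ty1, forall n, P n <-> f • n = 0) ->
  P 0 -> (forall n, P n -> P (n + 1)) -> forall n, P n.
Proof.
move=> [f Pf] P0 PS n; apply/Pf; apply: ind_app; first exact/Pf.
by move=> k /Pf Pk; apply/Pf; apply: PS.
Qed.

Lemma ac10 (P : M ty1 -> M N -> Prop) :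
  (exists f : M (ty1 ⇒ N ⇒ N), forall h y, P h y <-> f • h • y = 0) ->
  (forall h, exists y, P h y) -> exists Y : M ty2, forall h, P h (Y • h).
Proof.
move=> [f Pf] ex; pose A : form [N; ty1; ty1 ⇒ N ⇒ N] :=
  (Var (vs (vs vz)) · Var (vs vz) · Var vz ≐ 0)%L.
have [||Y HY] := @qf_ac10 M _ A (scons (P := M) f (@nil_env M)).
- by [].
- by move=> h; have [y /Pf e] := ex h; exists y.
- by exists Y => h; apply/Pf; apply: HY.
Qed.

Lemma ac00 (P : M N -> M N -> Prop) :
  (exists f : M (N ⇒ N ⇒ N), forall n y, P n y <-> f • n • y = 0) ->
  (forall n, exists y, P n y) -> exists Y : M ty1, forall n, P n (Y • n).
Proof.
move=> [f Pf] ex.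
have [||Y HY] := @ac10 (fun h y => P (h • 0) y).
- have [g Hg] : exists g : M (ty1 ⇒ N ⇒ N), forall h y, g • h • y = f • (h • 0) • y by lam.
  by exists g => h y; rewrite Hg.
- by move=> h; apply: ex.
have [g Hg] : exists g : M ty1, forall n, g • n = Y • (m_K M N N • n) by lam.
by exists g => n; have := HY (m_K M N N • n); rewrite Hg KE.
Qed.

Lemma selectP (P : Prop) a b c : (P <-> c = 0) ->
  P /\ select M • a • b • c = a \/ ~ P /\ select M • a • b • c = b.
Proof.
move=> e; case: (zero_or_succ c) => [c0|[w cw]].
  by left; rewrite c0 select0; split=> //; apply/e.
by right; rewrite cw selectS; split=> // /e; rewrite cw => /succ_neq0.
Qed.

(** The integer square root, needed to invert the pairing [(i + j)^2 + i]. From 0 on, [s] is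
    increased as long as [(s + 1)^2 <= c], and [c] rounds are enough. *)
Lemma sqrt_ex : exists f : M ty1, forall c,
  f • c * (f • c) <= c /\ c < (f • c + 1) * (f • c + 1).
Proof.
have [t Ht] : exists t : M (N ⇒ N ⇒ N), forall c s, (s + 1) * (s + 1) <= c <-> t • c • s = 0.
  by refl.
have [g Hg] : exists g : M (N ⇒ ty1), forall c s,
  g • c • s = select M • (s + 1) • s • (t • c • s) by lam.
have [f Hf] : exists f : M ty1, forall c, f • c = m_rec M • (g • c) • 0 • c by lam.
exists f => c; rewrite Hf.
have H n : m_rec M • (g • c) • 0 • n * (m_rec M • (g • c) • 0 • n) <= c /\
    (m_rec M • (g • c) • 0 • n = n \/
     c < (m_rec M • (g • c) • 0 • n + 1) * (m_rec M • (g • c) • 0 • n + 1)).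
  move: n; apply: ind; first by refl.
    by rewrite rec0 mulx0; split; [apply: mle0x | left].
  move=> n; rewrite recS; move: (m_rec _ • _ • _ • _) => s [sc sn]; rewrite Hg.
  case: (selectP (s + 1) s (Ht c s)) => -[p ->]; split=> //.
    by case: sn => [->|q]; [left | case: (le_lt_irr p q)].
  by right; case: (mlt_total c ((s + 1) * (s + 1))) => [//|[e|e]]; case: p; [right | left].
have [sc [e|//]] := H c; split=> //; move: (m_rec _ • _ • _ • _) e sc => s -> _.
mnra.
Qed.

Definition msqrt := proj1_sig (cid sqrt_ex).

Lemma msqrtE s i : i <= s -> msqrt • (s * s + i) = s.
Proof.
move=> le_is; have [] := proj2_sig (cid sqrt_ex) (s * s + i); rewrite -/msqrt.
move: (msqrt • _) => t p q.
case: (mlt_total s t) => [st|[//|ts]]; exfalso.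
- by move/lt_succ_le: st => st; mnra.
- by move/lt_succ_le: ts => ts; mnra.
Qed.

Lemma unpair_ex : exists f g : M ty1, forall i j, f • ⟨i, j⟩ = i /\ g • ⟨i, j⟩ = j.
Proof.
have [f Hf] : exists f : M ty1, forall c,
  f • c = monus M • c • (msqrt • c * (msqrt • c)) by lam.
have [g Hg] : exists g : M ty1, forall c, g • c = monus M • (msqrt • c) • (f • c) by lam.
have monusD a b : monus M • (a + b) • a = b.
  by case: (monusP (a + b) a) => [[/le_lt_irr[]]|e]; [exact: le_addr | mlra].
exists f, g => i j; rewrite Hg Hf msqrtE; last exact: le_addr.
by rewrite !monusD.
Qed.

Definition mfst := proj1_sig (cid unpair_ex).
Definition msnd := proj1_sig (cid (proj2_sig (cid unpair_ex))).
Lemma mfstE i j : mfst • ⟨i, j⟩ = i.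
Proof. by case: (proj2_sig (cid (proj2_sig (cid unpair_ex))) i j). Qed.
Lemma msndE i j : msnd • ⟨i, j⟩ = j.
Proof. by case: (proj2_sig (cid (proj2_sig (cid unpair_ex))) i j). Qed.

Lemma pair_inj i j i' j' : ⟨i, j⟩ = ⟨i', j'⟩ -> i = i' /\ j = j'.
Proof.
by move=> e; split; [rewrite -(mfstE i j) e mfstE | rewrite -(msndE i j) e msndE].
Qed.

(** Recursion with access to the counter, by iterating on pairs of counter and value. *)
Lemma primrec_ex : exists R : M ((N ⇒ N ⇒ N) ⇒ N ⇒ N ⇒ N), forall h a,
  R • h • a • 0 = a /\ forall n, R • h • a • (n + 1) = h • n • (R • h • a • n).
Proof.
have [st Hst] : exists st : M ((N ⇒ N ⇒ N) ⇒ ty1), forall h c,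
  st • h • c = ⟨mfst • c + 1, h • (mfst • c) • (msnd • c)⟩ by lam.
have [R HR] : exists R : M ((N ⇒ N ⇒ N) ⇒ N ⇒ N ⇒ N), forall h a n,
  R • h • a • n = msnd • (m_rec M • (st • h) • ⟨0, a⟩ • n) by lam.
exists R => h a; rewrite !HR rec0 msndE; split=> // n.
have fstE : forall n, mfst • (m_rec M • (st • h) • ⟨0, a⟩ • n) = n.
  apply: ind; [by refl | by rewrite rec0 mfstE |].
  by move=> k IH; rewrite recS Hst mfstE IH.
by rewrite !HR recS Hst msndE fstE.
Qed.

Definition primrec := proj1_sig (cid primrec_ex).
Lemma primrec0 h a : primrec • h • a • 0 = a.
Proof. by case: (proj2_sig (cid primrec_ex) h a). Qed.
Lemma primrecS h a n : primrec • h • a • (n + 1) = h • n • (primrec • h • a • n).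
Proof. by case: (proj2_sig (cid primrec_ex) h a). Qed.

(** The product of the values below [n] vanishes when a factor does. For the converse a second
    recursion [w] records the last zero, since induction on a bounded existential statement only
    becomes available through this lemma. *)
Lemma bex_ex : exists b : M (ty1 ⇒ N ⇒ N), forall f n,
  (exists i, i < n /\ f • i = 0) <-> b • f • n = 0.
Proof.
have [p Hp] : exists p : M (ty1 ⇒ N ⇒ N ⇒ N), forall f i v, p • f • i • v = v * (f • i) by lam.
have [w Hw] : exists w : M (ty1 ⇒ N ⇒ N ⇒ N), forall f i v,
  w • f • i • v = select M • i • v • (f • i) by lam.
have [b Hb] : exists b : M (ty1 ⇒ N ⇒ N), forall f n,
  b • f • n = primrec • (p • f) • 1 • n by lam.
exists b => f n; rewrite Hb; split=> [[i [+ fi]]|].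
  move: n; apply: ind; first by refl.
    by move/mltx0.
  move=> n IH /ltS_le; rewrite primrecS Hp => -[/IH ->|<-].
    by rewrite mulC mulx0.
  by rewrite fi mulx0.
suff H : primrec • (p • f) • 1 • n = 0 -> primrec • (w • f) • 0 • n < n /\
    f • (primrec • (w • f) • 0 • n) = 0 by move/H => ?; eexists; eauto.
move: n; apply: ind; first by refl.
  by rewrite primrec0 => /one_neq0.
move=> n IH; rewrite !primrecS Hp Hw => /mul_eq0 pf.
case: (@selectP (f • n = 0) n (primrec • (w • f) • 0 • n) (f • n)) => [//|[fn ->]|[fn ->]].
  by split=> //; apply: lt_succ.
case: pf => [/IH [lt e]|//]; split=> //; exact: mlt_trans lt (lt_succ n).
Qed.

Definition bex := proj1_sig (cid bex_ex).

Lemma refl_bex_lemma (Q : M N -> Prop) (h : M ty1) n : (forall i, Q i <-> h • i = 0) ->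
  ((exists i, i < n /\ Q i) <-> bex • h • n = 0).
Proof.
move=> Qh; rewrite -(proj2_sig (cid bex_ex) h n).
by split=> -[i [lt q]]; exists i; split=> //; apply/Qh.
Qed.

Lemma ball_ex : exists b : M (ty1 ⇒ N ⇒ N), forall f n,
  (forall i, i < n -> f • i = 0) <-> b • f • n = 0.
Proof.
have [g Hg] : exists g : M (ty1 ⇒ ty1), forall f i, g • f • i = monus M • 1 • (f • i) by lam.
have [b Hb] : exists b : M (ty1 ⇒ N ⇒ N), forall f n,
  b • f • n = monus M • 1 • (bex • (g • f) • n) by lam.
have gE f i : ~ f • i = 0 <-> g • f • i = 0 by rewrite Hg; apply: refl_not.
exists b => f n; rewrite Hb -(refl_not (refl_bex_lemma n (gE f))).
split=> [al [i [lt ne]]|nex i lt]; first exact: ne (al i lt).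
by apply: NNPP => ne; apply: nex; exists i.
Qed.

Definition ball := proj1_sig (cid ball_ex).

Lemma refl_ball_lemma (Q : M N -> Prop) (h : M ty1) n : (forall i, Q i <-> h • i = 0) ->
  ((forall i, i < n -> Q i) <-> ball • h • n = 0).
Proof.
move=> Qh; rewrite -(proj2_sig (cid ball_ex) h n).
by split=> al i lt; apply/Qh; apply: al.
Qed.

End Recursion.

Ltac refl_ball ::=
  eapply refl_ball_lemma; let i := fresh "i" in intro i; eapply iff_sub; [refl_prop | lam_core].
Ltac refl_bex ::=
  eapply refl_bex_lemma; let i := fresh "i" in intro i; eapply iff_sub; [refl_prop | lam_core].

(** * Least elements, choice with a number parameter, and codes of initial segments *)

Section Sequences.
Variable M : rca_model.
Implicit Types a b c n m i : M N.

Lemma le_sum m n : m <= n -> exists i, n = m + i.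
Proof. by case=> [/lt_sub [i <-]|->]; [exists i | exists 0; rewrite addx0]. Qed.

Lemma le_or m n : m <= n \/ n <= m.
Proof. by case: (mlt_total m n) => [lt|[->|lt]]; [left; left | left; right | right; left]. Qed.

Lemma least (P : M N -> Prop) n : (exists f : M ty1, forall n, P n <-> f • n = 0) ->
  P n -> exists m, P m /\ forall k, k < m -> ~ P k.
Proof.
move=> [f Pf] Pn; apply: NNPP => nex.
have H : forall m k, k < m -> ~ P k.
  apply: ind; first by refl.
    by move=> k /mltx0.
  move=> m IH k /ltS_le [|->]; first exact: IH.
  by move=> Pm; apply: nex; exists m.
exact: (H _ _ (lt_succ n) Pn).
Qed.

(** The number [n] is put in front of [h], so that a single function carries both arguments. *)
Lemma ac100 (P : M ty1 -> M N -> M N -> Prop) :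
  (exists f : M (ty1 ⇒ N ⇒ N ⇒ N), forall h n y, P h n y <-> f • h • n • y = 0) ->
  (forall h n, exists y, P h n y) -> exists Y : M (ty1 ⇒ N ⇒ N), forall h n, P h n (Y • h • n).
Proof.
move=> [f Pf] ex.
have [tl Htl] : exists tl : M (ty1 ⇒ ty1), forall h i, tl • h • i = h • (i + 1) by lam.
have [||Y HY] := @ac10 M (fun h y => P (tl • h) (h • 0) y).
- have [g Hg] : exists g : M (ty1 ⇒ N ⇒ N), forall h y,
    g • h • y = f • (tl • h) • (h • 0) • y by lam.
  by exists g => h y; rewrite Hg.
- by move=> h; apply: ex.
have [k Hk] : exists k : M (ty1 ⇒ N ⇒ ty1), forall h n i,
  k • h • n • i = select M • n • (h • (mpred M • i)) • i by lam.
have [g Hg] : exists g : M (ty1 ⇒ N ⇒ N), forall h n, g • h • n = Y • (k • h • n) by lam.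
exists g => h n; rewrite Hg; have := HY (k • h • n).
have -> : tl • (k • h • n) = h by apply: app_ext => i; rewrite Htl Hk selectS mpredS.
by rewrite Hk select0.
Qed.

Definition initseg (f : M ty1) n s : Prop := exists c : M ty1,
  c • 0 = 0 /\ (forall i, i < n -> c • (i + 1) = ⟨c • i, f • i⟩ + 1) /\ c • n = s.

Lemma seg_ex : exists g : M (ty1 ⇒ N ⇒ N), forall f,
  g • f • 0 = 0 /\ forall i, g • f • (i + 1) = ⟨g • f • i, f • i⟩ + 1.
Proof.
have [h Hh] : exists h : M (ty1 ⇒ N ⇒ N ⇒ N), forall f i v, h • f • i • v = ⟨v, f • i⟩ + 1 by lam.
have [g Hg] : exists g : M (ty1 ⇒ N ⇒ N), forall f i, g • f • i = primrec M • (h • f) • 0 • i by lam.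
by exists g => f; rewrite Hg primrec0; split=> // i; rewrite !Hg primrecS Hh.
Qed.

Definition seg := proj1_sig (cid seg_ex).
Lemma seg0 f : seg • f • 0 = 0. Proof. by case: (proj2_sig (cid seg_ex) f). Qed.
Lemma segS f i : seg • f • (i + 1) = ⟨seg • f • i, f • i⟩ + 1.
Proof. by case: (proj2_sig (cid seg_ex) f). Qed.

Lemma initsegE f n s : initseg f n s <-> s = seg • f • n.
Proof.
split=> [[c [c0 [cS <-]]]|->]; last first.
  by exists (seg • f); rewrite seg0; split=> //; split=> // i _; rewrite segS.
suff H : forall m, m <= n -> c • m = seg • f • m by apply: H; right.
apply: ind; [by refl | by rewrite c0 seg0 |].
move=> m IH mn; rewrite segS cS; last exact/lt_succ_le.
by rewrite IH //; mlra.
Qed.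

Lemma seg_eq f g n : seg • f • n = seg • g • n <-> forall i, i < n -> f • i = g • i.
Proof.
move: n; apply: ind; first by refl.
  by split=> [_ i /mltx0|_]; rewrite ?seg0.
move=> n IH; rewrite !segS; split=> [/addI/pair_inj [/IH e en] i /ltS_le [/e|->]//|e].
have -> : seg • f • n = seg • g • n; last by rewrite (e n (lt_succ n)).
by apply/IH => i lt; apply: e; apply: mlt_trans lt (lt_succ n).
Qed.

Lemma same_initsegE f g n :
  (exists s, initseg f n s /\ initseg g n s) <-> forall i, i < n -> f • i = g • i.
Proof.
rewrite -seg_eq; split=> [[s [/initsegE -> /initsegE ->]]//|e].
by exists (seg • f • n); split; apply/initsegE.
Qed.

End Sequences.

(** * Principles with quantifiers over functions *)

Definition is_E2 (M : rca_model) (E : M ty2) : Prop :=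
  forall h : M ty1, (exists n, h • n = 0) <-> E • h = 0.

Section Quantifiers.
Variable M : rca_model.
Variable E : M ty2.
Hypothesis E_E2 : is_E2 E.

Lemma refl_ex_lemma (Q : M N -> Prop) (h : M ty1) :
  (forall i, Q i <-> h • i = 0) -> ((exists i, Q i) <-> E • h = 0).
Proof. by move=> Qh; rewrite -E_E2; split=> -[i q]; exists i; apply/Qh. Qed.

Lemma all_ex : exists A : M ty2, forall h : M ty1, (forall n, h • n = 0) <-> A • h = 0.
Proof.
have [g Hg] : exists g : M (ty1 ⇒ ty1), forall f i, g • f • i = monus M • 1 • (f • i) by lam.
have [A HA] : exists A : M ty2, forall f, A • f = monus M • 1 • (E • (g • f)) by lam.
exists A => h; rewrite HA.
have gE i : ~ h • i = 0 <-> g • h • i = 0 by rewrite Hg; apply: refl_not.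
rewrite -(refl_not (refl_ex_lemma gE)); split=> [al [i]|nex i]; first exact.
by apply: NNPP => ne; apply: nex; exists i.
Qed.

Definition mall := proj1_sig (cid all_ex).

Lemma refl_all_lemma (Q : M N -> Prop) (h : M ty1) :
  (forall i, Q i <-> h • i = 0) -> ((forall i, Q i) <-> mall • h = 0).
Proof. by move=> Qh; rewrite -(proj2_sig (cid all_ex)); split=> q i; apply/Qh. Qed.
End Quantifiers.

Ltac refl_all ::=
  match goal with hE : is_E2 _ |- _ =>
    eapply (refl_all_lemma hE); let i := fresh "i" in intro i; eapply iff_sub; [refl_prop | lam_core]
  end.
Ltac refl_ex ::=
  match goal with hE : is_E2 _ |- _ =>
    eapply (refl_ex_lemma hE); let i := fresh "i" in intro i; eapply iff_sub; [refl_prop | lam_core]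
  end.

(** * The principles as statements about a model, and (∃²) from UATR or from a discontinuity *)

Section Semantics.
Variable M : rca_model.
Implicit Types (i j k m n : M N) (f g h X Y Z : M ty1).

Definition inC f : Prop := forall n, f • n <= m_K M N N • 1 • n.

Lemma inCE f : inC f <-> forall n, f • n = 0 \/ f • n = 1.
Proof.
split=> c n; have := c n; rewrite KE.
  move=> le; case: (zero_or_succ (f • n)) le => [|[w ->]]; first by left.
  case: (zero_or_succ w) => [->|[v ->]] le; right; first by rewrite add0x.
  by exfalso; mlra.
by case=> ->; [apply: mle0x | right].
Qed.

Definition E2_prop : Prop := exists E : M ty2,
  (forall f, E • f <= m_K M N ty1 • 1 • f) /\ is_E2 E.

Definition cont_prop (Y : M ty2) : Prop := forall f, exists n, forall g,
  (exists s, initseg f n s /\ initseg g n s) -> Y • f = Y • g.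

Definition FF_prop : Prop := exists Φ : M ty3, forall Y : M ty2, cont_prop Y ->
  forall f g, inC f /\ inC g ->
    (exists s, initseg f (Φ • Y) s /\ initseg g (Φ • Y) s) -> Y • f = Y • g.

Definition olt X i j : Prop := X • ⟨i, j⟩ = 1 /\ ~ X • ⟨j, i⟩ = 1.

Definition LO_prop X : Prop :=
  (forall i j, X • ⟨i, j⟩ = 1 -> X • ⟨i, i⟩ = 1 /\ X • ⟨j, j⟩ = 1) /\
  (forall i j k, X • ⟨i, j⟩ = 1 /\ X • ⟨j, k⟩ = 1 -> X • ⟨i, k⟩ = 1) /\
  (forall i j, X • ⟨i, j⟩ = 1 /\ X • ⟨j, i⟩ = 1 -> i = j) /\
  (forall i j, X • ⟨i, i⟩ = 1 /\ X • ⟨j, j⟩ = 1 -> X • ⟨i, j⟩ = 1 \/ X • ⟨j, i⟩ = 1).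

Definition WF_prop X : Prop := ~ exists h, forall n, olt X (h • (n + 1)) (h • n).

Definition below_prop X Y j Z : Prop :=
  inC Z /\ forall k, Z • k = 1 <->
    exists m i, k = ⟨m, i⟩ /\ olt X i j /\ Y • ⟨m, i⟩ = 1.

Definition Hf_prop f X Y : Prop := forall j, X • ⟨j, j⟩ = 1 -> forall n,
  Y • ⟨n, j⟩ = 1 <-> exists Z, below_prop X Y j Z /\
    exists m s, initseg Z m s /\ f • ⟨⟨n, m⟩, s⟩ = 0.

Definition UATR_prop : Prop := exists Φ : M (ty1 ⇒ ty1 ⇒ ty1), forall X f,
  LO_prop X /\ WF_prop X -> Hf_prop f X (Φ • X • f).

(* The hierarchy along the one-point order with field [{0}] decides [(∃m) g(m) = 0]. *)
Lemma UATR_E2 : UATR_prop -> E2_prop.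
Proof.
move=> [Φ HΦ].
(* As [⟨0, 0⟩ = 0], the characteristic function of the set whose only member is 0 codes the order
   with field consisting of 0. *)
have [X HX] : exists X, forall k, X • k = select M • 1 • 0 • k by lam.
have X1 i j : X • ⟨i, j⟩ = 1 <-> i = 0 /\ j = 0.
  rewrite HX; split=> [|[-> ->]]; last by rewrite !addx0 mulx0 select0.
  case: (@selectP M (⟨i, j⟩ = 0) 1 0 ⟨i, j⟩) => // -[]; last by move=> _ -> /esym /one_neq0.
  by move=> /add_eq0 [/mul_eq0 e ->] _ _; split=> //; case: e => /add_eq0 [].
(* At [⟨⟨n, m⟩, s⟩] this returns [g • m], so membership at level 0 says that [g] has a zero,
   whatever the set below. *)
have [F HF] : exists F : M (ty1 ⇒ ty1), forall g t, F • g • t = g • (msnd M • (mfst M • t)) by lam.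
have WO : LO_prop X /\ WF_prop X.
  split; last by case=> h /(_ 0) [/X1 [e e']] []; apply/X1.
  split=> [i j /X1 [-> ->]|]; first by split; apply/X1.
  split=> [i j k [/X1 [-> _] /X1 [_ ->]]|]; first by apply/X1.
  split=> [i j [/X1 [-> ->]]//|i j [/X1 [-> _] /X1 [-> _]]].
  by left; apply/X1.
have key g : (Φ • X • (F • g)) • ⟨0, 0⟩ = 1 <-> exists n, g • n = 0.
  have X00 : X • ⟨0, 0⟩ = 1 by apply/X1.
  rewrite (HΦ X (F • g) WO 0 X00); split=> [[Z [_ [m [s [_]]]]]|[m gm]].
    by rewrite HF mfstE msndE; exists m.
  (* Nothing precedes level 0, so the part of the hierarchy below it is empty. *)
  exists (m_K M N N • 0); split; last first.
    exists m, (seg M • (m_K M N N • 0) • m); split; first exact/initsegE.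
    by rewrite HF mfstE msndE.
  split=> [|k]; first by apply/inCE => k; rewrite KE; left.
  rewrite KE; split=> [/esym/one_neq0//|[m' [i [_ [[/X1 [-> _]]]]]]].
  by move=> []; apply/X1.
have [t Ht] : exists t : M ty2, forall g, (Φ • X • (F • g)) • ⟨0, 0⟩ = 1 <-> t • g = 0 by refl.
have [e He] : exists e : M ty2, forall g, e • g = select M • 0 • 1 • (t • g) by lam.
exists e; split=> g; rewrite He ?KE;
  case: (selectP 0 1 (Ht g)) => -[p ->]; [exact: mle0x | by right | by rewrite -key |].
by rewrite -key; split=> // /one_neq0.
Qed.

Lemma ac21 : models M (QF_AC ty2 ty1) -> forall P : M ty2 -> M ty1 -> Prop,
  (exists f : M (ty2 ⇒ ty1 ⇒ N), forall F h, P F h <-> f • F • h = 0) ->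
  (forall F, exists h, P F h) -> exists Y : M (ty2 ⇒ ty1), forall F, P F (Y • F).
Proof.
move=> mAC P [f Pf] ex; pose A : form [ty1; ty2; ty2 ⇒ ty1 ⇒ N] :=
  (Var (vs (vs vz)) · Var (vs vz) · Var vz ≐ 0)%L.
have qA : quantifier_free A by [].
have [|Y HY] := sat_choice (mAC _ _ (scons (P := M) f (@nil_env M)) (qf_ac (σ := ty2) (τ := ty1) qA)).
  by move=> F; have [h /Pf e] := ex F; exists h.
by exists Y => F; apply/Pf; apply: HY.
Qed.

(* Grilliot's trick: a sequence [G] converging to a discontinuity [f] of [Y] yields, for
   each [h], a function that is [f] if [h] has no zero and [G i] if [i] is the least one. *)
Lemma grilliot : models M (QF_AC ty2 ty1) -> ~ E2_prop -> forall Y : M ty2, cont_prop Y.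
Proof.
move=> mAC nE Y f; apply: NNPP => ncont; apply: nE.
have disc n : exists g, (forall i, i < n -> f • i = g • i) /\ ~ Y • f = Y • g.
  apply: NNPP => nex; apply: ncont; exists n => g /same_initsegE e.
  by apply: NNPP => ne; apply: nex; exists g.
(* Choice of functions for numbers, from choice at type 2: a number is passed as a constant
   functional and recovered as its value at the zero function. *)
have [||Z HZ] := ac21 mAC (P := fun F g =>
    (forall i, i < F • (m_K M N N • 0) -> f • i = g • i) /\ ~ Y • f = Y • g).
- by refl.
- by move=> F; apply: disc.
have [G HG] : exists G : M (N ⇒ ty1), forall n, G • n = Z • (m_K M N ty1 • n) by lam.
have {HZ} {}HG n : (forall i, i < n -> f • i = G • n • i) /\ ~ Y • f = Y • (G • n).
  by have := HZ (m_K M N ty1 • n); rewrite HG KE.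
(* [K • h • n] searches for a zero of [h] only up to [n], which is a bounded condition. A least zero
   [i] beyond [n] changes nothing, because [G • i] agrees with [f] below [i]. *)
have [||K HK] := @ac100 M (fun h n v =>
  (exists i, i < n + 1 /\ h • i = 0 /\ (forall j, j < i -> ~ h • j = 0) /\ v = G • i • n) \/
  (forall i, i < n + 1 -> ~ h • i = 0) /\ v = f • n).
- by refl.
- move=> h n; case: (classic (exists i, i < n + 1 /\ h • i = 0)) => [[i [lt hi]]|nex]; last first.
    by exists (f • n); right; split=> // i lt hi; apply: nex; exists i.
  have [|i0 [h0 mini]] := @least M (fun i => h • i = 0) i _ hi; first by refl.
  exists (G • i0 • n); left; exists i0; split=> //.
  case: (mlt_total i0 (n + 1)) => [//|lt']; exfalso; apply: (mini i) => //.
  by case: lt' => [->//|]; apply: mlt_trans.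
have K0 h : (forall i, ~ h • i = 0) -> K • h = f.
  by move=> nz; apply: app_ext => n; case: (HK h n) => [[i [_ [/nz]]]|[]].
have K1 h i : h • i = 0 -> (forall j, j < i -> ~ h • j = 0) -> K • h = G • i.
  move=> hi mini; apply: app_ext => n; case: (HK h n) => [[j [_ [hj [minj ->]]]]|[nz ->]].
    by case: (mlt_total i j) => [/minj|[->|/mini]].
  case: (mlt_total i (n + 1)) => [/nz//|ni]; apply: (proj1 (HG i)); case: ni => ni; mlra.
have [t Ht] : exists t : M ty2, forall h, ~ Y • f = Y • (K • h) <-> t • h = 0 by refl.
have [e He] : exists e : M ty2, forall h, e • h = select M • 0 • 1 • (t • h) by lam.
have key h : (exists n, h • n = 0) <-> ~ Y • f = Y • (K • h).
  split=> [[n hn]|ne]; last by apply: NNPP => nz; apply: ne; rewrite K0 // => i hi; apply: nz; exists i.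
  have [|i [hi mini]] := @least M (fun i => h • i = 0) n _ hn; first by refl.
  by rewrite (K1 h i hi mini); case: (HG i).
exists e; split=> g; rewrite He ?KE;
  case: (selectP 0 1 (Ht g)) => -[p ->]; [exact: mle0x | by right | by rewrite key |].
by rewrite key; split=> // /one_neq0.
Qed.

End Semantics.

(** * Real numbers *)

Import Order.TTheory GRing.Theory Num.Theory.

(** The semantic counterpart of [qexp], with the denominator itself and not its predecessor. The
    predicates below are phrased with it so that they unfold to satisfaction of the corresponding
    formulas. *)
Record sq (M : model) := Sq { sp : M N; sn : M N; sd : M N }.

Section Reals.
Variable M : rca_model.
Implicit Types (i j k m n : M N) (x y z : M ty1) (p q r : sq M).
Notation F := (frac M).
Notation e := (@embed M).

Definition sq_add p q : sq M :=
  Sq (sp p * sd q + sp q * sd p) (sn p * sd q + sn q * sd p) (sd p * sd q).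
Definition sq_opp p : sq M := Sq (sn p) (sp p) (sd p).
Definition sq_sub p q : sq M := sq_add p (sq_opp q).
Definition sq_lt p q : Prop := sp p * sd q + sn q * sd p < sp q * sd p + sn p * sd q.
Definition sq_eq p q : Prop := sp p * sd q + sn q * sd p = sp q * sd p + sn p * sd q.

Definition mdouble : M ty1 := eval (@nil_env M) double.
Definition mpow2 n : M N := m_rec M • mdouble • 1 • n.

Lemma mpow2_0 : mpow2 0 = 1.
Proof. exact: rec0. Qed.

Lemma mpow2S n : mpow2 (n + 1) = mpow2 n + mpow2 n.
Proof. by rewrite /mpow2 recS /mdouble /= !SE !KE. Qed.

Definition codes_prop (t : M N) (P : sq M -> Prop) : Prop :=
  exists a b c, t = ⟨⟨a, b⟩, c⟩ /\ P (Sq a b (c + 1)).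

Definition is_real_prop x : Prop := forall n i,
  codes_prop (x • n) (fun p => codes_prop (x • (n + i)) (fun q =>
    sq_lt (sq_sub p q) (Sq 1 0 (mpow2 n)) /\ sq_lt (sq_opp (sq_sub p q)) (Sq 1 0 (mpow2 n)))).

Definition real_eq_prop x y : Prop := forall n,
  codes_prop (x • n) (fun p => codes_prop (y • n) (fun q =>
    ~ sq_lt (Sq (1 + 1) 0 (mpow2 n)) (sq_sub p q) /\
    ~ sq_lt (Sq (1 + 1) 0 (mpow2 n)) (sq_opp (sq_sub p q)))).

Definition real_lt_prop x y : Prop := exists n,
  codes_prop (x • n) (fun p => codes_prop (y • n) (fun q =>
    sq_lt (sq_add p (Sq (1 + 1) 0 (mpow2 n))) q)).

Definition real_op_prop (op : sq M -> sq M -> sq M) x y z : Prop := forall n,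
  codes_prop (x • (n + 1)) (fun p => codes_prop (y • (n + 1)) (fun q =>
    codes_prop (z • n) (fun r => sq_eq r (op p q)))).

Definition rzero : M ty1 := m_K M N N • ⟨⟨0, 0⟩, 0⟩.
Definition rone : M ty1 := m_K M N N • ⟨⟨1, 0⟩, 0⟩.

Definition in_unit_interval_prop x : Prop :=
  is_real_prop x /\ ~ real_lt_prop x rzero /\ ~ real_lt_prop rone x.

Definition in_interval_prop (Ψ : M (ty1 ⇒ ty1)) y x : Prop := exists u v,
  real_op_prop sq_sub y (Ψ • y) u /\ real_op_prop sq_add y (Ψ • y) v /\
  real_lt_prop u x /\ real_lt_prop x v.

Definition pos_real_function_prop (Ψ : M (ty1 ⇒ ty1)) : Prop :=
  (forall x, is_real_prop x -> is_real_prop (Ψ • x) /\ real_lt_prop rzero (Ψ • x)) /\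
  (forall x y, is_real_prop x /\ is_real_prop y -> real_eq_prop x y ->
    real_eq_prop (Ψ • x) (Ψ • y)).

Definition HBU_prop : Prop := forall Ψ, pos_real_function_prop Ψ ->
  exists k, exists y : M (N ⇒ ty1), (forall i, i < k -> is_real_prop (y • i)) /\
    forall x, in_unit_interval_prop x -> exists i, i < k /\ in_interval_prop Ψ (y • i) x.

Definition pw n : F := e (mpow2 n).

Lemma pwS n : pw (n + 1) = (2 * pw n)%R.
Proof. by rewrite /pw mpow2S embedD mulr_natl. Qed.

Lemma embed_gt0 n : 0 < n -> (0 < e n)%R.
Proof. by move/embed_lt. Qed.

Lemma mpow2_gt n : n < mpow2 n.
Proof.
move: n; apply: ind; first by rewrite /mpow2; refl.
  by rewrite mpow2_0; apply: lt01.
by move=> n IH; rewrite mpow2S; mlra.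
Qed.

Lemma pw_gt0 n : (0 < pw n)%R.
Proof. apply: embed_gt0; have := mpow2_gt n; have := mle0x n; move=> *; mlra. Qed.

Lemma pw_gt n : (e n < pw n)%R.
Proof. exact/embed_lt/mpow2_gt. Qed.

Lemma pwD n i : pw (n + i) = (pw n * pw i)%R.
Proof.
rewrite /pw -embedM; congr embed; move: i; apply: ind; first by rewrite /mpow2; refl.
  by rewrite addx0 mpow2_0 mulx1.
by move=> i IH; rewrite -addA !mpow2S IH mulDr.
Qed.

Lemma pw_ge1 n : (1 <= pw n)%R.
Proof.
move: n; rewrite /pw => n; apply/(embed_le 1); move: n; apply: ind.
- by rewrite /mpow2; refl.
- by rewrite mpow2_0; right.
- by move=> n IH; rewrite mpow2S; mlra.
Qed.

Lemma pwV_le n m : n <= m -> ((pw m)^-1 <= (pw n)^-1)%R.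
Proof.
move=> nm; have [i <-] : exists i, n + i = m.
  by case: nm => [/lt_sub//|<-]; exists 0; rewrite addx0.
rewrite lef_pV2 ?posrE ?pw_gt0 // pwD.
by rewrite ler_peMr ?pw_ge1 // ltW ?pw_gt0.
Qed.

Lemma pwV_gt0 n : (0 < (pw n)^-1)%R.
Proof. by rewrite invr_gt0 pw_gt0. Qed.

Lemma pwVS n : ((pw n)^-1 = 2 * (pw (n + 1)%M)^-1)%R.
Proof. by rewrite pwS invfM mulrA mulfV ?mul1r // pnatr_eq0. Qed.

Definition sval p : F := ((e (sp p) - e (sn p)) / e (sd p))%R.

Lemma mulfBl (u v w : F) : ((u - v) * w = u * w - v * w)%R.
Proof. exact: mulrBl. Qed.

Lemma sq_ltE p q : 0 < sd p -> 0 < sd q -> sq_lt p q <-> (sval p < sval q)%R.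
Proof.
case: p q => [a b c] [a' b' c'] /= /embed_gt0 c0 /embed_gt0 c0'.
rewrite /sq_lt /sval /= -embed_lt !embedE ltr_pdivrMr // mulrAC ltr_pdivlMr //.
by rewrite !mulfBl; split=> h; lra.
Qed.

Lemma sq_eqE p q : 0 < sd p -> 0 < sd q -> sq_eq p q <-> sval p = sval q.
Proof.
case: p q => [a b c] [a' b' c'] /= /embed_gt0 c0 /embed_gt0 c0'.
have cn : e c != 0%R by rewrite gt_eqF.
have cn' : e c' != 0%R by rewrite gt_eqF.
rewrite /sq_eq /sval /= -embed_eq !embedE; split=> h.
  by apply/eqP; rewrite eqr_div //; apply/eqP; rewrite !mulfBl; lra.
by move/eqP: h; rewrite eqr_div // => /eqP; rewrite !mulfBl => h; lra.
Qed.

Lemma sval_add p q : 0 < sd p -> 0 < sd q -> sval (sq_add p q) = (sval p + sval q)%R.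
Proof.
case: p q => [a b c] [a' b' c'] /= /embed_gt0 c0 /embed_gt0 c0'.
rewrite /sval /= !embedE; field.
by rewrite !gt_eqF.
Qed.

Lemma sval_opp p : sval (sq_opp p) = (- sval p)%R.
Proof. by rewrite /sval /= -mulNr opprB. Qed.

Lemma mulx_gt0 m n : 0 < m -> 0 < n -> 0 < m * n.
Proof. by move=> m0 n0; have := lt_mul2r n0 m0; rewrite (mulC 0) mulx0. Qed.

Definition rat (t : M N) (v : F) : Prop :=
  exists a b c, t = ⟨⟨a, b⟩, c⟩ /\ v = ((e a - e b) / (e c + 1))%R.

Lemma rat_inj t v w : rat t v -> rat t w -> v = w.
Proof.
move=> [a [b [c [-> ->]]]] [a' [b' [c' [/pair_inj [/pair_inj [<- <-] <-] ->]]]].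
by [].
Qed.

Lemma codes_rat t P : codes_prop t P -> exists2 p, rat t (sval p) & P p /\ 0 < sd p.
Proof.
move=> [a [b [c [-> Pp]]]]; exists (Sq a b (c + 1)); last by split=> //; apply: lt0S.
by exists a, b, c; rewrite /sval /= !embedE.
Qed.

Lemma rat_codes t v (P : sq M -> Prop) : rat t v ->
  (forall p, 0 < sd p -> sval p = v -> P p) -> codes_prop t P.
Proof.
move=> [a [b [c [-> ->]]]] H; exists a, b, c; split=> //; apply: H; first exact: lt0S.
by rewrite /sval /= !embedE.
Qed.

(** Injectivity of the pairing makes the coded rational unique, so the quantifiers in [codes_prop]
    can be traded for its value [v]. *)
Lemma codes_ratE t v (P : sq M -> Prop) (Q : Prop) : rat t v ->
  (forall p, 0 < sd p -> sval p = v -> (P p <-> Q)) -> codes_prop t P <-> Q.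
Proof.
move=> tv H; split=> [/codes_rat [p tp [Pp p0]]|q].
  by apply/(H p p0 (rat_inj tp tv)).
by apply: (rat_codes tv) => p p0 pv; apply/(H p p0 pv).
Qed.

Lemma mpow2_gt0 n : 0 < mpow2 n.
Proof. by have := mpow2_gt n; have := mle0x n => *; mlra. Qed.

(** [v] is a function of the metatheory; through it statements about a coded real become estimates
    in the field [F]. *)
Definition valuation x (v : M N -> F) : Prop := forall n, rat (x • n) (v n).

Lemma sval_pow2 a n : sval (Sq a 0 (mpow2 n)) = (e a / pw n)%R.
Proof. by rewrite /sval /= embed0 subr0. Qed.

Lemma is_realE x v : valuation x v ->
  is_real_prop x <-> forall n i, (`|v n - v (n + i)%M| < (pw n)^-1)%R.
Proof.
move=> xv; suff H n i : codes_prop (x • n) (fun p => codes_prop (x • (n + i)) (fun q =>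
    sq_lt (sq_sub p q) (Sq 1 0 (mpow2 n)) /\
    sq_lt (sq_opp (sq_sub p q)) (Sq 1 0 (mpow2 n)))) <-> (`|v n - v (n + i)%M| < (pw n)^-1)%R.
  by split=> r n i; apply/H.
apply: (codes_ratE (xv n)) => p p0 pv; apply: (codes_ratE (xv (n + i))) => q q0 qv.
rewrite !sq_ltE //=; try exact: mpow2_gt0; try exact: mulx_gt0.
rewrite sval_opp sval_add // sval_opp sval_pow2 pv qv embed1 mul1r ltr_norml.
by split=> [[h1 h2]|/andP[h1 h2]]; [apply/andP; split; lra | split; lra].
Qed.

Lemma real_valuation x : is_real_prop x -> exists v, valuation x v.
Proof.
move=> xr; have ex n : exists v, rat (x • n) v.
  by have /codes_rat [p xp _] := xr n 0; exists (sval p).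
by exists (fun n => proj1_sig (cid (ex n))) => n; apply: (proj2_sig (cid (ex n))).
Qed.

Lemma real_eqE x y v w : valuation x v -> valuation y w ->
  real_eq_prop x y <-> forall n, (`|v n - w n| <= 2 / pw n)%R.
Proof.
move=> xv yw; suff H n : codes_prop (x • n) (fun p => codes_prop (y • n) (fun q =>
    ~ sq_lt (Sq (1 + 1) 0 (mpow2 n)) (sq_sub p q) /\
    ~ sq_lt (Sq (1 + 1) 0 (mpow2 n)) (sq_opp (sq_sub p q)))) <-> (`|v n - w n| <= 2 / pw n)%R.
  by split=> r n; apply/H.
apply: (codes_ratE (xv n)) => p p0 pv; apply: (codes_ratE (yw n)) => q q0 qv.
rewrite !sq_ltE //=; try exact: mpow2_gt0; try exact: mulx_gt0.
rewrite sval_opp sval_add // sval_opp sval_pow2 pv qv !embedE ler_norml.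
split=> [[/negP h1 /negP h2]|/andP[h1 h2]]; first by apply/andP; split; lra.
by split; apply/negP; lra.
Qed.

Lemma real_ltE x y v w : valuation x v -> valuation y w ->
  real_lt_prop x y <-> exists n, (v n + 2 / pw n < w n)%R.
Proof.
move=> xv yw; suff H n : codes_prop (x • n) (fun p => codes_prop (y • n) (fun q =>
    sq_lt (sq_add p (Sq (1 + 1) 0 (mpow2 n))) q)) <-> (v n + 2 / pw n < w n)%R.
  by split=> -[n r]; exists n; apply/H.
apply: (codes_ratE (xv n)) => p p0 pv; apply: (codes_ratE (yw n)) => q q0 qv.
rewrite !sq_ltE //=; last by apply: mulx_gt0 => //; apply: mpow2_gt0.
by rewrite sval_add // ?sval_pow2 ?pv ?qv ?embedE //; apply: mpow2_gt0.
Qed.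

Lemma real_subE x y z u v w : valuation x u -> valuation y v -> valuation z w ->
  real_op_prop sq_sub x y z <-> forall n, w n = (u (n + 1)%M - v (n + 1)%M)%R.
Proof.
move=> xu yv zw; suff H n : codes_prop (x • (n + 1)) (fun p => codes_prop (y • (n + 1))
    (fun q => codes_prop (z • n) (fun r => sq_eq r (sq_sub p q)))) <->
    w n = (u (n + 1)%M - v (n + 1)%M)%R.
  by split=> h n; apply/H.
apply: (codes_ratE (xu _)) => p p0 pv; apply: (codes_ratE (yv _)) => q q0 qv.
apply: (codes_ratE (zw _)) => r r0 rv; rewrite sq_eqE //; last exact: mulx_gt0.
by rewrite sval_add // sval_opp pv qv rv.
Qed.

Lemma real_addE x y z u v w : valuation x u -> valuation y v -> valuation z w ->
  real_op_prop sq_add x y z <-> forall n, w n = (u (n + 1)%M + v (n + 1)%M)%R.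
Proof.
move=> xu yv zw; suff H n : codes_prop (x • (n + 1)) (fun p => codes_prop (y • (n + 1))
    (fun q => codes_prop (z • n) (fun r => sq_eq r (sq_add p q)))) <->
    w n = (u (n + 1)%M + v (n + 1)%M)%R.
  by split=> h n; apply/H.
apply: (codes_ratE (xu _)) => p p0 pv; apply: (codes_ratE (yv _)) => q q0 qv.
apply: (codes_ratE (zw _)) => r r0 rv; rewrite sq_eqE //; last exact: mulx_gt0.
by rewrite sval_add // pv qv rv.
Qed.

Lemma rat_code a b d : 0 < d -> rat ⟨⟨a, b⟩, mpred M • d⟩ ((e a - e b) / e d)%R.
Proof.
case: (zero_or_succ d) => [->/mlt_irr//|[c ->] _]; exists a, b, c; rewrite mpredS.
by rewrite !embedE.
Qed.

Definition num (t : M N) := mfst M • (mfst M • t).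
Definition neg (t : M N) := msnd M • (mfst M • t).
Definition den (t : M N) := msnd M • t + 1.

Lemma rat_decode t v : rat t v -> v = ((e (num t) - e (neg t)) / e (den t))%R.
Proof.
by move=> [a [b [c [-> ->]]]]; rewrite /num /neg /den !(mfstE, msndE) !embedE.
Qed.

Lemma rat_sub a b c a' b' c' : 0 < c -> 0 < c' ->
  rat ⟨⟨a * c' + b' * c, b * c' + a' * c⟩, mpred M • (c * c')⟩
    ((e a - e b) / e c - (e a' - e b') / e c')%R.
Proof.
move=> c0 c0'; have := rat_code (a * c' + b' * c) (b * c' + a' * c) (mulx_gt0 c0 c0').
congr rat; rewrite !embedE; field.
by rewrite !gt_eqF // embed_gt0.
Qed.

Lemma sub_valuation x y u v : valuation x u -> valuation y v ->
  exists z, valuation z (fun n => u (n + 1)%M - v (n + 1)%M)%R.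
Proof.
move=> xu yv.
have [z Hz] : exists z, forall n, z • n =
    ⟨⟨num (x • (n + 1)) * den (y • (n + 1)) + neg (y • (n + 1)) * den (x • (n + 1)),
      neg (x • (n + 1)) * den (y • (n + 1)) + num (y • (n + 1)) * den (x • (n + 1))⟩,
      mpred M • (den (x • (n + 1)) * den (y • (n + 1)))⟩ by rewrite /num /neg /den; lam.
exists z => n; rewrite Hz (rat_decode (xu _)) (rat_decode (yv _)).
exact: rat_sub (lt0S _) (lt0S _).
Qed.

Lemma opp_valuation x u : valuation x u -> exists z, valuation z (fun n => - u n)%R.
Proof.
move=> xu.
have [z Hz] : exists z, forall n, z • n =
    ⟨⟨neg (x • n), num (x • n)⟩, mpred M • (den (x • n))⟩ by rewrite /num /neg /den; lam.
exists z => n; rewrite Hz (rat_decode (xu _)) -mulNr opprB; apply: rat_code; exact: lt0S.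
Qed.

(** The values of the two endpoints are determined termwise and the endpoints exist in the model,
    which removes the quantifiers over them. The index [n + 1] is the shift built into [real_op]. *)
Lemma in_intervalE (Ψ : M (ty1 ⇒ ty1)) x y u v w :
  valuation y v -> valuation (Ψ • y) w -> valuation x u ->
  in_interval_prop Ψ y x <->
  (exists n, v (n + 1)%M - w (n + 1)%M + 2 / pw n < u n)%R /\
  (exists n, u n + 2 / pw n < v (n + 1)%M + w (n + 1)%M)%R.
Proof.
move=> yv yw xu; have [a av] := sub_valuation yv yw.
have [w' yw'] := opp_valuation yw; have [b bv'] := sub_valuation yv yw'.
have bv : valuation b (fun n => v (n + 1)%M + w (n + 1)%M)%R.
  by move=> n; have := bv' n; rewrite opprK.
split=> [[a' [b' [ra [rb [l1 l2]]]]]|[l1 l2]]; last first.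
  exists a, b; rewrite (real_subE yv yw av) (real_addE yv yw bv).
  by rewrite (real_ltE av xu) (real_ltE xu bv).
have ex z op : real_op_prop op y (Ψ • y) z -> exists t, valuation z t.
  move=> h; have ex n : exists t, rat (z • n) t.
    have /codes_rat [p _ [/codes_rat [q _ [/codes_rat [r zr _] _]] _]] := h n.
    by exists (sval r).
  by exists (fun n => proj1_sig (cid (ex n))) => n; apply: (proj2_sig (cid (ex n))).
have [s as'] := ex _ _ ra; have [t bt] := ex _ _ rb.
move: ra rb; rewrite (real_subE yv yw as') (real_addE yv yw bt) => ra rb.
move: l1 l2; rewrite (real_ltE as' xu) (real_ltE xu bt) => -[m l1] [n l2].
by split; [exists m; rewrite -ra | exists n; rewrite -rb].
Qed.

Lemma rzero_valuation : valuation rzero (fun _ => 0%R).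
Proof. by move=> n; rewrite /rzero KE; exists 0, 0, 0; rewrite !embedE subrr mul0r. Qed.

Lemma rone_valuation : valuation rone (fun _ => 1%R).
Proof. by move=> n; rewrite /rone KE; exists 1, 0, 0; rewrite !embedE subr0 add0r divr1. Qed.

Lemma real_dist x v m n : is_real_prop x -> valuation x v ->
  (`|v m - v n| < (pw m)^-1 + (pw n)^-1)%R.
Proof.
move=> xr xv; have xc := proj1 (is_realE xv) xr.
have main a b : a <= b -> (`|v a - v b| < (pw a)^-1 + (pw b)^-1)%R.
  move=> ab; have [i <-] : exists i, a + i = b.
    by case: ab => [/lt_sub//|<-]; exists 0; rewrite addx0.
  by have := xc a i; have := pwV_gt0 (a + i); lra.
case: (mlt_total m n) => [mn|mn]; first by apply: main; left.
rewrite distrC [X in (_ < X)%R]addrC; apply: main.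
by case: mn => [->|]; [right | left].
Qed.

End Reals.

(** * Expansions of reals in a base *)

Section Expansions.
Variable M : rca_model.
Implicit Types (i j k m n : M N) (x y z : M ty1).
Notation F := (frac M).
Notation e := (@embed M).

(** The integer whose base-[β] digits are the first [n] values of [δ], that is, the numerator over
    [β ^ n] of the truncated expansion. It is used with base 2 for the fan and with base 4 for the
    Cantor set. *)
Lemma xnum_ex : exists f : M (N ⇒ ty1 ⇒ ty1), forall β δ,
  f • β • δ • 0 = 0 /\ forall n, f • β • δ • (n + 1) = β * (f • β • δ • n) + δ • n.
Proof.
have [h Hh] : exists h : M (N ⇒ ty1 ⇒ N ⇒ N ⇒ N), forall β δ n v,
  h • β • δ • n • v = β * v + δ • n by lam.
have [f Hf] : exists f : M (N ⇒ ty1 ⇒ ty1), forall β δ n,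
  f • β • δ • n = primrec M • (h • β • δ) • 0 • n by lam.
by exists f => β δ; rewrite Hf primrec0; split=> // n; rewrite !Hf primrecS Hh.
Qed.

Definition xnum := proj1_sig (cid xnum_ex).
Lemma xnum0 β δ : xnum • β • δ • 0 = 0.
Proof. by case: (proj2_sig (cid xnum_ex) β δ). Qed.
Lemma xnumS β δ n : xnum • β • δ • (n + 1) = β * (xnum • β • δ • n) + δ • n.
Proof. by case: (proj2_sig (cid xnum_ex) β δ). Qed.

Definition xpow β n : M N := m_rec M • (m_times M • β) • 1 • n.
Lemma xpow0 β : xpow β 0 = 1. Proof. exact: rec0. Qed.
Lemma xpowS β n : xpow β (n + 1) = β * xpow β n. Proof. exact: recS. Qed.

Lemma xreal_ex : exists f : M (N ⇒ ty1 ⇒ ty1), forall β δ n,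
  f • β • δ • n = ⟨⟨xnum • β • δ • n, 0⟩, mpred M • xpow β n⟩.
Proof. by rewrite /xpow; lam. Qed.

Definition xreal := proj1_sig (cid xreal_ex).
Lemma xrealE β δ n : xreal • β • δ • n = ⟨⟨xnum • β • δ • n, 0⟩, mpred M • xpow β n⟩.
Proof. exact: (proj2_sig (cid xreal_ex)). Qed.

Variables (β : M N) (δ : M ty1).
Hypothesis β_ge2 : 1 + 1 <= β.
Hypothesis δ_lt : forall n, δ • n + 1 <= β.

Notation q := (xnum • β • δ).
Notation p := (xpow β).

Definition xval n : F := (e (q • n) / e (p n))%R.

Lemma mpow2_le_xpow n : mpow2 n <= p n.
Proof.
move: n; apply: ind; first by rewrite /mpow2 /xpow; refl.
  by rewrite mpow2_0 xpow0; right.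
move=> n IH; rewrite mpow2S xpowS.
have : (1 + 1) * p n <= β * p n by apply: le_mul2r.
by move=> h; mlra.
Qed.

Lemma xpow_gt0 n : 0 < p n.
Proof. have := mpow2_le_xpow n; have := mpow2_gt0 n => *; mlra. Qed.

Lemma expow_gt0 n : (0 < e (p n))%R.
Proof. exact/embed_gt0/xpow_gt0. Qed.

Lemma xval_valuation : valuation (xreal • β • δ) xval.
Proof.
move=> n; rewrite xrealE /xval -[e (q • n)]subr0 -(embed0 M).
exact: rat_code (xpow_gt0 n).
Qed.

Lemma xpowD n i : p (n + i) = p n * p i.
Proof.
move: i; apply: ind; first by rewrite /xpow; refl.
  by rewrite addx0 xpow0 mulx1.
by move=> i IH; rewrite -addA !xpowS IH -!mulA (mulC β).
Qed.

(** Each digit is at most [β - 1], so [i] further digits contribute less than one unit of place [n];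
    the form with [+ 1] is the one that passes through the induction. *)
Lemma xnum_bounds n i :
  q • n * p i <= q • (n + i) /\ q • (n + i) + 1 <= (q • n + 1) * p i.
Proof.
move: i; apply: ind; first by rewrite /xpow; refl.
  by rewrite addx0 xpow0 !mulx1; split; right.
move=> i [lo hi]; rewrite -addA xnumS xpowS.
have lo' := le_mul2r β lo; have hi' := le_mul2r β hi; have d := δ_lt (n + i).
by split; mlra.
Qed.

Lemma xpow_cancel (u : F) n i : (u / e (p n) * e (p (n + i)%M) = u * e (p i))%R.
Proof.
rewrite xpowD embedM mulrA mulfVK //.
by rewrite gt_eqF // expow_gt0.
Qed.

Lemma xval_incr n i : (xval n <= xval (n + i)%M)%R.
Proof.
rewrite /xval ler_pdivlMr ?expow_gt0 // xpow_cancel -embedM.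
by apply/embed_le; case: (xnum_bounds n i).
Qed.

Lemma xval_upper n i : (xval (n + i)%M < (e (q • n) + 1) / e (p n))%R.
Proof.
rewrite /xval ltr_pdivrMr ?expow_gt0 // xpow_cancel -embed1 -embedD -embedM.
by apply/embed_lt/lt_succ_le; case: (xnum_bounds n i).
Qed.

Lemma xval_lt n m : (xval m < (e (q • n) + 1) / e (p n))%R.
Proof.
case: (le_or n m) => /le_sum [i ->]; first exact: xval_upper.
apply: le_lt_trans (xval_incr m i) _.
by have := xval_upper (m + i) 0; rewrite addx0.
Qed.

Lemma expowV_le n : ((e (p n))^-1 <= (pw n)^-1)%R.
Proof.
rewrite lef_pV2 ?posrE ?pw_gt0 ?expow_gt0 //.
exact/embed_le/mpow2_le_xpow.
Qed.

Lemma xreal_real : is_real_prop (xreal • β • δ).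
Proof.
apply/(is_realE xval_valuation) => n i; rewrite distrC ger0_norm ?subr_ge0 ?xval_incr //.
have := xval_upper n i; rewrite mulrDl mul1r => h.
by have := expowV_le n; rewrite {2}/xval; lra.
Qed.

Lemma xval_ge0 n : (0 <= xval n)%R.
Proof. by rewrite /xval divr_ge0 ?embed_ge0. Qed.

Lemma xval_lt1 n : (xval n < 1)%R.
Proof. by have := xval_lt 0 n; rewrite xnum0 xpow0 !embedE add0r divr1. Qed.

Lemma xreal_unit : in_unit_interval_prop (xreal • β • δ).
Proof.
split; first exact: xreal_real.
split; rewrite ?(real_ltE xval_valuation (@rzero_valuation M))
  ?(real_ltE (@rone_valuation M) xval_valuation) => -[n].
  by have := xval_ge0 n; have := pwV_gt0 n; lra.
by have := xval_lt1 n; have := pwV_gt0 n; lra.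
Qed.

End Expansions.

(** * Heine-Borel from the fan functional *)

Section Fan.
Variable M : rca_model.
Implicit Types (i j k l m n c d : M N) (x y z f g : M ty1).
Notation F := (frac M).
Notation e := (@embed M).
Local Notation two := (1 + 1).

Lemma half_ex : exists h : M ty1, forall n, n = two * (h • n) \/ n = two * (h • n) + 1.
Proof.
have [||h Hh] := @ac00 M (fun n c => n = two * c \/ n = two * c + 1); last by exists h.
  by refl.
suff H n : exists c, c < n + 1 /\ (n = two * c \/ n = two * c + 1).
  by move=> n; have [y [_ ?]] := H n; exists y.
move: n; apply: ind; first by refl.
  by exists 0; split; [apply: lt0S | left; rewrite mulx0].
move=> n [y [lt [->|->]]].
  by exists y; split; [have := mle0x y => ?; mlra | right].
by exists (y + 1); split; [have := mle0x y => ?; mlra | left; mlra].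
Qed.

Definition half := proj1_sig (cid half_ex).
Lemma halfP n : n = two * (half • n) \/ n = two * (half • n) + 1.
Proof. exact: (proj2_sig (cid half_ex)). Qed.

Lemma halfE n c : c <= 1 -> half • (two * n + c) = n.
Proof.
move=> c1; have c0 := mle0x c; move: (halfP (two * n + c)); move: (half • _) => y.
by case: (mlt_total y n) => [lt|[->//|lt]]; case=> h; exfalso; mlra.
Qed.

Lemma monusK m n : m <= n -> m + monus M • n • m = n.
Proof. by case: (monusP n m) => [[lt _] /le_lt_irr[]//|<-]. Qed.

(** Bit [j] of the [l]-digit binary expansion of [d], most significant first: [d] halved
    [l - (j + 1)] times, minus twice [d] halved [l - j] times. Positions from [l] on are filled with
    0. *)
Lemma bits_ex : exists b : M (N ⇒ N ⇒ ty1), forall l d j,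
  b • l • d • j = select M • (monus M • (m_rec M • half • d • (monus M • l • (j + 1)))
     • (two * (m_rec M • half • d • (monus M • l • j)))) • 0 • (monus M • (j + 1) • l).
Proof. by lam. Qed.

Definition bits := proj1_sig (cid bits_ex).

Lemma bits_ge l d j : l <= j -> bits • l • d • j = 0.
Proof.
move=> lj; rewrite (proj2_sig (cid bits_ex)).
case: (@selectP M (j + 1 <= l) (monus M • (m_rec M • half • d • (monus M • l • (j + 1)))
     • (two * (m_rec M • half • d • (monus M • l • j)))) 0 (monus M • (j + 1) • l)) => [|[]|[]//].
  by rewrite monus_eq0.
by move=> jl _; exfalso; mlra.
Qed.

Lemma bits_lt l d j : j < l -> bits • l • d • j <= 1 /\
  m_rec M • half • d • (monus M • l • (j + 1)) =
  two * (m_rec M • half • d • (monus M • l • j)) + bits • l • d • j.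
Proof.
move=> /lt_succ_le jl; rewrite (proj2_sig (cid bits_ex)).
have -> : monus M • (j + 1) • l = 0 by apply/monus_eq0.
rewrite select0; have k1 := monusK jl.
have -> : monus M • l • j = monus M • l • (j + 1) + 1.
  have k2 : j + monus M • l • j = l by apply: monusK; mlra.
  by mlra.
rewrite recS; move: (m_rec _ • _ • _ • _) => u.
set v := half • u.
have le : two * v <= u by case: (halfP u); rewrite -/v => h; have := mle0x v => ?; mlra.
have h2 := monusK le; split=> //; case: (halfP u); rewrite -/v => h; mlra.
Qed.

Lemma bits_le1 l d j : bits • l • d • j <= 1.
Proof.
case: (le_or l j) => [/bits_ge ->|]; first exact: mle0x.
case=> [jl|->]; first by case: (bits_lt d jl).
by rewrite bits_ge; [apply: mle0x | right].
Qed.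

Lemma bits_C l d : inC (bits • l • d).
Proof. by move=> n; rewrite KE; apply: bits_le1. Qed.

Lemma two_digits f : inC f -> forall n, f • n + 1 <= two.
Proof. by move=> fC n; have := fC n; rewrite KE => ?; mlra. Qed.

Lemma xpow_two n : xpow two n = mpow2 n.
Proof.
move: n; apply: ind; first by rewrite /xpow /mpow2; refl.
  by rewrite xpow0 mpow2_0.
by move=> n IH; rewrite xpowS mpow2S IH; mlra.
Qed.

(** The recursion of [xnum] undoes the halvings; it starts correctly because a number below [2 ^ l]
    is reduced to 0 by [l] of them. *)
Lemma xnum_bits l d j : d < mpow2 l -> j <= l ->
  xnum M • two • (bits • l • d) • j = m_rec M • half • d • (monus M • l • j).
Proof.
move=> dl; move: j; apply: ind; first by refl.
  move=> _; rewrite xnum0.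
  have -> : monus M • l • 0 = l by have := monusK (mle0x l); rewrite add0x.
  have H i : m_rec M • half • d • i * mpow2 i <= d.
    rewrite /mpow2; move: i; apply: ind; first by refl.
      by rewrite !rec0 mulx1; right.
    move=> i; rewrite -/(mpow2 i) -/(mpow2 (i + 1)) mpow2S recS.
    move: (m_rec _ • half • _ • _) => u IH; have := mle0x (half • u) => v0.
    have h : two * (half • u) <= u by case: (halfP u) => h; mlra.
    by have := le_mul2r (mpow2 i) h => ?; mlra.
  have := H l; case: (zero_or_succ (m_rec M • half • d • l)) => [->//|[w ->]] h; exfalso.
  have := le_addr (mpow2 l) (w * mpow2 l) => ?.
  by mlra.
move=> j IH /lt_succ_le jl; have [_ ->] := bits_lt d jl.
by rewrite xnumS IH //; left.
Qed.

Lemma bits_xnum l f j : inC f -> j < l -> bits • l • (xnum M • two • f • l) • j = f • j.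
Proof.
move=> fC; set d := xnum M • two • f • l.
have H i : i <= l -> m_rec M • half • d • i = xnum M • two • f • (monus M • l • i).
  move: i; apply: ind; first by refl.
    by rewrite rec0 => _; congr (_ • _); have := monusK (mle0x l); rewrite add0x.
  move=> i IH il; have k1 := monusK il; rewrite recS IH; last by mlra.
  have -> : monus M • l • i = monus M • l • (i + 1) + 1.
    by have k2 : i + monus M • l • i = l by [apply: monusK; mlra]; mlra.
  by rewrite xnumS halfE //; have := fC (monus M • l • (i + 1)); rewrite KE.
move=> jl; have [b1] := bits_lt d jl; have jl' := proj1 (lt_succ_le j l) jl.
have k1 := monusK jl'; have k2 : j + monus M • l • j = l by apply: monusK; left.
have monus_le a : monus M • l • a <= l.
  by case: (monusP l a) => [[_ ->]|e]; [exact: mle0x | have := mle0x a => ?; mlra].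
rewrite !H //.
have -> : monus M • l • (monus M • l • (j + 1)) = j + 1.
  by have := monusK (monus_le (j + 1)) => ?; mlra.
have -> : monus M • l • (monus M • l • j) = j by have := monusK (monus_le j) => ?; mlra.
by rewrite xnumS => h; mlra.
Qed.

(** Partial sums bound all earlier values, and a bound is all that is asked for, so they stand in
    for maxima. *)
Lemma sum_ex (h : M ty1) : exists s : M ty1, forall n i, i < n -> h • i <= s • n.
Proof.
have [g Hg] : exists g : M (N ⇒ N ⇒ N), forall n v, g • n • v = v + h • n by lam.
have [s Hs] : exists s : M ty1, forall n, s • n = primrec M • g • 0 • n by lam.
exists s => n; rewrite Hs; move: n; apply: ind; first by refl.
  by move=> i /mltx0.
move=> n IH i; rewrite primrecS Hg => /ltS_le [/IH|->].
  by have := mle0x (h • n) => ? ?; mlra.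
by rewrite addC; apply: le_addr.
Qed.

(* By the fan functional, [Y] takes on [C] only the values at finitely many binary strings. *)
Lemma fan_bounded (Y : M ty2) : FF_prop M -> cont_prop Y ->
  exists b, forall f, inC f -> Y • f <= b.
Proof.
move=> [Φ HΦ] /HΦ {}HΦ; set k := Φ • Y in HΦ.
have [h Hh] : exists h : M ty1, forall d, h • d = Y • (bits • k • d) by lam.
have [s Hs] := sum_ex h; exists (s • (mpow2 k)) => f fC.
have -> : Y • f = h • (xnum M • two • f • k).
  rewrite Hh; apply: HΦ; first by split=> //; apply: bits_C.
  by apply/same_initsegE => i lt; rewrite bits_xnum.
apply: Hs; have two_le : two <= two by right.
have [_] := xnum_bounds (two_digits fC) 0 k.
rewrite !add0x xnum0 add0x xpow_two => h'; mlra.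
Qed.

End Fan.

(** * Covering the unit interval by equidistant dyadic points *)

Section FanHBU.
Variable M : rca_model.
Implicit Types (i j k l m n c d : M N) (x y z f g : M ty1).
Notation F := (frac M).
Notation e := (@embed M).
Local Notation two := (1 + 1).

Definition decode (t : M N) : sq M := Sq (num t) (neg t) (den t).

Lemma sval_decode t v : rat t v -> sval (decode t) = v.
Proof. by move/rat_decode ->. Qed.

(** Take the greatest [d] below [2 ^ l] with [d / 2 ^ l <= v l], or 0 if there is none. Of the 3
    units of error, one is the spacing; the other two are the amount by which [v l] may leave
    [0, 1], as [real_lt] asks for a surplus of [2 / 2 ^ l]. *)
Lemma dyadic_approx x v l : in_unit_interval_prop x -> valuation x v ->
  exists2 d, d < mpow2 l & (`|e d / pw l - v l| <= 3 / pw l)%R.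
Proof.
move=> [xr [x0 x1]] xv.
have [t0 pt] : (0 < (pw l)^-1)%R /\ (pw l * (pw l)^-1 = 1)%R.
  by split; [exact: pwV_gt0 | rewrite mulfV // gt_eqF // pw_gt0].
have v0 : (- (2 / pw l) <= v l)%R.
  rewrite leNgt; apply/negP => h; apply: x0; apply/(real_ltE xv (@rzero_valuation M)).
  by exists l; lra.
have v1 : (v l <= 1 + 2 / pw l)%R.
  rewrite leNgt; apply/negP => h; apply: x1; apply/(real_ltE (@rone_valuation M) xv).
  by exists l.
(* The comparison is phrased in the model and not in [F], so that induction on [d] is admissible. *)
pose P d := ~ sq_lt (decode (x • l)) (Sq d 0 (mpow2 l)).
have PE d : P d <-> (e d / pw l <= v l)%R.
  rewrite /P sq_ltE; [|exact: lt0S|exact: mpow2_gt0].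
  rewrite (sval_decode (xv l)) sval_pow2 leNgt.
  by split=> [/negP|/negP].
have [d [dl [lo hi]]] : exists d, d < mpow2 l /\ (d = 0 \/ P d) /\ (d + 1 = mpow2 l \/ ~ P (d + 1)).
  apply: NNPP => nex.
  have H : forall d, d < mpow2 l -> d = 0 \/ P d.
    apply: ind; first by rewrite /P /sq_lt /decode /num /neg /den /mpow2 /=; refl.
      by left.
    move=> d IH lt; right; apply: NNPP => nP; apply: nex; exists d.
    have lt' : d < mpow2 l by apply: mlt_trans (lt_succ d) lt.
    by split=> //; split; [apply: IH | right].
  case: (zero_or_succ (mpow2 l)) => [|[w we]].
    by move=> e0; have := mpow2_gt0 l; rewrite e0 => /mlt_irr.
  have wl : w < mpow2 l by rewrite we; apply: lt_succ.
  by apply: nex; exists w; split=> //; split; [apply: H | left].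
exists d => //.
have {}lo : (e d / pw l - v l <= 2 / pw l)%R.
  by case: lo => [d0|/PE h]; [move: v0; rewrite d0 embed0 mul0r; lra | lra].
have {}hi : (v l <= e d / pw l + 3 / pw l)%R.
  case: hi => [/embed_eq|/PE].
    by rewrite embedD embed1 -/(pw l) => dE; move: pt; rewrite -{1}dE mulrDl => h; lra.
  by rewrite embedD embed1 => /negP; rewrite -ltNge mulrDl => h; lra.
by rewrite ler_norml; apply/andP; split; lra.
Qed.

Lemma fan_HBU : FF_prop M -> (forall Y : M ty2, cont_prop Y) -> HBU_prop M.
Proof.
move=> ff cont Ψ [Ψpos _].
(* Clipping forces every function into Cantor space, so [rf • f] is a real for each [f] and choice
   over all of type 1 applies. *)
have [clip Hclip] : exists c : M (ty1 ⇒ ty1), forall f n,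
  c • f • n = select M • 0 • 1 • (f • n) by lam.
have clipC f : inC (clip • f).
  move=> n; rewrite KE Hclip; case: (zero_or_succ (f • n)) => [->|[w ->]].
    by rewrite select0; apply: mle0x.
  by rewrite selectS; right.
have clipE f : inC f -> clip • f = f.
  move=> /inCE fC; apply: app_ext => n; rewrite Hclip; case: (fC n) => ->.
    by rewrite select0.
  by have := selectS (0 : M N) 1 0; rewrite add0x.
have [rf Hrf] : exists r : M (ty1 ⇒ ty1), forall f, r • f = xreal M • two • (clip • f) by lam.
have two_le : two <= (two : M N) by right.
have digits f := two_digits (clipC f).
have rf_real f : is_real_prop (rf • f) by rewrite Hrf; apply: xreal_real two_le (digits f).
have [||Y HY] := @ac10 M
    (fun f m => sq_lt (Sq two 0 (mpow2 m)) (decode ((Ψ • (rf • f)) • m))).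
- by rewrite /sq_lt /decode /num /neg /den /mpow2 /=; refl.
- move=> f; have [pr pp] := Ψpos _ (rf_real f).
  have [w xw] := real_valuation pr.
  have /(real_ltE (@rzero_valuation M) xw) [n h] := pp; exists n.
  rewrite sq_ltE; [|exact: mpow2_gt0|exact: lt0S].
  by rewrite (sval_decode (xw n)) sval_pow2 !embedE; lra.
have [b Hb] := fan_bounded ff (cont Y).
(* In units of [2^-l], the approximation costs 3, passing to index [l + 1] costs 3/2 for the centre
   and 1/2 for the radius, and the strict inequality costs 2. The total 7 is less than [2^-b], which
   is 8 units. *)
pose l := b + 1 + 1 + 1.
have [y Hy] : exists y : M (N ⇒ ty1), forall d, y • d = rf • (bits M • l • d) by lam.
exists (mpow2 l), y; split=> [i _|x xu]; first by rewrite Hy.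
have [u xv] := real_valuation (proj1 xu).
have [d dl dE] := dyadic_approx l xu xv; exists d; split=> //.
set f := bits M • l • d in Hy.
have fC : inC f by apply: bits_C.
have yE : y • d = xreal M • two • f by rewrite Hy Hrf -/f clipE.
have yv : valuation (y • d) (xval two f) by rewrite yE; apply: xval_valuation two_le.
have yr : is_real_prop (y • d) by rewrite Hy.
have [pr _] := Ψpos _ yr; have [w yw] := real_valuation pr.
apply/(in_intervalE yv yw xv).
have vl : xval two f l = (e d / pw l)%R.
  rewrite /xval xpow_two (xnum_bits dl) ?monus_self ?rec0 //; by right.
have := HY f; set m := Y • f; have mb : m <= b := Hb f fC.
rewrite sq_ltE; [|exact: mpow2_gt0|exact: lt0S].
have yd : (Ψ • (rf • f)) • m = (Ψ • (y • d)) • m by rewrite Hy.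
rewrite yd (sval_decode (yw m)) sval_pow2 !embedE => wm.
have d1 := real_dist m (l + 1) pr yw; have d2 := real_dist l (l + 1) yr yv.
have t0 := pwV_gt0 l; have tS := pwVS l; have mb' := pwV_le mb.
have tb : ((pw b)^-1 = 8 * (pw l)^-1)%R.
  by rewrite (pwVS b) (pwVS (b + 1)) (pwVS (b + 1 + 1)) -/l; lra.
move: d1 d2 dE; rewrite vl ltr_norml ltr_norml ler_norml.
move=> /andP[a1 a2] /andP[a3 a4] /andP[a5 a6].
by split; exists l; lra.
Qed.

End FanHBU.

(** * Heine-Borel for Cantor space *)

#[local] Arguments xpow {M} β%_M n%_M.
#[local] Arguments pw {M} n%_M.

(** Here [A] is [4 q], [s] is [4^-(n+1)], [va] and [vm] approximate the centre, [w] is the radius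
    and [ua] approximates the covered point. If the centre exceeded the threshold [(A + 2) s], the
    interval would lie above [(A + 1) s], hence above a point whose digit is 0. *)
Lemma digit0_bound (R : realFieldType) (A s w va vm ua ta tS tm : R) :
  ((A + 2) * s + 2 * tm < vm -> w <= s -> va - w + 2 * ta < ua -> ua < (A + 1) * s ->
  - (tS + tm) < va - vm -> ta = 2 * tS -> 0 < tS -> 0 < tm -> False)%R.
Proof. by rewrite !mulrDl => *; lra. Qed.

(** A point with digit 3 is at least [(A + 3) s] up to [tb], so the centre exceeds [(A + 2) s] by
    about [tb]. Three indices later this surplus witnesses the strict inequality. *)
Lemma digit1_bound (R : realFieldType) (A s w vb vc ub tb t1 t2 t3 : R) :
  ((A + 3) * s - tb < ub -> ub + 2 * tb < vb + w -> w <= s -> vb - vc < t1 + t3 ->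
  tb = 2 * t1 -> t1 = 2 * t2 -> t2 = 2 * t3 -> 0 < t3 -> (A + 2) * s + 2 * t3 < vc)%R.
Proof. by rewrite !mulrDl => *; lra. Qed.

Section Digits.
Variable M : rca_model.
Variable E : M ty2.
Hypothesis E_E2 : is_E2 E.
Implicit Types (i j k l m n c d q : M N) (x y z f g X Y Z : M ty1).
Notation F := (frac M).
Notation e := (@embed M).
Local Notation two := (1 + 1).
Local Notation three := (1 + 1 + 1).
Local Notation four := (1 + 1 + 1 + 1).
Local Notation p4 n := (xpow four n%M).

(** Multiplication by 3 turns bits into the base-4 digits 0 and 3. Points that first differ at place
    [n] are then at least [2 * 4^-(n+1)] apart, too far for one open interval of radius
    [4^-(n+1)]. *)
Lemma tri_ex : exists t : M (ty1 ⇒ ty1), forall f n, t • f • n = three * (f • n).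
Proof. by lam. Qed.
Definition tri := proj1_sig (cid tri_ex).
Lemma triE f n : tri • f • n = three * (f • n).
Proof. exact: (proj2_sig (cid tri_ex)). Qed.

Lemma tri_digits f : inC f -> forall n, tri • f • n + 1 <= four.
Proof. by move=> fC n; rewrite triE; have := fC n; rewrite KE => ?; mlra. Qed.

Lemma two_le4 : two <= (four : M N).
Proof. by have := @lt01 M => ?; mlra. Qed.

(* The real [x] exceeds [(4 q + 2) / 4 ^ (n + 1)], the threshold at which the next base-4
   digit of a point of the Cantor set with digits in [{0, 3}] must be 3. *)
Definition exceeds x n q : Prop := exists m,
  sq_lt (sq_add (Sq (four * q + two) 0 (p4 (n + 1))) (Sq two 0 (mpow2 m))) (decode (x • m)).

Lemma sq_lt_sval (p r : sq M) (u v : F) : 0 < sd p -> 0 < sd r -> sval p = u -> sval r = v ->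
  sq_lt p r <-> (u < v)%R.
Proof. by move=> p0 r0 <- <-; apply: sq_ltE. Qed.

Lemma exceedsE x v n q : valuation x v ->
  exceeds x n q <-> exists m, ((4 * e q + 2) / e (p4 (n + 1)) + 2 / pw m < v m)%R.
Proof.
have p40 : 0 < p4 (n + 1) by apply: xpow_gt0 two_le4 _.
have d0 m : 0 < p4 (n + 1) * mpow2 m by apply: mulx_gt0 => //; apply: mpow2_gt0.
move=> xv; suff H m : sq_lt (sq_add (Sq (four * q + two) 0 (p4 (n + 1)))
    (Sq two 0 (mpow2 m))) (decode (x • m)) <->
    ((4 * e q + 2) / e (p4 (n + 1)) + 2 / pw m < v m)%R.
  by split=> -[m h]; exists m; apply/H.
apply: sq_lt_sval; [exact: d0|exact: lt0S| |exact: sval_decode (xv m)].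
apply: etrans (sval_add (p := Sq _ _ _) (q := Sq _ _ _) p40 (mpow2_gt0 m)) _.
rewrite sval_pow2 /sval /= !embedE subr0.
have -> : (1 + 1 = 2 :> F)%R by [].
by have -> : (1 + 1 + 1 + 1 = 4 :> F)%R by lra.
Qed.

(** The surplus [2 / 2^m] in the strict inequality outlasts the passage from [x] to [y] when the
    index is raised by 4. *)
Lemma exceeds_eq x y n q : is_real_prop x -> is_real_prop y -> real_eq_prop x y ->
  exceeds x n q -> exceeds y n q.
Proof.
move=> xr yr; have [v xv] := real_valuation xr; have [w yw] := real_valuation yr.
move/(real_eqE xv yw) => eq /(exceedsE _ _ xv) [m h]; apply/(exceedsE _ _ yw).
exists (m + 1 + 1 + 1 + 1); move: (eq (m + 1 + 1 + 1 + 1)).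
have := real_dist m (m + 1 + 1 + 1 + 1) xr xv.
rewrite (pwVS m) (pwVS (m + 1)) (pwVS (m + 1 + 1)) (pwVS (m + 1 + 1 + 1)) in h *.
have := pwV_gt0 (m + 1 + 1 + 1 + 1).
rewrite ltr_norml ler_norml => t0 /andP[a1 a2] /andP[a3 a4].
by lra.
Qed.

(** This is where (∃²) enters: [exceeds] is an unbounded existential statement about the
    approximations of [x]. *)
Lemma digit_ex : exists d : M (ty1 ⇒ N ⇒ N ⇒ N), forall x n q,
  exceeds x n q /\ d • x • n • q = 1 \/ ~ exceeds x n q /\ d • x • n • q = 0.
Proof.
have [t Ht] : exists t : M (ty1 ⇒ N ⇒ N ⇒ N), forall x n q, exceeds x n q <-> t • x • n • q = 0.
  by rewrite /exceeds /sq_lt /sq_add /decode /num /neg /den /mpow2 /xpow /=; refl.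
have [d Hd] : exists d : M (ty1 ⇒ N ⇒ N ⇒ N), forall x n q,
  d • x • n • q = select M • 1 • 0 • (t • x • n • q) by lam.
by exists d => x n q; rewrite Hd; apply: selectP.
Qed.
Definition digit := proj1_sig (cid digit_ex).
Definition digitP := proj2_sig (cid digit_ex) : forall x n q,
  exceeds x n q /\ digit • x • n • q = 1 \/ ~ exceeds x n q /\ digit • x • n • q = 0.

(** The integer formed by the first [n] base-4 digits read off [x]; each digit is decided at the
    threshold that the earlier ones determine. *)
Lemma prefix_ex : exists h : M (ty1 ⇒ ty1), forall x,
  h • x • 0 = 0 /\ forall n, h • x • (n + 1) = four * (h • x • n) + three * (digit • x • n • (h • x • n)).
Proof.
have [s Hs] : exists s : M (ty1 ⇒ N ⇒ N ⇒ N), forall x n q,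
  s • x • n • q = four * q + three * (digit • x • n • q) by lam.
have [h Hh] : exists h : M (ty1 ⇒ ty1), forall x n, h • x • n = primrec M • (s • x) • 0 • n by lam.
by exists h => x; rewrite Hh primrec0; split=> // n; rewrite !Hh primrecS Hs.
Qed.
Definition prefix := proj1_sig (cid prefix_ex).
Lemma prefix0 x : prefix • x • 0 = 0.
Proof. by case: (proj2_sig (cid prefix_ex) x). Qed.
Lemma prefixS x n :
  prefix • x • (n + 1) = four * (prefix • x • n) + three * (digit • x • n • (prefix • x • n)).
Proof. by case: (proj2_sig (cid prefix_ex) x). Qed.

Lemma digits_ex : exists h : M (ty1 ⇒ ty1), forall x n, h • x • n = digit • x • n • (prefix • x • n).
Proof. by lam. Qed.
Definition digits := proj1_sig (cid digits_ex).
Lemma digitsE x n : digits • x • n = digit • x • n • (prefix • x • n).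
Proof. exact: (proj2_sig (cid digits_ex)). Qed.

(** Digits depend on [x] only through [exceeds], which respects equality of reals. Hence a radius
    defined from [digits • x] gives a function on the reals, as HBU requires. *)
Lemma digits_eq x y : is_real_prop x -> is_real_prop y -> real_eq_prop x y ->
  digits • x = digits • y.
Proof.
move=> xr yr xy.
have yx : real_eq_prop y x.
  have [v xv] := real_valuation xr; have [w yw] := real_valuation yr.
  by apply/(real_eqE yw xv) => n; rewrite distrC; move/(real_eqE xv yw): xy.
have dE n q : digit • x • n • q = digit • y • n • q.
  case: (digitP x n q) => -[ex ->]; case: (digitP y n q) => -[ey ->] //; exfalso.
    by apply: ey; apply: exceeds_eq ex.
  by apply: ex; apply: exceeds_eq ey.
have pE : forall n, prefix • x • n = prefix • y • n.
  apply: ind; [by refl | by rewrite !prefix0 |].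
  by move=> n IH; rewrite !prefixS dE IH.
by apply: app_ext => n; rewrite !digitsE dE pE.
Qed.

Definition cantor_point f : M ty1 := xreal M • four • (tri • f).

(** By induction on [n], the numerator of the point equals the prefix of the centre. The radius
    [4^-l] is at most [4^-(n+1)], so the two bounds above settle the next digit. *)
Lemma cantor_digits (Ψ : M (ty1 ⇒ ty1)) y f l : is_real_prop y -> inC f ->
  valuation (Ψ • y) (fun _ => (e (p4 l))^-1)%R ->
  in_interval_prop Ψ y (cantor_point f) -> forall n, n < l -> f • n = digits • y • n.
Proof.
move=> yr fC Ψv; have [v yv] := real_valuation yr.
have cv := xval_valuation (tri • f) two_le4.
move/(in_intervalE yv Ψv cv) => [[a la] [b lb]].
set u := xval four (tri • f) in cv la lb.
have step n : n < l -> xnum M • four • (tri • f) • n = prefix • y • n -> f • n = digits • y • n.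
  move=> nl eq; rewrite digitsE; set q := prefix • y • n in eq *.
  have pl : ((e (p4 l))^-1 <= (e (p4 (n + 1)))^-1)%R.
    have [i ->] := le_sum (proj1 (lt_succ_le n l) nl).
    rewrite lef_pV2 ?posrE ?(expow_gt0 two_le4) // (xpowD _ (n + 1) i) embedM ler_peMr //.
      by apply: ltW; apply: expow_gt0 two_le4 _.
    by apply/(embed_le 1); have := xpow_gt0 two_le4 i => ?; mlra.
  have qn : xnum M • four • (tri • f) • (n + 1) = four * q + three * (f • n).
    by rewrite xnumS eq triE.
  case: (digitP y n q) => -[ex ->]; move/inCE: (fC) => /(_ n) [f0|f1] //; exfalso.
    move/(exceedsE _ _ yv): ex => [m h].
    have := xval_lt two_le4 (tri_digits fC) (n + 1) a; rewrite -/u qn f0 mulx0 addx0 !embedE.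
    have -> : ((1 + 1 + 1 + 1) * e q + 1 = 4 * e q + 1 :> F)%R by clear; lra.
    have := real_dist (a + 1) m yr yv; rewrite ltr_norml => /andP[h1 _] h3.
    exact: digit0_bound h pl la h3 h1 (pwVS a) (pwV_gt0 (a + 1)) (pwV_gt0 m).
  apply: ex; apply/(exceedsE _ _ yv); exists (b + 1 + 1 + 1).
  have lo : ((4 * e q + 3) / e (p4 (n + 1)) - (pw b)^-1 < u b)%R.
    have lo : ((4 * e q + 3) / e (p4 (n + 1)) = u (n + 1)%M)%R.
      rewrite /u /xval qn f1 !embedE.
      by have -> : (((1 + 1 + 1 + 1) * e q + (1 + 1 + 1) * 1 = 4 * e q + 3 :> F))%R by lra.
    rewrite lo; case: (le_or (n + 1) b) => /le_sum [i ->].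
      have := xval_incr two_le4 (tri_digits fC) (n + 1) i; rewrite -/u.
      by have := pwV_gt0 (n + 1 + i); clear; lra.
    have := proj1 (is_realE cv) (xreal_real two_le4 (tri_digits fC)) b i.
    by rewrite ltr_norml => /andP[]; clear; lra.
  have := real_dist (b + 1) (b + 1 + 1 + 1) yr yv; rewrite ltr_norml => /andP[_ h].
  exact: digit1_bound lo lb pl h (pwVS b) (pwVS (b + 1)) (pwVS (b + 1 + 1))
    (pwV_gt0 (b + 1 + 1 + 1)).
have H n : n <= l -> xnum M • four • (tri • f) • n = prefix • y • n.
  move: n; apply: ind; first by refl.
    by rewrite xnum0 prefix0.
  move=> n IH /lt_succ_le nl; have eq := IH (or_introl nl).
  by rewrite xnumS prefixS triE (step n nl eq) digitsE eq.
by move=> n nl; apply: step => //; apply: H; left.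
Qed.

(** [2 n < 2 ^ (2 n)] gives an explicit index at which the constant radius [1 / n] is seen to be
    positive. *)
Lemma inv_gt_pw n : 0 < n -> (0 + 2 / pw (two * n) < (e n)^-1)%R.
Proof.
move=> /embed_gt0 n0; have := pw_gt (two * n); have := pw_gt0 (two * n).
rewrite add0r !embedE -[X in _ -> _ -> (_ < X)%R]mul1r ltr_pdivlMr // => p0 h.
by rewrite mulrAC ltr_pdivrMr // mul1r; move: h; clear; lra.
Qed.

(* Any [G] on Cantor space induces a cover of [0, 1] whose intervals are so short that
   [cantor_point f] can only be covered by [y] if [f] agrees with [digits • y] up to
   [G (digits • y)]. *)
Lemma HBU_cantor (G : M ty2) : HBU_prop M -> exists k, exists Z : M (N ⇒ ty1),
  forall f, inC f -> exists i, i < k /\ forall n, n <= G • (Z • i) -> f • n = Z • i • n.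
Proof.
move=> hbu; pose r := m_rec M • (m_times M • four) • 1.
(* The radius is [4^-(G (digits x) + 1)]; the added 1 yields agreement up to and including the place
   [G (digits x)]. *)
have [Ψ HΨ] : exists Ψ : M (ty1 ⇒ ty1), forall x n,
  Ψ • x • n = ⟨⟨1, 0⟩, mpred M • (r • (G • (digits • x) + 1))⟩ by lam.
have Ψv x : valuation (Ψ • x) (fun _ => (e (p4 (G • (digits • x) + 1)%M))^-1)%R.
  move=> n; rewrite HΨ; have := rat_code 1 0 (xpow_gt0 two_le4 (G • (digits • x) + 1)).
  by rewrite !embedE subr0 mul1r.
have [|k [y [yr cov]]] := hbu Ψ.
  split=> [x xr|x y [xr yr] xy].
    have t0 := expow_gt0 two_le4 (G • (digits • x) + 1).
    have s0 : (0 < (e (p4 (G • (digits • x) + 1)%M))^-1)%R by rewrite invr_gt0.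
    split; first by apply/(is_realE (Ψv x)) => n i; rewrite subrr normr0; apply: pwV_gt0.
    apply/(real_ltE (@rzero_valuation M) (Ψv x)); exists (two * p4 (G • (digits • x) + 1)).
    exact/inv_gt_pw/(xpow_gt0 two_le4).
  apply/(real_eqE (Ψv x) (Ψv y)) => n; rewrite (digits_eq xr yr xy) subrr normr0.
  by have := pwV_gt0 n; lra.
have [Z HZ] : exists Z : M (N ⇒ ty1), forall i, Z • i = digits • (y • i) by lam.
exists k, Z => f fC; have [i [ik ii]] := cov _ (xreal_unit two_le4 (tri_digits fC)).
exists i; split=> // n le; rewrite HZ.
apply: (cantor_digits (yr i ik) fC (Ψv (y • i)) ii).
by rewrite -HZ; apply: le_ltS.
Qed.

End Digits.

(** * Hierarchies along well-orderings *)

Section Hierarchy.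
Variable M : rca_model.
Variable E : M ty2.
Hypothesis E_E2 : is_E2 E.
Implicit Types (i j k m n p : M N) (f X Y Z : M ty1).

Lemma below_ex : exists b : M (ty1 ⇒ ty1 ⇒ N ⇒ ty1), forall X Y j,
  inC (b • X • Y • j) /\ forall k, b • X • Y • j • k = 1 <->
    exists m i, k = ⟨m, i⟩ /\ olt X i j /\ Y • ⟨m, i⟩ = 1.
Proof.
have [t Ht] : exists t : M (ty1 ⇒ ty1 ⇒ N ⇒ N ⇒ N), forall X Y j k,
    (exists m i, k = ⟨m, i⟩ /\ olt X i j /\ Y • ⟨m, i⟩ = 1) <-> t • X • Y • j • k = 0.
  by rewrite /olt; refl.
have [b Hb] : exists b : M (ty1 ⇒ ty1 ⇒ N ⇒ ty1), forall X Y j k,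
  b • X • Y • j • k = select M • 1 • 0 • (t • X • Y • j • k) by lam.
exists b => X Y j; split=> [|k].
  apply/inCE => k; rewrite Hb.
  by case: (selectP 1 0 (Ht X Y j k)) => -[_ ->]; [right | left].
rewrite Hb; case: (selectP 1 0 (Ht X Y j k)) => -[p ->]; first by split.
by split=> [/esym /one_neq0|/p].
Qed.

Definition below := proj1_sig (cid below_ex).
Lemma below_C X Y j : inC (below • X • Y • j).
Proof. by case: (proj2_sig (cid below_ex) X Y j). Qed.
Lemma belowE X Y j k : below • X • Y • j • k = 1 <->
  exists m i, k = ⟨m, i⟩ /\ olt X i j /\ Y • ⟨m, i⟩ = 1.
Proof. by case: (proj2_sig (cid below_ex) X Y j). Qed.

Lemma C_ext f g : inC f -> inC g -> (forall n, f • n = 1 <-> g • n = 1) -> f = g.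
Proof.
move=> /inCE fC /inCE gC eq; apply: app_ext => n.
case: (fC n) (gC n) (eq n) => -> [->|->] // h; exfalso; apply: (@one_neq0 M).
  by symmetry; apply/h.
by symmetry; apply/h.
Qed.

Lemma below_eq X Y Y' j :
  (forall m i, olt X i j -> Y • ⟨m, i⟩ = 1 <-> Y' • ⟨m, i⟩ = 1) ->
  below • X • Y • j = below • X • Y' • j.
Proof.
move=> eq; apply: C_ext; try exact: below_C.
move=> k; rewrite !belowE; split=> -[m [i [-> [lt /eq e]]]]; exists m, i; split=> //; split=> //;
  exact: e.
Qed.

Definition step f X Y j n : Prop :=
  exists m, f • ⟨⟨n, m⟩, seg M • (below • X • Y • j) • m⟩ = 0.

(** The set quantified in the hierarchy condition is unique by extensionality and is provided by
    [below] using (∃²). Replacing it by [below] makes the condition arithmetical. *)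
Lemma HfE f X Y : Hf_prop f X Y <->
  forall j, X • ⟨j, j⟩ = 1 -> forall n, Y • ⟨n, j⟩ = 1 <-> step f X Y j n.
Proof.
have stepE j n : (exists Z, below_prop X Y j Z /\
    exists m s, initseg Z m s /\ f • ⟨⟨n, m⟩, s⟩ = 0) <-> step f X Y j n.
  split=> [[Z [[ZC Zb] [m [s [/initsegE -> e]]]]]|[m e]].
    exists m; have -> : below • X • Y • j = Z; last by [].
    by apply: C_ext ZC _; [apply: below_C | move=> k; rewrite belowE Zb].
  exists (below • X • Y • j); split; last by exists m, (seg M • (below • X • Y • j) • m);
    split=> //; apply/initsegE.
  by split; [apply: below_C | move=> k; apply: belowE].
by split=> h j jX n; rewrite h // stepE.
Qed.

Lemma olt_refl : exists t : M (ty1 ⇒ N ⇒ N ⇒ N), forall X i j, olt X i j <-> t • X • i • j = 0.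
Proof. by rewrite /olt; refl. Qed.

Lemma LO_refl : exists t : M ty2, forall X, LO_prop X <-> t • X = 0.
Proof. by rewrite /LO_prop; refl. Qed.

Lemma step_refl : exists t : M (ty1 ⇒ ty1 ⇒ ty1 ⇒ N ⇒ N ⇒ N), forall f X Y j n,
  step f X Y j n <-> t • f • X • Y • j • n = 0.
Proof. by rewrite /step; refl. Qed.

Section Order.
Variables X f : M ty1.
Hypothesis X_LO : LO_prop X.
Hypothesis X_WF : WF_prop X.

Local Notation le i j := (X • ⟨i, j⟩ = 1).
Local Notation lt i j := (olt X i j).

Lemma le_field i j : le i j -> le i i /\ le j j.
Proof. by case: X_LO => h _; apply: h. Qed.
Lemma ole_trans i j k : le i j -> le j k -> le i k.
Proof. by case: X_LO => _ [t _] ij jk; apply: t (conj ij jk). Qed.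
Lemma ole_anti i j : le i j -> le j i -> i = j.
Proof. by case: X_LO => _ [_ [t _]] ij ji; apply: t. Qed.
Lemma ole_total i j : le i i -> le j j -> le i j \/ le j i.
Proof. by case: X_LO => _ [_ [_ t]] ii jj; apply: t. Qed.
Lemma olt_le_trans i j k : lt i j -> le j k -> lt i k.
Proof.
by move=> [ij nji] jk; split; [apply: ole_trans jk | move=> /(ole_trans jk)].
Qed.

(** Otherwise choice gives a function leading from each element of [P] to a smaller one, and its
    iteration from [j] descends forever. *)
Lemma minimal (P : M N -> Prop) j : (exists t : M ty1, forall j, P j <-> t • j = 0) -> P j ->
  exists i, P i /\ forall k, P k -> ~ lt k i.
Proof.
move=> [t Ht] Pj; apply: NNPP => nmin.
have [tl Htl] := olt_refl.
have [||s Hs] := @ac00 M (fun i k => P i -> P k /\ lt k i).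
- by refl.
- move=> i; case: (classic (P i)) => [Pi|nPi]; last by exists i.
  apply: NNPP => nex; apply: nmin; exists i; split=> // k Pk ki.
  by apply: nex; exists k.
have [h Hh] : exists h : M ty1, forall n, h • n = m_rec M • s • j • n by lam.
have Ph : forall n, P (h • n).
  apply: ind; [by refl | by rewrite Hh rec0 |].
  by move=> n IH; rewrite Hh recS -Hh; case: (Hs _ IH).
apply: X_WF; exists h => n; rewrite (Hh (n + 1)) recS -Hh.
by case: (Hs _ (Ph n)).
Qed.

Definition error Z n j : Prop := le j j /\ ~ (Z • ⟨n, j⟩ = 1 <-> step f X Z j n).

(* If no set is the hierarchy, let [G Z] locate an error of [Z] at an [X]-minimal level.
   Finitely many [Z i] cover Cantor space in the sense of [HBU_cantor]; extend the one whose
   error level [jm] is maximal to a set [Y] that is correct up to and including [jm].  The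
   [Z i] covering [Y] agrees with [Y] at the error of [Z i], and below its level, which is
   impossible. *)
Lemma hierarchy_exists : HBU_prop M -> exists Z, Hf_prop f X Z.
Proof.
move=> hbu; apply: NNPP => nH.
have [te Hte] : exists t : M (ty1 ⇒ N ⇒ N ⇒ N), forall Z n j, error Z n j <-> t • Z • n • j = 0.
  by have [ts Hts] := step_refl; rewrite /error; refl.
have [tl Htl] := olt_refl; have [ts Hts] := step_refl.
have [||G HG] := @ac10 M (fun Z p => exists n j, p = ⟨n, j⟩ /\ error Z n j /\
    forall n' j', error Z n' j' -> ~ lt j' j).
- by refl.
- move=> Z; have [j0 [n0 err0]] : exists j n, error Z n j.
    apply: NNPP => nerr; apply: nH; exists Z; apply/HfE => j jX n.
    by apply: NNPP => ne; apply: nerr; exists j, n.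
  have [||j [[n err] minj]] := @minimal (fun j => exists n, error Z n j) j0.
  + by refl.
  + by exists n0.
  by exists ⟨n, j⟩, n, j; split=> //; split=> // n' j' err'; apply: minj; exists n'.
have [k [Z cov]] := HBU_cantor E_E2 G hbu.
have [J HJ] : exists J : M ty1, forall i, J • i = msnd M • (G • (Z • i)) by lam.
have {}HG i : exists n, G • (Z • i) = ⟨n, J • i⟩ /\ error (Z • i) n (J • i) /\
    forall n' j', error (Z • i) n' j' -> ~ lt j' (J • i).
  by have [n [j [e h]]] := HG (Z • i); exists n; rewrite HJ e msndE.
have J_field i : le (J • i) (J • i) by have [n [_ [[]]]] := HG i.
have k0 : 0 < k.
  (* Any element of Cantor space will do: since it is covered, the cover is nonempty. *)
  have [i [ik _]] := cov _ (below_C X X 0).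
  by case: (mle0x k) => // e; move: ik; rewrite -e => /mltx0.
(* The length of the cover may be nonstandard, so even this maximum is obtained by induction inside
   the model. *)
have [im [imk J_max]] : exists im, im < k /\ forall i, i < k -> le (J • i) (J • im).
  have H : forall k', 0 < k' -> exists im, im < k' /\ forall i, i < k' -> le (J • i) (J • im).
    apply: ind; [by refl | by move/mlt_irr |].
    move=> k' IH _; case: (mle0x k') => [/IH [im [imk mx]]|<-]; last first.
      by exists 0; split; [apply: lt0S | move=> i /ltS_le [/mltx0|->]].
    have lt' : im < k' + 1 by apply: mlt_trans imk (lt_succ k').
    case: (ole_total (J_field im) (J_field k')) => h.
      exists k'; split; first exact: lt_succ.
      by move=> i /ltS_le [/mx h'|->//]; apply: ole_trans h' h.
    by exists im; split=> // i /ltS_le [/mx//|->].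
  exact: H.
set jm := J • im in J_max.
have [_ [_ [_ errm]]] := HG im; rewrite -/jm in errm.
have [t Ht] : exists t : M ty1, forall p,
    (exists n j, p = ⟨n, j⟩ /\
      (lt j jm /\ Z • im • ⟨n, j⟩ = 1 \/ j = jm /\ step f X (Z • im) jm n)) <-> t • p = 0.
  by refl.
have [Y HY] : exists Y, forall p, Y • p = select M • 1 • 0 • (t • p) by lam.
have YC : inC Y.
  by apply/inCE => p; rewrite HY; case: (selectP 1 0 (Ht p)) => -[_ ->]; [right | left].
have YE n j : Y • ⟨n, j⟩ = 1 <->
    lt j jm /\ Z • im • ⟨n, j⟩ = 1 \/ j = jm /\ step f X (Z • im) jm n.
  rewrite HY; case: (selectP 1 0 (Ht ⟨n, j⟩)) => -[h ->].
    by split=> // _; move: h => [n' [j' [/pair_inj [-> ->]]]].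
  by split=> [/esym /one_neq0//|h']; case: h; exists n, j.
have Y_correct n j : le j jm -> Y • ⟨n, j⟩ = 1 <-> step f X Y j n.
  move=> jjm; have -> : step f X Y j n <-> step f X (Z • im) j n.
    rewrite /step (@below_eq X Y (Z • im) j) // => m i ij; rewrite YE.
    have ijm := olt_le_trans ij jjm.
    split=> [[[]//|[ei _]]|h]; last by left.
    by case: ijm => h []; move: h; rewrite ei.
  rewrite YE; case: (classic (j = jm)) => [->|ne].
    split=> [[[[h []]]//|[]//]|h]; by right.
  have jlt : lt j jm by split=> // h; apply: ne; apply: ole_anti.
  have : Z • im • ⟨n, j⟩ = 1 <-> step f X (Z • im) j n.
    apply: NNPP => nc; apply: (errm n j) jlt; split=> //.
    by case: (le_field jjm).
  by move=> <-; split=> [[[_ h] //|[/ne //]]|h]; left.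
have [i [ik agree]] := cov Y YC.
have [n [Gi [[_ err] mini]]] := HG i.
have Ji_le := J_max i ik.
(* Below its error level [Z • i] is correct, and so is [Y]; at a minimal level of disagreement both
   would be computed from the same data. *)
have same m i' : lt i' (J • i) -> Y • ⟨m, i'⟩ = 1 <-> Z • i • ⟨m, i'⟩ = 1.
  move=> lt0; apply: NNPP => ne.
  have [|j [[jlt [m' ne']] minj]] := @minimal (fun j => lt j (J • i) /\
      exists m, ~ (Y • ⟨m, j⟩ = 1 <-> Z • i • ⟨m, j⟩ = 1)) i' _ (conj lt0 (ex_intro _ m ne)).
    by refl.
  apply: ne'; rewrite Y_correct; last exact: ole_trans (proj1 jlt) Ji_le.
  have -> : step f X Y j m' <-> step f X (Z • i) j m'.
    rewrite /step (@below_eq X Y (Z • i) j) // => m2 j2 lt2.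
    apply: NNPP => ne2; apply: (minj j2) => //; split; last by exists m2.
    exact: olt_le_trans lt2 (proj1 jlt).
  apply: NNPP => ne2; apply: (mini m' j _ jlt); split; last by move=> h; apply: ne2; rewrite h.
  by case: (le_field (proj1 jlt)).
apply: err; rewrite -Gi -agree ?Gi; last by right.
by rewrite Y_correct // /step (@below_eq X Y (Z • i) (J • i)).
Qed.

End Order.

Lemma E2_HBU_UATR : models M (QF_AC ty2 ty1) -> HBU_prop M -> UATR_prop M.
Proof.
move=> mAC hbu.
(* Choice ranges over type 2, so [X] and [f] are packed into the functional sending [g] to
   [⟨X • (g • 0), f • (g • 0)⟩] and read off again at constant functions. *)
have [x Hx] : exists x : M (ty2 ⇒ ty1), forall F n, x • F • n = mfst M • (F • (m_K M N N • n)) by lam.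
have [s Hs] : exists s : M (ty2 ⇒ ty1), forall F n, s • F • n = msnd M • (F • (m_K M N N • n)) by lam.
have [||Φ HΦ] := ac21 mAC (P := fun F Z =>
    (forall j, x • F • ⟨j, j⟩ = 1 -> forall n,
       Z • ⟨n, j⟩ = 1 <-> step (s • F) (x • F) Z j n) \/
    (forall n, olt (x • F) (Z • (n + 1)) (Z • n)) \/ ~ LO_prop (x • F)).
- by have [t1 H1] := step_refl; have [t2 H2] := olt_refl; have [t3 H3] := LO_refl; refl.
- move=> F; case: (classic (LO_prop (x • F))) => [lo|nlo]; last first.
    by exists (x • F); right; right.
  case: (classic (WF_prop (x • F))) => [wf|/NNPP [h Hh]].
    by have [Z /HfE HZ] := hierarchy_exists (s • F) lo wf hbu; exists Z; left.
  by exists h; right; left.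
have [code Hcode] : exists c : M (ty1 ⇒ ty1 ⇒ ty2), forall X f g,
  c • X • f • g = ⟨X • (g • 0), f • (g • 0)⟩ by lam.
have [Ψ HΨ] : exists Ψ : M (ty1 ⇒ ty1 ⇒ ty1), forall X f, Ψ • X • f = Φ • (code • X • f) by lam.
exists Ψ => X f [lo wf].
have xE : x • (code • X • f) = X by apply: app_ext => n; rewrite Hx Hcode mfstE KE.
have sE : s • (code • X • f) = f by apply: app_ext => n; rewrite Hs Hcode msndE KE.
have := HΦ (code • X • f); rewrite -HΨ xE sE.
case=> [h|[h|//]]; first exact/HfE.
by case: wf; exists (Ψ • X • f).
Qed.

End Hierarchy.

Theorem theorem3p15 : RCA0ω_FF_QFAC21 ⊢ (E2 ↔ (UATR ∨ ¬ HBU)).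
Proof.
apply: completeness.
- exact: RCA0ω_FF_QFAC21_sub_closed.
- by move=> Γ ρ τ; apply: extend_l; apply: extend_l; apply: rca_ext.
move=> M0 models_T ρ.
have rca : models M0 RCA0ω.
  by move=> Γ A σ a; apply: models_T; apply: extend_l; apply: extend_l.
pose M := RcaModel rca.
(* The predicates [_prop] below are convertible to satisfaction of the formulas in [M]. *)
have ac : models M (QF_AC ty2 ty1).
  by move=> Γ A σ a; apply: models_T; apply: extend_r.
have ff : FF_prop M.
  apply: (models_T nil FF ρ).
  by apply: extend_l; apply: extend_r; apply: just_FF_intro.
suff : E2_prop M <-> UATR_prop M \/ ~ HBU_prop M by [].
split=> [[E [_ E_E2]]|[/UATR_E2//|nHBU]].
  by case: (classic (HBU_prop M)) => h; [left; apply: E2_HBU_UATR E_E2 ac h | right].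
by apply: NNPP => /(grilliot ac) cont; apply: nHBU; apply: fan_HBU.
Qed.
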